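(* Let $p\ge1$ be an integer, let $c\in\mathcal C^{p+1}(\mathcal D;\mathbb R^d)$ be a velocity field and $u_0\in\mathcal C^p(\mathcal D)$. Let $u$ be the solution of the stochastic transport equation $$du(t,x)+c(x)\cdot\nabla u(t,x)\circ dW(t)=0,\qquad u(0,x)=u_0(x),\qquad x\in\mathcal D,\ t\in[0,T].$$ Then (for small $\epsilon>0$) there exists a subspace $V=V_\epsilon$ of $H$ of dimension $o(\epsilon^{-2/p})$ (as $\epsilon\to0$) such that $$\|P_Vu-u\|_{L^2(\Omega;L^2([0,T];H))}\ \lesssim\ \epsilon,$$ where the implicit constant does not depend on $\epsilon$.
   Context: $\mathcal D=\mathbb T^d$ is the $d$-dimensional torus, $H=L^2(\mathcal D)$, $T>0$, $W$ is a real-valued standard Brownian motion (depending on time only) on a complete filtered probability space $(\Omega,\mathcal F,(\mathcal F_t)_{t\ge0},\mathbb P)$, and $\circ\,dW$ is the Stratonovich integral. $P_V$ is the orthogonal projection of $H$ onto $V$, applied at each time. The solution is understood via stochastic characteristics: let $X_{0,t}(x)$ be the solution at time $t$ of $dX(t)=-c(X(t))\circ dW(t)$ with $X(0)=x$; then $u$ satisfies $u(t,X_{0,t}(x))=u_0(x)$, and, the characteristics not intersecting, $u(t,y)=u_0(X_{t,0}(y))$, where $X_{t,0}$ is the inverse of $X_{0,t}$. *)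

(* Defs.v *)
From HB Require Import structures.
From mathcomp Require Import all_boot all_order all_algebra.
From mathcomp Require Import all_classical all_reals all_analysis.

Set Implicit Arguments.
Unset Strict Implicit.
Unset Printing Implicit Defensive.
Import Order.TTheory GRing.Theory Num.Theory.
Import numFieldNormedType.Exports.

Local Open Scope classical_set_scope.
Local Open Scope ring_scope.

(** * The torus

  The torus is R^d / Z^d.  A function on it is a Z^d-periodic function on R^d,
  and L^2 of the torus is L^2 of the unit cube, coordinates being given by
  tuples because ['rV_d] carries no measurable structure in the library. *)

Section torus.
Context {R : realType}.

Definition periodic (S : Type) d (f : 'rV[R]_d -> S) :=
  forall x i, f (x + 'e_i) = f x.

(* C^k, by existence and continuity of the partial derivatives up to order k *)
Fixpoint Ck (k : nat) d (f : 'rV[R]_d -> R) : Prop :=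
  if k is k'.+1 then
    continuous f /\
    forall i, (forall x, derivable f x 'e_i) /\ Ck k' (fun x => 'D_('e_i) f x)
  else continuous f.

Definition torus_Ck k d (f : 'rV[R]_d -> R) := periodic f /\ Ck k f.

Definition torus_Ck_vect k d (c : 'rV[R]_d -> 'rV[R]_d) :=
  periodic c /\ forall i, Ck k (fun x => c x 0 i).

Definition tuple_cons n (xs : measurableTypeR R * n.-tuple (measurableTypeR R))
  : n.+1.-tuple (measurableTypeR R) := [tuple of xs.1 :: xs.2].

Lemma measurable_tuple_cons n : measurable_fun setT (@tuple_cons n).
Proof. exact: measurable_cons. Qed.

HB.instance Definition _ n := isMeasurableFun.Build _ _ _ _ (@tuple_cons n)
  (@measurable_tuple_cons n).

(* Lebesgue measure on the unit cube [0, 1]^n *)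
Fixpoint cube_measure n : probability (n.-tuple (measurableTypeR R)) R :=
  if n is n'.+1 then
    distribution (uniform_prob (@ltr01 R) \x cube_measure n')%E (@tuple_cons n')
  else dirac [tuple].

Definition cube_point d (y : d.-tuple (measurableTypeR R)) : 'rV[R]_d :=
  \row_i tnth y i.

End torus.

(** * Finite-dimensional subspaces of L^2 and orthogonal projections

  Elements of L^2 are represented by functions, so a subspace is a set of
  functions saturated for equality almost everywhere, and its dimension is
  computed modulo that equality. *)

Section L2.
Context {d : measure_display} {T : measurableType d} {R : realType}.
Variable mu : {measure set T -> \bar R}.

Definition L2_inner (f g : T -> R) : R := \int[mu]_x (f x * g x).

Definition L2_subspace (V : set (T -> R)) :=
  [/\ (forall f, V f -> f \in Lfun mu 2%:E),
      V (cst 0),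
      (forall (a : R) f g, V f -> V g -> V (a \*: f \+ g)) &
      (forall f g, V f -> g \in Lfun mu 2%:E -> f = g %[ae mu] -> V g)].

Definition L2_dim (V : set (T -> R)) (n : nat) :=
  exists e : 'I_n -> T -> R,
    [/\ (forall i, V (e i)),
        (forall a : 'I_n -> R,
           (fun x => \sum_i a i * e i x) = cst 0 %[ae mu] ->
           forall i, a i = 0) &
        (forall f, V f -> exists a : 'I_n -> R,
           f = (fun x => \sum_i a i * e i x) %[ae mu])].

(* [L2_proj V f] is determined up to equality almost everywhere when [f] is
   square-integrable and [V] is finite-dimensional. *)
Definition L2_proj (V : set (T -> R)) (f : T -> R) : T -> R :=
  xget (cst 0)
    [set g | V g /\ forall v, V v -> L2_inner (f \- g) v = 0].

End L2.

(** * Stochastic calculus *)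

Section stochastic.
Context {d : measure_display} {Omega : measurableType d} {R : realType}.
Variable P : probability Omega R.

Definition complete_filtration (F : R -> set (set Omega)) :=
  [/\ measure_is_complete P,
      (forall t, 0 <= t -> sigma_algebra setT (F t) /\ F t `<=` measurable),
      (forall s t, 0 <= s -> s <= t -> F s `<=` F t) &
      P.-negligible `<=` F 0].

Definition rv_measurable (G : set (set Omega)) (X : Omega -> R) :=
  forall B : set (measurableTypeR R), measurable B -> G (X @^-1` B).

Definition adapted (F : R -> set (set Omega)) (I : set R)
    (X : R -> Omega -> R) :=
  forall t, I t -> rv_measurable (F t) (X t).

Definition continuous_paths (I : set R) (X : R -> Omega -> R) :=
  {ae P, forall w, {within I, continuous (fun t => X t w)}}.

Definition brownian_motion (F : R -> set (set Omega)) (W : R -> Omega -> R) :=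
  [/\ adapted F `[0, +oo[ W,
      {ae P, forall w, W 0 w = 0},
      continuous_paths `[0, +oo[ W,
      (forall s t, 0 <= s -> s < t ->
         forall B : set (measurableTypeR R), measurable B ->
         P ((W t \- W s) @^-1` B)
         = normal_prob 0 (Num.sqrt (t - s)) B) &
      (forall s t, 0 <= s -> s < t ->
         forall A, F s A ->
         forall B : set (measurableTypeR R), measurable B ->
         P (A `&` ((W t \- W s) @^-1` B))
         = (P A * P ((W t \- W s)%R @^-1` B))%E)].

Section horizon.
Variables (F : R -> set (set Omega)) (T : R).

Definition martingale (M : R -> Omega -> R) :=
  [/\ adapted F `[0, T] M,
      (forall t, 0 <= t <= T -> P.-integrable setT (EFin \o M t)) &
      (forall s t, 0 <= s -> s <= t -> t <= T -> forall A, F s A ->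
         (\int[P]_(w in A) (M t w)%:E = \int[P]_(w in A) (M s w)%:E)%E)].

Definition stopping_time (tau : Omega -> R) :=
  (forall w, 0 <= tau w) /\ forall t, 0 <= t <= T -> F t [set w | tau w <= t].

Definition continuous_local_martingale (M : R -> Omega -> R) :=
  [/\ adapted F `[0, T] M,
      continuous_paths `[0, T] M &
      exists tau : nat -> Omega -> R,
        [/\ (forall n, stopping_time (tau n)),
            (forall n w, tau n w <= tau n.+1 w),
            {ae P, forall w, exists n, T <= tau n w} &
            forall n, martingale (fun t w => M (Num.min t (tau n w)) w)]].

Definition continuous_finite_variation (A : R -> Omega -> R) :=
  [/\ adapted F `[0, T] A,
      continuous_paths `[0, T] A &
      {ae P, forall w, bounded_variation 0 T (fun t => A t w)}].

Definition continuous_semimartingale (Z : R -> Omega -> R) :=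
  [/\ adapted F `[0, T] Z,
      continuous_paths `[0, T] Z &
      exists M A : R -> Omega -> R,
        [/\ continuous_local_martingale M,
            continuous_finite_variation A &
            {ae P, forall w, forall t, 0 <= t <= T ->
               Z t w = M t w + A t w}]].

End horizon.

Definition stratonovich_sum (Y Z : R -> Omega -> R) (a : R) (s : seq R)
    (w : Omega) : R :=
  \sum_(x <- zip (a :: s) s)
    2^-1 * (Y x.1 w + Y x.2 w) * (Z x.2 w - Z x.1 w).

Definition mesh_lt (a : R) (s : seq R) (eta : R) :=
  forall x, x \in zip (a :: s) s -> x.2 - x.1 < eta.

(* J is the Stratonovich integral of Y against Z over [0, t], that is, the
   limit in probability of the trapezoidal sums as the mesh tends to 0. *)
Definition is_stratonovich_integral (Y Z : R -> Omega -> R) (t : R)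
    (J : Omega -> R) :=
  forall e delta : R, 0 < e -> 0 < delta ->
  exists2 eta : R, 0 < eta &
    forall s, itv_partition 0 t s -> mesh_lt 0 s eta ->
    (P [set w | (e < `|stratonovich_sum Y Z 0 s w - J w|)%R] < delta%:E)%E.

Section characteristics.
Variables (n : nat) (F : R -> set (set Omega)) (W : R -> Omega -> R).
Variables (c : 'rV[R]_n -> 'rV[R]_n) (T : R).

(* X is a lift to R^n of a solution of the Stratonovich equation
   dX = - c(X) o dW on [0, T], X(0) = x, in the integrated form
   x - X(t) = \int_0^t c(X) o dW.  The minus sign matters little: the class of
   admissible fields c is symmetric, and - W is again a Brownian motion. *)
Definition characteristic (x : 'rV[R]_n) (X : R -> Omega -> 'rV[R]_n) :=
  [/\ (forall i, continuous_semimartingale F T (fun t w => X t w 0 i)),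
      {ae P, forall w, X 0 w = x} &
      forall t i, 0 <= t <= T ->
        is_stratonovich_integral (fun s w => c (X s w) 0 i) W t
          (fun w => x 0 i - X t w 0 i)].

(* [X t x w] is a lift to R^n of the stochastic flow X_{0,t}(x) on the torus,
   in its jointly continuous version; [Y t y w] is the inverse X_{t,0}(y). *)
Definition characteristic_flow
    (X Y : R -> 'rV[R]_n -> Omega -> 'rV[R]_n) :=
  [/\ (forall x, characteristic x (fun t => X t x)),
      {ae P, forall w, {within `[0, T]%classic `*` setT,
         continuous (fun tx : R * 'rV[R]_n => X tx.1 tx.2 w)}},
      {ae P, forall w t x i, 0 <= t <= T ->
         X t (x + 'e_i) w = X t x w + 'e_i} &
      {ae P, forall w t, 0 <= t <= T ->
         cancel (fun x => X t x w) (fun y => Y t y w) /\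
         cancel (fun y => Y t y w) (fun x => X t x w)}].

Definition transport_solution (u0 : 'rV[R]_n -> R)
    (u : R -> 'rV[R]_n -> Omega -> R) :=
  exists X Y : R -> 'rV[R]_n -> Omega -> 'rV[R]_n,
    characteristic_flow X Y /\
    {ae P, forall w t, 0 <= t <= T ->
       (forall x, u t (X t x w) w = u0 x) /\
       (forall y, u t y w = u0 (Y t y w))}.

End characteristics.

(* || v ||_{L^2(Omega; L^2([0,T]; H))} for H = L^2(mu), with values in
   [0, +oo] *)
Definition L2_norm3 d' (S : measurableType d') (mu : {measure set S -> \bar R})
    (T : R) (v : R -> Omega -> S -> R) : \bar R :=
  Lnorm P 2%:E (fun w =>
    Lnorm (mrestr lebesgue_measure (measurable_itv `[0, T])) 2%:E (fun t =>
      Lnorm mu 2%:E (EFin \o v t w))).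

End stochastic.

(* Main.v *)
(** The characteristic through [x] is [X_t(x) = psi_{-W_t}(x)], where [psi] is the
  flow of [c].  To see this, compare both sides along uniform grids.  The
  trapezoidal sums, refined inside each step of a coarse grid, turn the
  Stratonovich equation into its Ito form up to a term vanishing in probability,
  because the quadratic variations of [X] and [W] stay bounded in probability;
  Taylor's formula gives the same Ito form for [psi_{-W_t}(x)].  A discrete
  Gronwall argument for [E min(|X_t - psi_{-W_t}(x)|, 1)^2] concludes.

  Hence [u(t, y) = u0(psi_{W_t}(y))] depends on time only through the scalar
  [W_t].  With [A f = c . grad f], the Taylor expansion of [s |-> u0 o psi_s] at
  the points [k h], [|k| h <= M], shows that the functions [(A^j u0) o psi_{k h}],
  [j < p], approximate it up to [O(h^p)] on [[-M, M]].  Take [h = eps^(1/p)] and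
  [M = eps^(-1/(2 p))]: the error is [O(eps)] while [|W_t| <= M], the Gaussian
  moments of [W_t] take care of [|W_t| > M], and the dimension is
  [O(M / h) = O(eps^(-3/(2 p))) = o(eps^(-2/p))]. *)

Require Import Defs.
From HB Require Import structures.
From mathcomp Require Import all_boot all_order all_algebra.
From mathcomp Require Import all_classical all_reals all_analysis.
From mathcomp Require Import measurable_realfun.
From mathcomp Require Import ring lra.
Import Order.TTheory GRing.Theory Num.Theory.
Import numFieldNormedType.Exports.
Local Open Scope classical_set_scope.
Local Open Scope ring_scope.

Set Implicit Arguments.
Unset Strict Implicit.
Unset Printing Implicit Defensive.

(** * Ordinary differential equations *)

(** A characteristic comes without moment bounds, and its equation only says that trapezoidal sums
    converge in probability, so no stochastic integral is ever formed: the comparison takes place on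
    finite sums over uniform grids. The obstacle is the correction term. A trapezoidal sum contains
    [(c(X_{i+1}) - c(X_i)) dW_i], where the increment of [X] has to be replaced by [- c(X_i) dW_i]
    with an error that, multiplied by [dW_i] and summed over the grid, still vanishes. Hence the
    equation is needed on each single grid step. Errors small in probability turn into bounds on
    means because the distance is truncated at 1.

    The exponent of [M] leaves room on both sides. With [M = eps^(-a)] the dimension is of order
    [eps^(-1/p - a)], which asks for [a < 1/p], while any [a > 0] can be paid for by a moment of
    [W_t] of order [2/a]. The choice [a = 1/(2 p)] makes this order the even integer [4 p]. *)

Section row_norm.
Context {R : realType} {d : nat}.
Implicit Types x y : 'rV[R]_d.

Lemma coord_le_norm x i : `|x 0 i| <= `|x|.
Proof.
rewrite [leRHS]/Num.norm/= mx_normrE; apply/bigmax_geP; right.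
by exists (0, i).
Qed.

Lemma row_norm_le x (e : R) : 0 <= e -> (forall i, `|x 0 i| <= e) -> `|x| <= e.
Proof.
move=> e0 xe; rewrite [leLHS]/Num.norm/= mx_normrE; apply/bigmax_leP; split => //.
by move=> [a i] _ /=; rewrite (ord1 a).
Qed.

Lemma row_subE x y i : (x - y) 0 i = x 0 i - y 0 i.
Proof. by rewrite !mxE. Qed.

End row_norm.

Section mean_value.
Context {R : realType}.

Lemma mean_value (F f : R -> R) : (forall x : R, is_derive x 1 F (f x)) ->
  forall a b, exists xi,
    [/\ `|xi - a| <= `|b - a|, (a <= xi <= b) || (b <= xi <= a)
      & F b - F a = f xi * (b - a)].
Proof.
move=> Ff a b.
have cF : continuous F.
  by move=> x; apply/differentiable_continuous/derivable1_diffP; case: (Ff x).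
have [ab|/ltW ba] := leP a b.
  have [|xi] := @MVT_segment R F f a b ab (fun x _ => Ff x).
    exact: continuous_subspaceT.
  rewrite in_itv/= => /andP[axi xib] ->; exists xi; rewrite axi xib.
  by rewrite ger0_norm ?subr_ge0// ger0_norm ?subr_ge0// lerB.
have [|xi] := @MVT_segment R F f b a ba (fun x _ => Ff x).
  exact: continuous_subspaceT.
rewrite in_itv/= => /andP[bxi xia] e; exists xi; rewrite bxi xia orbT.
split => //; last by rewrite -[b - a]opprB mulrN -e opprB.
by rewrite distrC ger0_norm ?subr_ge0// distrC ger0_norm ?subr_ge0// lerB.
Qed.

Lemma le_derive_pow (F f : R -> R) (K : R) k :
  (forall x : R, is_derive x 1 F (f x)) -> F 0 = 0 -> 0 <= K ->
  (forall x : R, `|f x| <= K * `|x| ^+ k) -> forall x, `|F x| <= K * `|x| ^+ k.+1.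
Proof.
move=> Ff F0 K0 fK x; have [xi [+ _]] := mean_value Ff 0 x.
rewrite F0 !subr0 => xix ->; rewrite normrM exprSr mulrA ler_pM//.
by rewrite (le_trans (fK _))// ler_wpM2l// lerXn2r// nnegrE.
Qed.

End mean_value.

Section telescoping.
Context {R : realType} {d : nat}.
Implicit Types f : 'rV[R]_d -> R.

Lemma is_derive_line f (x v : 'rV[R]_d) (r : R) :
  (forall x, derivable f x v) ->
  is_derive r 1 (fun r => f (x + r *: v)) ('D_v f (x + r *: v)).
Proof.
move=> df; have E : (fun h => h^-1 *: (((fun r => f (x + r *: v)) \o shift r) (h *: (1:R)) -
      (fun r => f (x + r *: v)) r)) =
    (fun h => h^-1 *: ((f \o shift (x + r *: v)) (h *: v) - f (x + r *: v))).
  apply/funext => h /=; rewrite [_ *: 1]mulr1; congr (_ *: (f _ - _)).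
  by rewrite scalerDl [in RHS]addrC -addrA [in RHS]addrA [_ *: v + _]addrC !addrA.
by split; rewrite /derivable /derive E//; exact: df.
Qed.

(* Moving from [x] to [y] one coordinate at a time needs only partial
   derivatives, not differentiability. *)
Lemma coordinatewise_mean_value f (x y : 'rV[R]_d) :
  (forall i x, derivable f x 'e_i) ->
  exists2 z : 'I_d -> 'rV[R]_d, (forall i, `|z i - x| <= `|y - x|) &
    f y - f x = \sum_i 'D_('e_i) f (z i) * (y 0 i - x 0 i).
Proof.
move=> df; pose w k : 'rV[R]_d := \row_j (if (j < k)%N then y 0 j else x 0 j).
have wS (k : 'I_d) : w k.+1 = w k + (y 0 k - x 0 k) *: 'e_k.
  apply/rowP => j; rewrite !mxE/= ltnS.
  have [->|jk] := eqVneq j k; first by rewrite leqnn ltnn/= mulr1 addrC subrK.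
  rewrite leq_eqVlt (negbTE (jk : j != k :> nat))/= mulr0 addr0//.
have step (k : 'I_d) : exists z, `|z - x| <= `|y - x| /\
    f (w k.+1) - f (w k) = 'D_('e_k) f z * (y 0 k - x 0 k).
  have [xi [xile _]] := mean_value (fun r => is_derive_line (w k) r (df k)) 0 (y 0 k - x 0 k).
  rewrite wS scale0r addr0 !subr0 in xile * => e; exists (w k + xi *: 'e_k).
  split => //; apply: row_norm_le => // j; rewrite !mxE/=.
  have [->|jk] := eqVneq j k.
    rewrite ltnn mulr1 addrAC subrr add0r (le_trans xile)//.
    by have := coord_le_norm (y - x) k; rewrite !mxE.
  rewrite mulr0 addr0; case: ltnP => _; last by rewrite subrr normr0.
  by have := coord_le_norm (y - x) j; rewrite !mxE.
have [z zP] := @choice _ _ (fun (k : 'I_d) z => `|z - x| <= `|y - x| /\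
    f (w k.+1) - f (w k) = 'D_('e_k) f z * (y 0 k - x 0 k)) step.
exists z; first by move=> i; case: (zP i).
rewrite -(eq_bigr _ (fun i _ => (zP i).2)).
rewrite -(big_mkord predT (fun k => f (w k.+1) - f (w k))) telescope_sumr//.
by congr (f _ - f _); apply/rowP => j; rewrite mxE ?ltn_ord.
Qed.

End telescoping.

Section primitive.
Context {R : realType}.
Notation mu := (@lebesgue_measure R).

Lemma continuous_itv_integrable (f : R -> R) (a b : R) : continuous f ->
  mu.-integrable `[a, b] (EFin \o f).
Proof.
move=> cf; apply: continuous_compact_integrable; first exact: segment_compact.
exact: continuous_subspaceT.
Qed.

(** The integral from 0 to [s], with [s] of either sign, is a difference of two integrals from a
    common left endpoint [- S]. Its value is the same for all [S >= 0] with [- S <= s], so [S] may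
    vary with [s] in the definition of the primitive, while a fixed [S] serves to differentiate near
    a given [x]. *)
Lemma primitive_exists (f : R -> R) : continuous f ->
  exists F : R -> R, F 0 = 0 /\ forall x : R, is_derive x 1 F (f x).
Proof.
move=> cf; pose I a s : R := \int[mu]_(t in `[a, s]) f t.
have split a b s : a <= b -> b <= s -> I a s = I a b + (\int[mu]_(t in `]b, s]) f t).
  move=> ab bs; apply/eqP; rewrite addrC -subr_eq; apply/eqP.
  by apply: Rintegral_itvB; rewrite ?bnd_simp//; exact: continuous_itv_integrable.
pose G S s := I (- S) s - I (- S) 0.
have GE S S' s : 0 <= S -> S <= S' -> - S <= s -> G S' s = G S s.
  move=> S0 SS' Ss; rewrite /G.
  rewrite (split (- S') (- S) s) ?lerN2// (split (- S') (- S) 0) ?lerN2 ?oppr_le0//.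
  rewrite (split (- S) (- S) s)// (split (- S) (- S) 0) ?oppr_le0//.
  by ring.
exists (fun s => G (`|s| + 1) s); split; first by rewrite /G subrr.
move=> x; pose S := `|x| + 2.
have S0 : 0 <= S by rewrite addr_ge0.
have Gx : is_derive x 1 (G S) (f x).
  have [||dI IE] := @continuous_FTC1_closed R f (- S) x (x + 1) _
      (continuous_itv_integrable _ _ cf) _ (cf x).
  - by rewrite ltrDl.
  - by rewrite /S ltrNl; have := ler_norm (- x); rewrite normrN; lra.
  have IS : is_derive x 1 (I (- S)) (f x).
    by split; [exact: dI|rewrite -derive1E].
  have := @is_deriveB _ _ _ _ _ _ _ _ _ IS (@is_derive_cst _ _ _ (I (- S) 0) x 1).
  by rewrite subr0.
apply: near_eq_is_derive Gx; near=> s.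
have xs : `|s - x| <= 1.
  by near: s; apply: (@cvgr_distC_le _ _ _ _ _ id x) => //; exact: cvg_id.
have sx1 : `|s| <= `|x| + 1.
  by rewrite -[s](subrK x) (le_trans (ler_normD _ _))// addrC lerD.
by apply: GE => //; rewrite /S; have := ler_norm (- s); rewrite normrN; lra.
Unshelve. all: by end_near. Qed.

Lemma is_derive_scale_expR (K l x : R) :
  is_derive x 1 (fun y => K / l * expR (l * y)) (K / l * (l * expR (l * x))).
Proof.
have lx : is_derive x 1 (fun y : R => l * y) l.
  have := @is_deriveZ _ _ _ _ l x 1 _ (@is_derive_id _ _ x 1).
  by rewrite [_ *: 1]mulr1.
have := @is_derive1_comp _ expR (fun y : R => l * y) x _ _ (is_derive_expR _) lx.
move=> /(@is_deriveZ _ _ _ _ (K / l) x 1).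
by rewrite [expR _ * l]mulrC.
Qed.

(** Integrating against the weight [expR (l * |x|)] gains a factor [1 / l]. With [l = 2 L] this
    makes the Picard map a contraction by one half on the whole line at once (Bielecki's weighted
    norm). On the positive side [K / l * expR (l * y) - H y] is nondecreasing; the negative side
    follows by reflection. *)
Lemma le_derive_expR (F f : R -> R) (K l : R) : 0 < l ->
  (forall x : R, is_derive x 1 F (f x)) ->
  (forall x : R, `|f x| <= K * expR (l * `|x|)) ->
  forall x, `|F x - F 0| <= K / l * expR (l * `|x|).
Proof.
move=> l0.
have pos (H h : R -> R) : (forall x : R, is_derive x 1 H (h x)) ->
    (forall x : R, 0 <= x -> `|h x| <= K * expR (l * x)) ->
    forall x, 0 <= x -> H x - H 0 <= K / l * expR (l * x).
  move=> Hh hK x x0.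
  have D (y : R) : is_derive y 1 (fun y => K / l * expR (l * y) - H y)
      (K * expR (l * y) - h y).
    have := @is_deriveB _ _ _ _ _ _ _ _ _ (is_derive_scale_expR K l y) (Hh y).
    by rewrite mulrA divfK ?gt_eqF.
  have [xi [_ /orP xiP]] := mean_value D 0 x.
  have xi0 : 0 <= xi by case: xiP => /andP[]// /(le_trans x0).
  have hx : 0 <= (K * expR (l * xi) - h xi) * (x - 0).
    by rewrite subr0 mulr_ge0// subr_ge0 (le_trans (ler_norm _))// hK.
  move=> E; rewrite -E mulr0 expR0 mulr1 in hx.
  have K0 : 0 <= K / l.
    by rewrite divr_ge0 ?(ltW l0)//; have := hK 0 (lexx _); rewrite mulr0 expR0 mulr1; apply: le_trans.
  by lra.
have posN (H h : R -> R) : (forall x : R, is_derive x 1 H (h x)) ->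
    (forall x : R, 0 <= x -> `|h x| <= K * expR (l * x)) ->
    forall x, 0 <= x -> `|H x - H 0| <= K / l * expR (l * x).
  move=> Hh hK x x0; rewrite ler_norml (pos H h)// andbT lerNl opprB.
  have := pos (- H) (fun x => - h x) (fun x => @is_deriveN _ _ _ _ _ _ _ (Hh x)).
  rewrite /= opprK addrC; apply => // y y0; rewrite normrN; exact: hK.
move=> Ff fK x; have [x0|x0] := leP 0 x.
  rewrite (ger0_norm x0); apply: (posN F f) => // y y0.
  by have := fK y; rewrite (ger0_norm y0).
rewrite (ltr0_norm x0).
have D (y : R) : is_derive y 1 (F \o -%R) (f (- y) * -1).
  exact: is_derive1_comp.
have := posN _ _ D _ (- x).
rewrite /= opprK oppr0; apply; last by rewrite oppr_ge0 ltW.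
by move=> y y0; rewrite mulrN1 normrN (le_trans (fK _))// normrN (ger0_norm y0).
Qed.

End primitive.

Section row_continuity.
Context {R : realType} {d : nat}.

Lemma row_cvg T (F : set_system T) {FF : Filter F} (g : T -> 'rV[R]_d) (l : 'rV[R]_d) :
  (forall i, g x 0 i @[x --> F] --> l 0 i) -> g x @[x --> F] --> l.
Proof.
move=> gl; apply/cvgrPdist_le => e e0; near=> x.
apply: row_norm_le (ltW e0) _ => i; rewrite !mxE; move: i; near: x.
by apply: filter_forall => i; move/cvgrPdist_le : (gl i); exact.
Unshelve. all: by end_near. Qed.

Lemma is_derive_continuous (g : R -> R) (s l : R) : is_derive s 1 g l ->
  {for s, continuous g}.
Proof. by case=> /derivable1_diffP/differentiable_continuous. Qed.

End row_continuity.

Section geometric.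
Context {R : realType}.

Lemma le_add_geometric (a b M : R) : (forall n, a <= b + M / 2 ^+ n) -> a <= b.
Proof.
move=> abM; have h : (b + M / 2 ^+ n) @[n --> \oo] --> b.
  rewrite -[X in _ --> X]addr0; apply: cvgD; first exact: cvg_cst.
  rewrite -(mulr0 M); apply: cvgM; first exact: cvg_cst.
  under eq_fun do rewrite -exprVn.
  by apply: cvg_expr; rewrite ger0_norm ?invr_ge0// invf_lt1// ltr1n.
rewrite -(cvg_lim _ h)//; apply: limr_ge; first by apply/cvg_ex; exists b.
by near=> n; exact: abM.
Unshelve. all: by end_near. Qed.

Lemma geometric_cvg d (u : nat -> 'rV[R]_d) (M : R) :
  (forall k, `|u k.+1 - u k| <= M / 2 ^+ k) ->
  exists l, forall k, `|l - u k| <= 2 * M / 2 ^+ k.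
Proof.
move=> uM; have tail k m : `|u (k + m)%N - u k| <= 2 * M / 2 ^+ k - 2 * M / 2 ^+ (k + m).
  elim: m => [|m ih]; first by rewrite addn0 !subrr normr0.
  rewrite addnS -(subrK (u (k + m)%N) (u _.+1)) -addrA (le_trans (ler_normD _ _))//.
  rewrite (le_trans (lerD (uM _) ih))// exprS invfM.
  by rewrite le_eqVlt; apply/orP; left; apply/eqP; field; rewrite !expf_neq0.
have cu i : cvgn (fun k => u k 0 i).
  have E : (fun k => u k 0 i) = (fun k => u 0%N 0 i + series (telescope (fun k => u k 0 i)) k).
    by apply/funext => k; rewrite -eq_sum_telescope.
  rewrite E; apply: is_cvgD; first exact: is_cvg_cst.
  apply: normed_cvg; apply: (@series_le_cvg _ _ (geometric M 2^-1)).
  - by move=> n; exact: normr_ge0.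
  - by move=> n; rewrite /geometric/= exprVn; exact: le_trans (uM n).
  - move=> n; rewrite /geometric/= exprVn; apply: le_trans (uM n).
    by have := coord_le_norm (u n.+1 - u n) i; rewrite !mxE.
  - by apply: is_cvg_geometric_series; rewrite ger0_norm ?invr_ge0// invf_lt1// ltr1n.
pose l : 'rV[R]_d := \row_i limn (fun k => u k 0 i).
have ul : u k @[k --> \oo] --> l by apply: row_cvg => i; rewrite mxE; exact: cu.
have M0 : 0 <= M by have := uM 0%N; rewrite expr0 divr1; apply: le_trans.
exists l => k; apply: (@le_add_geometric _ _ 1) => n.
suff [m km lm] : exists2 m, (k <= m)%N & `|l - u m| <= 1 / 2 ^+ n.
  rewrite -(subrK (u m) l) -addrA (le_trans (ler_normD _ _))// [leLHS]addrC lerD//.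
  rewrite -(subnKC km) (le_trans (tail _ _))// gerBl//.
  by rewrite divr_ge0 ?mulr_ge0// exprn_ge0.
have e0 : 0 < 1 / 2 ^+ n :> R by rewrite divr_gt0// exprn_gt0.
have [N _ NP] : \forall m \near \oo, `|l - u m| <= 1 / 2 ^+ n.
  by move/(@cvgrPdist_le R 'rV[R]_d) : ul; exact.
by exists (maxn k N); rewrite ?leq_maxl//; apply: NP => /=; rewrite leq_maxr.
Qed.

End geometric.

Lemma dist_le_continuous (R : realType) (V W : normedModType R) (f : V -> W) (K : R) :
  (forall x y, `|f x - f y| <= K * `|x - y|) -> continuous f.
Proof.
move=> fK x; apply/cvgrPdist_le => e e0; near=> y.
have K0 : 0 < `|K| + 1 by rewrite ltr_pwDr.
rewrite (le_trans (fK _ _))// (@le_trans _ _ ((`|K| + 1) * `|x - y|))//.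
  by rewrite ler_wpM2r// (le_trans (ler_norm _))// lerDl.
rewrite -ler_pdivlMl//; near: y.
apply: (@cvgr_dist_le _ V _ _ _ id x); first exact: cvg_id.
by rewrite mulr_gt0 ?invr_gt0.
Unshelve. all: by end_near. Qed.

Section flow.
Context {R : realType} {d : nat}.
Variables (c : 'rV[R]_d -> 'rV[R]_d) (L B : R).
Hypothesis L0 : 0 < L.
Hypothesis cL : forall x y, `|c x - c y| <= L * `|x - y|.
Hypothesis cB : forall x, `|c x| <= B.

Let e (s : R) := expR (2 * L * `|s|).

Let L20 : 0 < 2 * L. Proof. by rewrite mulr_gt0. Qed.

Let B0 : 0 <= B. Proof. exact: le_trans (cB 0). Qed.

Let e1 s : 1 <= e s.
Proof. by rewrite -expR0 ler_expR mulr_ge0// ltW. Qed.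

Let e0 s : 0 <= e s. Proof. exact: expR_ge0. Qed.

Lemma lipschitz_coord_continuous i : continuous (fun x => c x 0 i).
Proof.
apply: (@dist_le_continuous R 'rV[R]_d R (fun x => c x 0 i) L) => x y; apply: le_trans (cL x y).
by have := coord_le_norm (c x - c y) i; rewrite !mxE.
Qed.

Definition integral_curve (x : 'rV[R]_d) (g : R -> 'rV[R]_d) :=
  g 0 = x /\ forall (s : R) i, is_derive s (1:R) (fun r => g r 0 i) (c (g s) 0 i).

Let curve_step (D De : R -> 'rV[R]_d) K : 0 <= K ->
  (forall (s : R) i, is_derive s (1:R) (fun r => D r 0 i) (De s 0 i)) ->
  (forall s, `|De s| <= K * e s) ->
  forall s, `|D s| <= (`|D 0| + K / (2 * L)) * e s.
Proof.
move=> K0 dD DeK s; apply: row_norm_le => [|i].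
  by rewrite mulr_ge0// addr_ge0// divr_ge0// ltW.
have DeKi (r : R) : `|De r 0 i| <= K * e r := le_trans (coord_le_norm _ _) (DeK r).
have := le_derive_expR L20 (fun r => dD r i) DeKi s.
have D0 : `|D 0 0 i| <= `|D 0| * e s.
  by rewrite (le_trans (coord_le_norm _ _))// ler_peMr.
rewrite (mulrDl `|D 0|) => h; rewrite -(subrK (D 0 0 i) (D s 0 i)) addrC.
by rewrite (le_trans (ler_normD _ _))// lerD.
Qed.

Let is_derive_sub (g h : R -> R) (s l m : R) : is_derive s (1:R) g l -> is_derive s (1:R) h m ->
  is_derive s (1:R) (fun r => g r - h r) (l - m).
Proof. by move=> gl hm; exact: is_deriveB. Qed.

(* Gronwall's lemma: the bound [K * e] improves to [(delta + K / 2) * e]. *)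
Lemma integral_curve_dist x y g h : integral_curve x g -> integral_curve y h ->
  forall s, `|g s - h s| <= 2 * `|x - y| * expR (2 * L * `|s|).
Proof.
move=> [g0 dg] [h0 dh]; set de := `|x - y|.
have step K : 0 <= K -> (forall s, `|c (g s) - c (h s)| <= K * e s) ->
    forall s, `|g s - h s| <= (de + K / (2 * L)) * e s.
  move=> K0 cK s; rewrite /de -g0 -h0.
  apply: (curve_step (D := fun s => g s - h s) (De := fun s => c (g s) - c (h s))) => //.
  move=> r i; rewrite !mxE; have -> : (fun r => (g r - h r) 0 i) = (fun r => g r 0 i - h r 0 i).
    by apply/funext => t; rewrite !mxE.
  exact: is_derive_sub.
have bnd n s : `|g s - h s| <= (2 * de + B / L / 2 ^+ n) * e s.
  elim: n s => [|n ih] s.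
    rewrite expr0 divr1; apply: (le_trans (step (2 * B) _ _ s)).
    - by rewrite mulr_ge0.
    - move=> r; rewrite (le_trans (ler_normB _ _))//.
      by rewrite (le_trans (lerD (cB _) (cB _)))// -mulr2n mulr_natl ler_peMr// mulrn_wge0.
    - rewrite ler_wpM2r// lerD//; first by have := normr_ge0 (x - y); rewrite -/de; lra.
      by rewrite invfM mulrACA divff// mul1r.
  set K := 2 * de + B / L / 2 ^+ n in ih.
  have de0 : 0 <= de by exact: normr_ge0.
  have K0 : 0 <= K.
    by apply: addr_ge0; [exact: mulr_ge0|rewrite !divr_ge0 ?exprn_ge0 ?(ltW L0)].
  apply: (le_trans (step (L * K) _ _ s)).
  - by rewrite mulr_ge0// ltW.
  - by move=> r; rewrite (le_trans (cL _ _))// -mulrA ler_wpM2l// ltW.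
  - rewrite ler_wpM2r// le_eqVlt; apply/orP; left; apply/eqP; rewrite /K exprS.
    by field; rewrite ?expf_neq0 ?(gt_eqF L0).
move=> s; apply: (@le_add_geometric _ _ _ (B / L * e s)) => n.
by rewrite (le_trans (bnd n s))// mulrDl lerD// mulrAC.
Qed.

Lemma integral_curve_unique x g h : integral_curve x g -> integral_curve x h -> g =1 h.
Proof.
move=> xg xh s; have := integral_curve_dist xg xh s.
by rewrite subrr normr0 mulr0 mul0r normr_le0 subr_eq0 => /eqP.
Qed.

Lemma integral_curve_lipschitz x g : integral_curve x g ->
  forall s r, `|g s - g r| <= B * `|s - r|.
Proof.
move=> [_ dg] s r; apply: row_norm_le => [|i]; first by rewrite mulr_ge0.
rewrite !mxE; have [xi [_ _ ->]] := mean_value (fun s => dg s i) r s.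
by rewrite normrM ler_wpM2r// (le_trans (coord_le_norm _ _)).
Qed.

(** Picard iteration: consecutive iterates differ by at most [M s / 2 ^+ k], where [M] carries the
    exponential weight and the boundedness of [c] starts the induction. All iterates are
    [B]-Lipschitz, hence so is the limit [g]; thus [step g] is differentiable with derivative
    [c (g s)], and it remains to see that [step g = g]. *)
Lemma integral_curve_exists x : exists g, integral_curve x g.
Proof.
(* Arbitrary values at discontinuous functions make [prim] total, so that the Picard map acts on
   every curve. *)
have prim (f : R -> R) : exists F : R -> R, continuous f -> F 0 = 0 /\ forall x : R, is_derive x 1 F (f x).
  have [cf|ncf] := pselect (continuous f); last by exists f.
  by have [F] := primitive_exists cf; exists F.
have {prim}[prim primP] := choice prim.
pose step (g : R -> 'rV[R]_d) s : 'rV[R]_d := \row_i (x 0 i + prim (fun r => c (g r) 0 i) s).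
pose u k := iter k step (fun=> x).
have stepP (g : R -> 'rV[R]_d) : continuous g -> step g 0 = x /\
    forall (s : R) i, is_derive s (1:R) (fun r => step g r 0 i) (c (g s) 0 i).
  move=> cg; have cgi i : continuous (fun r => c (g r) 0 i).
    move=> s; apply: (@continuous_comp _ _ _ g (fun x => c x 0 i) s (cg s)).
    exact: lipschitz_coord_continuous.
  split; first by apply/rowP => i; rewrite mxE (primP _ (cgi i)).1 addr0.
  move=> s i; have -> : (fun r => step g r 0 i) = (fun r => x 0 i + prim (fun r => c (g r) 0 i) r).
    by apply/funext => r; rewrite mxE.
  have := @is_deriveD _ _ _ _ _ _ _ _ _ (@is_derive_cst _ _ _ (x 0 i) s (1:R)) ((primP _ (cgi i)).2 s).
  by rewrite add0r.
have curve_cont (g g' : R -> 'rV[R]_d) :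
    (forall (s : R) i, is_derive s (1:R) (fun r => g r 0 i) (g' s 0 i)) -> continuous g.
  by move=> dg s; apply: row_cvg => i; exact: (is_derive_continuous (dg s i)).
have cu k : continuous (u k).
  elim: k => [|k ih]; first by move=> s; exact: cvg_cst.
  exact: (curve_cont _ _ (stepP _ ih).2).
have uS k : u k.+1 0 = x /\ forall (s : R) i, is_derive s (1:R) (fun r => u k.+1 r 0 i) (c (u k s) 0 i).
  exact: stepP.
have u0 k : u k 0 = x by case: k => // k; case: (uS k).
have sub_step (g h g' h' : R -> 'rV[R]_d) K : 0 <= K -> g 0 = h 0 ->
    (forall (s : R) i, is_derive s (1:R) (fun r => g r 0 i) (g' s 0 i)) ->
    (forall (s : R) i, is_derive s (1:R) (fun r => h r 0 i) (h' s 0 i)) ->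
    (forall s, `|g' s - h' s| <= K * e s) ->
    forall s, `|g s - h s| <= K / (2 * L) * e s.
  move=> K0 gh dg dh ghK s.
  have := @curve_step (fun s => g s - h s) (fun s => g' s - h' s) K K0 _ ghK s.
  rewrite gh subrr normr0 add0r; apply => r i; rewrite !mxE.
  have -> : (fun r => (g r - h r) 0 i) = (fun r => g r 0 i - h r 0 i).
    by apply/funext => t; rewrite !mxE.
  exact: is_derive_sub.
pose M s := B / (2 * L) * e s.
have uM k s : `|u k.+1 s - u k s| <= M s / 2 ^+ k.
  rewrite /M mulrAC; elim: k s => [|k ih] s.
    rewrite expr0 divr1; apply: (sub_step _ _ (fun=> c x) (fun=> 0)) => //.
    - exact: (uS 0%N).2.
    - by move=> r i; rewrite mxE; exact: is_derive_cst.
    - by move=> r; rewrite subr0 (le_trans (cB _))// ler_peMr.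
  have := sub_step (u k.+2) (u k.+1) _ _ (L * (B / (2 * L) / 2 ^+ k)) _ _ (uS k.+1).2 (uS k).2 _ s.
  have -> : L * (B / (2 * L) / 2 ^+ k) / (2 * L) = B / (2 * L) / 2 ^+ k.+1.
    by rewrite exprS; field; rewrite ?expf_neq0 ?(gt_eqF L0).
  apply.
  - by rewrite mulr_ge0 ?divr_ge0 ?exprn_ge0 ?(ltW L20) ?(ltW L0).
  - by rewrite !u0.
  - by move=> r; rewrite (le_trans (cL _ _))// -[leRHS]mulrA ler_wpM2l// ltW.
have [g gP] := choice (fun s => geometric_cvg (uM^~ s)).
have ulip k s r : `|u k s - u k r| <= B * `|s - r|.
  case: k => [|k]; first by rewrite subrr normr0 mulr_ge0.
  apply: row_norm_le => [|i]; first by rewrite mulr_ge0.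
  rewrite row_subE.
  have [xi [_ _ ->]] := mean_value (fun s => (uS k).2 s i) r s.
  by rewrite normrM ler_wpM2r// (le_trans (coord_le_norm _ _)).
have glip s r : `|g s - g r| <= B * `|s - r|.
  apply: (@le_add_geometric _ _ _ (2 * M s + 2 * M r)) => k.
  have -> : g s - g r = (g s - u k s) + (u k s - u k r) - (g r - u k r).
    by rewrite opprB !addrA subrK subrK.
  rewrite (le_trans (ler_normB _ _))// (le_trans (lerD (ler_normD _ _) (lexx _)))//.
  by have := gP s k; have := gP r k; have := ulip k s r; rewrite mulrDl; lra.
have cg : continuous g by exact: dist_le_continuous glip.
have [g0 dg] := stepP _ cg.
suff E : step g = g.
  exists (step g); split => // s i.
  by have -> : step g s = g s by rewrite E.
apply/funext => s; apply/eqP; rewrite -subr_eq0 -normr_le0.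
apply: (@le_add_geometric _ _ _ (2 * M s)) => k; rewrite add0r.
rewrite -(subrK (u k.+1 s) (step g s)) -addrA (le_trans (ler_normD _ _))//.
have gu : `|u k.+1 s - g s| <= 2 * M s / 2 ^+ k / 2.
  by rewrite distrC (le_trans (gP s k.+1))// exprSr invfM mulrA.
have h : `|step g s - u k.+1 s| <= L * (2 * (B / (2 * L)) / 2 ^+ k) / (2 * L) * e s.
  apply: (sub_step _ _ (fun s => c (g s)) (fun s => c (u k s))) => //.
  - by rewrite !mulr_ge0 ?divr_ge0 ?mulr_ge0 ?invr_ge0 ?exprn_ge0 ?(ltW L20) ?(ltW L0).
  - by rewrite g0 u0.
  - exact: (uS k).2.
  - move=> r; rewrite (le_trans (cL _ _))// -[leRHS]mulrA ler_wpM2l ?(ltW L0)//.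
    by rewrite (le_trans (gP r k))// /M mulrA mulrAC.
rewrite (le_trans (lerD h gu))// /M le_eqVlt; apply/orP; left; apply/eqP.
by field; rewrite ?expf_neq0 ?(gt_eqF L0).
Qed.

Lemma flow_exists : exists psi : R -> 'rV[R]_d -> 'rV[R]_d,
  forall x, integral_curve x (psi^~ x).
Proof.
have [g gP] := choice integral_curve_exists.
by exists (fun s x => g x s).
Qed.

Lemma flow_group (psi : R -> 'rV[R]_d -> 'rV[R]_d) :
  (forall x, integral_curve x (psi^~ x)) ->
  forall s t x, psi (s + t) x = psi s (psi t x).
Proof.
move=> psiP s t x; move: s.
apply: (@integral_curve_unique (psi t x)) => //; split; first by rewrite add0r.
move=> s i; have dst : is_derive s (1:R) (fun r : R => r + t) 1.
  have := @is_deriveD _ _ _ _ _ _ _ _ _ (@is_derive_id _ _ s (1:R)) (@is_derive_cst _ _ _ t s (1:R)).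
  by rewrite addr0.
have := @is_derive1_comp _ _ (fun r : R => r + t) s _ _ ((psiP x).2 (s + t) i) dst.
by rewrite mulr1.
Qed.

End flow.

(** * Calculus on the torus *)

Section Ck_theory.
Context {R : realType} {d : nat}.
Implicit Types f g : 'rV[R]_d -> R.

Lemma Ck_continuous k f : Ck k f -> continuous f.
Proof. by case: k => // k []. Qed.

Lemma Ck_weaken k f : Ck k.+1 f -> Ck k f.
Proof.
elim: k f => [|k ih] f [cf df]; first by [].
by split => // i; have [di Di] := df i; split => //; exact: ih.
Qed.

Lemma Ck_le k l f : (k <= l)%N -> Ck l f -> Ck k f.
Proof.
move=> /subnKC <-; elim: (l - k)%N => [|n ih]; first by rewrite addn0.
by rewrite addnS => /Ck_weaken.
Qed.

Lemma Ck_cst k (a : R) : Ck k (fun _ : 'rV[R]_d => a).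
Proof.
elim: k a => [|k ih] a /=; first exact: (@cst_continuous 'rV[R]_d R a).
split=> [|i]; first exact: (@cst_continuous 'rV[R]_d R a).
split=> [x|]; first exact: derivable_cst.
by under eq_fun do rewrite derive_cst.
Qed.

Lemma Ck_add k f g : Ck k f -> Ck k g -> Ck k (fun x => f x + g x).
Proof.
elim: k f g => [|k ih] f g.
  by move=> cf cg x; exact: (@continuousD _ _ _ f g x (cf x) (cg x)).
move=> [cf df] [cg dg]; split=> [x|i].
  exact: (@continuousD _ _ _ f g x (cf x) (cg x)).
have [dfi Dfi] := df i; have [dgi Dgi] := dg i; split=> [x|].
  exact: derivableD.
under eq_fun do rewrite deriveD//.
exact: ih.
Qed.

Lemma Ck_sum k I (r : seq I) (F : I -> 'rV[R]_d -> R) : (forall i, Ck k (F i)) ->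
  Ck k (fun x => \sum_(i <- r) F i x).
Proof.
move=> FC; elim: r => [|i r ih].
  by under eq_fun do rewrite big_nil; exact: Ck_cst.
by under eq_fun do rewrite big_cons; exact: Ck_add.
Qed.

Lemma Ck_mul k f g : Ck k f -> Ck k g -> Ck k (fun x => f x * g x).
Proof.
elim: k f g => [|k ih] f g.
  by move=> cf cg x; exact: (@continuousM _ _ f g x (cf x) (cg x)).
move=> Cf Cg; have fC := Ck_weaken Cf; have gC := Ck_weaken Cg.
have [cf df] := Cf; have [cg dg] := Cg; split=> [x|i].
  exact: (@continuousM _ _ f g x (cf x) (cg x)).
have [dfi Dfi] := df i; have [dgi Dgi] := dg i; split=> [x|].
  exact: derivableM.
have -> : (fun x => 'D_('e_i) (fun x => f x * g x) x) =
    (fun x => f x * 'D_('e_i) g x + g x * 'D_('e_i) f x).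
  by apply/funext => x; rewrite deriveM.
by apply: Ck_add; exact: ih.
Qed.

Definition transport (c : 'rV[R]_d -> 'rV[R]_d) f : 'rV[R]_d -> R :=
  fun x => \sum_i c x 0 i * 'D_('e_i) f x.

Lemma Ck_transport k (c : 'rV[R]_d -> 'rV[R]_d) f : (forall i, Ck k (fun x => c x 0 i)) -> Ck k.+1 f ->
  Ck k (transport c f).
Proof.
by move=> cC [_ df]; apply: Ck_sum => i; apply: Ck_mul => //; case: (df i).
Qed.

Lemma periodic_derive f (v : 'rV[R]_d) : Defs.periodic f -> Defs.periodic (fun x => 'D_v f x).
Proof.
move=> pf x i; have E : (fun h => h^-1 *: ((f \o shift (x + 'e_i)) (h *: v) - f (x + 'e_i))) =
    (fun h => h^-1 *: ((f \o shift x) (h *: v) - f x)).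
  by apply/funext => h /=; rewrite pf addrA pf.
by rewrite /derive E.
Qed.

Lemma periodic_transport (c : 'rV[R]_d -> 'rV[R]_d) f : Defs.periodic c -> Defs.periodic f -> Defs.periodic (transport c f).
Proof.
move=> pc pf x i; apply: eq_bigr => j _.
by rewrite pc (periodic_derive _ pf).
Qed.

Lemma torus_Ck_transport k (c : 'rV[R]_d -> 'rV[R]_d) f :
  torus_Ck_vect k c -> torus_Ck k.+1 f -> torus_Ck k (transport c f).
Proof.
move=> [pc cC] [pf fC]; split; first exact: periodic_transport.
exact: Ck_transport.
Qed.

Lemma torus_Ck_le k l f : (k <= l)%N -> torus_Ck l f -> torus_Ck k f.
Proof. by move=> kl [pf fC]; split=> //; exact: Ck_le fC. Qed.

Lemma torus_Ck_derive k f i : torus_Ck k.+1 f -> torus_Ck k (fun x => 'D_('e_i) f x).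
Proof. by move=> [pf [_ df]]; split; [exact: periodic_derive|case: (df i)]. Qed.

Lemma periodic_cube f : Defs.periodic f -> forall x, exists y : 'rV[R]_d,
  (forall i, y 0 i \in `[0, 1]) /\ f x = f y.
Proof.
move=> pf x.
have pn y i n : f (y + 'e_i *+ n) = f y.
  by elim: n => [|n ih]; rewrite ?mulr0n ?addr0// mulrSr addrA pf.
have pz y i (m : int) : f (y + 'e_i *~ m) = f y.
  case: m => n; first exact: pn.
  by rewrite NegzE mulrNz -[in RHS](subrK ('e_i *+ n.+1) y) pn.
have ps y (m : 'I_d -> int) (r : seq 'I_d) : f (y + \sum_(i <- r) 'e_i *~ m i) = f y.
  elim: r y => [|i r ih] y; first by rewrite big_nil addr0.
  by rewrite big_cons addrA ih pz.
exists (x - \sum_i 'e_i *~ Num.floor (x 0 i)); split; last first.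
  rewrite -[RHS](ps _ (fun i => Num.floor (x 0 i)) (index_enum 'I_d)).
  by rewrite subrK.
move=> i; rewrite !mxE summxE (bigD1 i)//= big1 => [|j ji]; last first.
  by rewrite -scaler_int !mxE eqxx/= eq_sym (negbTE ji) mulr0.
rewrite addr0 -scaler_int !mxE !eqxx mulr1 in_itv/= subr_ge0 lerBlDl.
by have := lt_succ_floor (x 0 i); have := ge_floor (x 0 i); rewrite intrD; lra.
Qed.

Lemma periodic_bounded f : Defs.periodic f -> continuous f -> exists2 B : R, 0 <= B & forall x, `|f x| <= B.
Proof.
move=> pf cf; have cube : compact [set v : 'rV[R]_d | forall i, (`[0, 1]%classic : set R) (v ord0 i)].
  by apply: (@rV_compact R d (fun=> `[0, 1]%classic)) => _; exact: segment_compact.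
have := @continuous_compact _ _ f _ (continuous_subspaceT cf) cube.
move=> /(@compact_bounded _ R)[M [_ MP]].
have fB x : `|f x| <= `|M| + 1.
  have [y [y01 ->]] := periodic_cube pf x.
  apply: (MP (`|M| + 1)); last by exists y.
  by rewrite (le_lt_trans (ler_norm _))// ltrDl.
by exists (`|M| + 1) => //; rewrite addr_ge0.
Qed.

Lemma torus_C1_lipschitz f : torus_Ck 1 f ->
  exists2 L : R, 0 <= L & forall x y, `|f x - f y| <= L * `|x - y|.
Proof.
move=> fC; have [pf [_ df]] := fC.
have B i : exists B : R, 0 <= B /\ forall x, `|'D_('e_i) f x| <= B.
  by have [B B0 fB] := periodic_bounded (periodic_derive 'e_i pf) (df i).2; exists B.
have [K KP] := choice B; exists (\sum_i K i) => [|x y].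
  by apply: sumr_ge0 => i _; case: (KP i).
have [z zx ->] := @coordinatewise_mean_value R d f y x (fun i => (df i).1).
rewrite (le_trans (ler_norm_sum _ _ _))// mulr_suml ler_sum// => i _.
rewrite normrM ler_pM//; first by case: (KP i).
by rewrite -row_subE coord_le_norm.
Qed.

Lemma torus_C2_taylor f : torus_Ck 2 f -> exists2 K : R, 0 <= K & forall x y,
  `|f y - f x - \sum_i 'D_('e_i) f x * (y 0 i - x 0 i)| <= K * `|y - x| ^+ 2.
Proof.
move=> fC; have [pf [_ df]] := fC.
have B i : exists L : R, 0 <= L /\ forall x y, `|'D_('e_i) f x - 'D_('e_i) f y| <= L * `|x - y|.
  by have [L L0 LP] := torus_C1_lipschitz (torus_Ck_derive i fC); exists L.
have [L LP] := choice B; exists (\sum_i L i) => [|x y].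
  by apply: sumr_ge0 => i _; case: (LP i).
have [z zx ->] := @coordinatewise_mean_value R d f x y (fun i => (df i).1).
rewrite -sumrB (le_trans (ler_norm_sum _ _ _))// mulr_suml ler_sum// => i _.
have [Li0 LiP] := LP i.
rewrite -mulrBl normrM expr2 mulrA ler_pM//.
  by rewrite (le_trans (LiP _ _))// ler_wpM2l.
by rewrite -row_subE coord_le_norm.
Qed.

(** Chain rule from continuous partial derivatives. The coordinatewise mean value formula writes the
    difference quotient of [f] along [g] exactly as a sum of partial derivatives at intermediate
    points times quotients of the coordinates of [g]; the intermediate points tend to [g s]. *)
Lemma is_derive_along_curve k f (g : R -> 'rV[R]_d) (s : R) (l : 'I_d -> R) :
  Ck k.+1 f -> (forall i, is_derive s (1:R) (fun r => g r 0 i) (l i)) ->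
  is_derive s (1:R) (fun r => f (g r)) (\sum_i 'D_('e_i) f (g s) * l i).
Proof.
move=> [_ df] dg.
have cg : {for s, continuous g} by apply: row_cvg => i; exact: is_derive_continuous (dg i).
have [z zP] : exists z : R -> 'I_d -> 'rV[R]_d, forall h, (forall i, `|z h i - g s| <= `|g (h + s) - g s|) /\
    f (g (h + s)) - f (g s) = \sum_i 'D_('e_i) f (z h i) * (g (h + s) 0 i - g s 0 i).
  suff /choice[z zP] : forall h, exists z : 'I_d -> 'rV[R]_d, (forall i, `|z i - g s| <= `|g (h + s) - g s|) /\
      f (g (h + s)) - f (g s) = \sum_i 'D_('e_i) f (z i) * (g (h + s) 0 i - g s 0 i) by exists z.
  move=> h; have [z z1 z2] := @coordinatewise_mean_value R d f (g s) (g (h + s)) (fun i => (df i).1).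
  by exists z.
have zc i : z h i @[h --> 0^'] --> g s.
  apply/(@cvgrPdist_le R 'rV[R]_d) => e e0; near=> h.
  rewrite distrC (le_trans ((zP h).1 i))// distrC; near: h; apply: nbhs_dnbhs.
  have : g (h + s) @[h --> (0:R)] --> g s.
    apply: (@cvg_comp _ _ _ (fun h : R => h + s) g); last exact: cg.
    have : (h + s) @[h --> (0:R)] --> 0 + s by apply: cvgD; [exact: cvg_id|exact: cvg_cst].
    by rewrite add0r.
  by move/(@cvgrPdist_le R 'rV[R]_d); exact.
have lim : (fun h => h^-1 *: ((fun r => f (g r)) (h + s) - f (g s))) @ 0^' -->
    \sum_i 'D_('e_i) f (g s) * l i.
  have -> : (fun h => h^-1 *: ((fun r => f (g r)) (h + s) - f (g s))) =
     (fun h => \sum_i 'D_('e_i) f (z h i) * (h^-1 *: (g (h + s) 0 i - g s 0 i))).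
    apply/funext => h; rewrite (zP h).2 scaler_sumr; apply: eq_bigr => i _.
    by rewrite scalerAr.
  apply: cvg_big => // [|i _]; first exact: add_continuous.
  apply: cvgM.
    apply: (@cvg_comp _ _ _ (fun h => z h i) (fun x => 'D_('e_i) f x)); first exact: zc.
    by have /Ck_continuous := (df i).2; exact.
  have [/cvg_ex[/= m mP] E] := dg i.
  have -> : l i = m by rewrite -E; apply/cvg_lim.
  have -> : (fun h => h^-1 *: (g (h + s) 0 i - g s 0 i)) =
      (fun h => h^-1 *: (((fun r => g r 0 i) \o shift s) (h *: (1:R)) - g s 0 i)).
    by apply/funext => h /=; rewrite [_ *: 1]mulr1.
  exact: mP.
have E : (fun h => h^-1 *: (((fun r => f (g r)) \o shift s) (h *: (1:R)) - f (g s))) =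
    (fun h => h^-1 *: ((fun r => f (g r)) (h + s) - f (g s))).
  by apply/funext => h /=; rewrite [_ *: 1]mulr1.
split; rewrite /derivable /derive E; first by apply/cvg_ex; eexists; exact: lim.
exact: cvg_lim.
Unshelve. all: by end_near. Qed.

End Ck_theory.

Section taylor.
Context {R : realType}.

Lemma is_derive_taylor_sum (a : nat -> R) n (r : R) :
  is_derive r (1:R) (fun r => \sum_(j < n.+1) a j * r ^+ j / j`!%:R)
    (\sum_(j < n) a j.+1 * r ^+ j / j`!%:R).
Proof.
elim: n => [|n ih].
  under eq_fun do rewrite big_ord1 expr0 mulr1.
  by rewrite big_ord0; exact: is_derive_cst.
under eq_fun do rewrite big_ord_recr.
rewrite big_ord_recr/=.
suff dn : is_derive r (1:R) (fun r => a n.+1 * r ^+ n.+1 / n.+1`!%:R) (a n.+1 * r ^+ n / n`!%:R).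
  exact: (@is_deriveD _ _ _ _ _ r (1:R) _ _ ih dn).
have -> : (fun r => a n.+1 * r ^+ n.+1 / n.+1`!%:R) = (a n.+1 / n.+1`!%:R) \*: (id ^+ n.+1 : R -> R).
  by apply/funext => t /=; rewrite fctE mulrAC.
apply: is_derive_eq; rewrite /= [_ *: 1]mulr1 factS natrM.
have cancel_factor (A N M X : R) : N != 0 -> M != 0 -> A / (N * M) * (N * X) = A * X / M.
  by move=> N0 M0; field; rewrite N0 M0.
by apply: cancel_factor; rewrite pnatr_eq0// -lt0n fact_gt0.
Qed.

Lemma is_derive_translate (f : R -> R) (s r l : R) : is_derive (r + s) (1:R) f l ->
  is_derive r (1:R) (fun r => f (r + s)) l.
Proof.
move=> df; have dst : is_derive r (1:R) (fun r : R => r + s) 1.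
  have := @is_deriveD _ _ _ _ _ _ _ _ _ (@is_derive_id _ _ r (1:R)) (@is_derive_cst _ _ _ s r (1:R)).
  by rewrite addr0.
by have := @is_derive1_comp _ _ (fun r : R => r + s) r _ _ df dst; rewrite mulr1.
Qed.

(** The successive derivatives form an abstract chain [f 0, f 1, ...], to be filled with the
    iterates of [transport c] along a curve, or with a coordinate of the curve followed by such
    iterates. By induction on the length of the chain, each integration multiplies the bound by
    [|s - s0|]; the factor [1 / p!] is given up. *)
Lemma taylor_chain_bound p (f : nat -> R -> R) (K s0 : R) : 0 <= K ->
  (forall j (s : R), (j < p)%N -> is_derive s (1:R) (f j) (f j.+1 s)) ->
  (forall s, `|f p s| <= K) ->
  forall s, `|f 0%N s - \sum_(j < p) f j s0 * (s - s0) ^+ j / j`!%:R| <= K * `|s - s0| ^+ p.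
Proof.
elim: p f => [|p ih] f K0 df fK s; first by rewrite big_ord0 subr0 expr0 mulr1.
pose h (r : R) := f 0%N (r + s0) - \sum_(j < p.+1) f j s0 * r ^+ j / j`!%:R.
pose h' (r : R) := f 1%N (r + s0) - \sum_(j < p) f j.+1 s0 * r ^+ j / j`!%:R.
have dh (r : R) : is_derive r (1:R) h (h' r).
  apply: is_deriveB; last exact: is_derive_taylor_sum (fun j => f j s0) p r.
  by apply: is_derive_translate; exact: df.
have h0 : h 0 = 0.
  rewrite /h add0r big_ord_recl/= expr0 fact0 mulr1 divr1 big1 ?addr0 ?subrr// => i _.
  by rewrite /bump/= add1n expr0n/= mulr0 mul0r.
have := @le_derive_pow R h h' K p dh h0 K0 _ (s - s0).
rewrite /h subrK; apply => r.
have := ih (fun j => f j.+1) K0 _ fK (r + s0).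
rewrite addrK; apply => j t jp; exact: df.
Qed.

End taylor.

(** * Gaussian integrals and Brownian increments *)

Section monotonicity.
Context {d : measure_display} {T : measurableType d} {R : realType}.
Variable mu : {measure set T -> \bar R}.
Import HBNNSimple.
Local Open Scope ereal_scope.

(* The integral of a nonnegative function is a supremum over simple minorants,
   so no measurability is needed for monotonicity. *)
Lemma ge0_le_integralW (f g : T -> \bar R) : (forall x, 0 <= f x) -> (forall x, f x <= g x) ->
  \int[mu]_x f x <= \int[mu]_x g x.
Proof.
move=> f0 fg; rewrite !ge0_integralTE//; last by move=> x; exact: le_trans (fg x).
by apply: ereal_sup_le => _ [h hf <-]; exists h => // x; exact: le_trans (fg x).
Qed.

(** Setting [g] to [+oo] on the exceptional null set makes the inequality hold everywhere without
    changing the integral of [g]. Only the dominating function is measurable: this is what allows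
    integrating the projection error, about whose measurability in time and chance nothing is
    known. *)
Lemma ae_ge0_le_integralW (f g : T -> \bar R) : (forall x, 0 <= f x) -> (forall x, 0 <= g x) ->
  measurable_fun setT g -> {ae mu, forall x, f x <= g x} ->
  \int[mu]_x f x <= \int[mu]_x g x.
Proof.
move=> f0 g0 mg [N [mN muN Nfg]]; pose h := fun x => if x \in N then +oo else g x.
have mh : measurable_fun setT h.
  apply: measurable_fun_ifT => //; apply: (@measurable_fun_bool _ _ _ _ true).
  rewrite setTI (_ : _ @^-1` _ = N)//.
  by apply/seteqP; split=> x /= xN; [exact: set_mem|exact: mem_set].
have -> : \int[mu]_x g x = \int[mu]_x h x.
  apply: ge0_ae_eq_integral => //.
    by move=> x _; rewrite /h; case: ifP.
  exists N; split=> // x /=; apply: contra_notP => xN _.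
  by rewrite /h memNset.
apply: ge0_le_integralW => // x; rewrite /h; case: ifPn => [_|]; first exact: leey.
by rewrite notin_setE => xN; apply: contrapT => fg; apply: xN; exact: Nfg.
Qed.

Lemma integrable_sub (f g : T -> R) : mu.-integrable setT (EFin \o f) ->
  mu.-integrable setT (EFin \o g) -> mu.-integrable setT (EFin \o (fun x => f x - g x)%R).
Proof.
move=> fi gi; have := integrableB measurableT fi gi.
by apply: eq_integrable => // x _ /=; rewrite EFinB.
Qed.

Lemma integrable_scale (a : R) (f : T -> R) : mu.-integrable setT (EFin \o f) ->
  mu.-integrable setT (EFin \o (fun x => a * f x)%R).
Proof.
move=> fi; have := integrableZl measurableT a fi.
by apply: eq_integrable => // x _ /=; rewrite EFinM.
Qed.

Lemma integrable_dominated (f g : T -> R) (C : R) : measurable_fun setT g ->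
  (forall w, `|g w| <= C * `|f w|)%R -> mu.-integrable setT (EFin \o f) ->
  mu.-integrable setT (EFin \o g).
Proof.
move=> mg gC /(integrable_scale C); apply: le_integrable => //.
- exact/measurable_EFinP.
- move=> w _; rewrite lee_fin normrM (le_trans (gC w))// ler_wpM2r//.
  exact: ler_norm.
Qed.

End monotonicity.

Section weighted_integral.
Context {d d' : measure_display} {T : measurableType d} {S : measurableType d'} {R : realType}.
Variables (mu : {measure set T -> \bar R}) (phi : T -> S) (p : T -> R).
Hypothesis mphi : measurable_fun setT phi.
Hypothesis mp : measurable_fun setT p.
Hypothesis p0 : forall x, 0 <= p x.
Import HBNNSimple.
Local Open Scope ereal_scope.

Lemma weighted_integral_nnsfun (f : {nnsfun S >-> R}) :
  \int[mu]_x ((f (phi x))%:E * (p x)%:E) =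
  \sum_(y \in range f) if (y < 0)%R then 0 else y%:E * \int[mu]_(x in phi @^-1` (f @^-1` [set y])) (p x)%:E.
Proof.
have mf y : measurable (phi @^-1` (f @^-1` [set y])).
  by rewrite -[X in measurable X]setTI; apply: mphi => //; rewrite -[X in measurable X]setTI; exact: measurable_funP.
under eq_integral => x _.
  rewrite fimfunE -fsumEFin// ge0_mule_fsuml; last by move=> y; rewrite EFinM nnfun_muleindic_ge0.
  over.
rewrite ge0_integral_fsum//; last 2 first.
- move=> y; apply: emeasurable_funM; last exact/measurable_EFinP.
  apply/measurable_EFinP; apply: measurable_funM => //.
  exact: (measurable_indic (mf y)).
- by move=> y x _; rewrite mule_ge0 ?lee_fin// -lee_fin EFinM nnfun_muleindic_ge0.
apply: eq_fsbigr => y _; case: ifPn => [y0|]; last rewrite -leNgt => y0.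
  rewrite preimage_nnfun0//.
  by under eq_integral do rewrite indic0 mulr0 mul0e; rewrite integral0.
rewrite -ge0_integralZl//; last 2 first.
- by apply/measurable_EFinP; exact: measurable_funTS.
- by move=> x _; rewrite lee_fin.
rewrite [RHS]integral_mkcond; apply: eq_integral => x _; rewrite patchE EFinM !indicE.
have -> : (x \in phi @^-1` (f @^-1` [set y])) = (phi x \in f @^-1` [set y]).
  by apply/idP/idP; rewrite !inE.
by case: (phi x \in _); rewrite ?mule1// mule0 mul0e.
Qed.

Lemma weighted_integral_lim (f : S -> \bar R) (mf : measurable_fun setT f) : (forall y, 0 <= f y) ->
  \int[mu]_x (f (phi x) * (p x)%:E) =
  limn (fun n => \int[mu]_x ((nnsfun_approx measurableT mf n (phi x))%:E * (p x)%:E)).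
Proof.
move=> f0; rewrite -monotone_convergence//=.
- apply: eq_integral => x _; apply/esym/cvg_lim => //=.
  by apply: cvgeZr => //; exact: cvg_nnsfun_approx.
- move=> n; apply: emeasurable_funM; apply/measurable_EFinP => //.
  exact: measurableT_comp.
- by move=> n x _; rewrite mule_ge0 ?lee_fin.
- move=> x _ m n mn; rewrite lee_wpmul2r ?lee_fin//.
  by have /lefP := nd_nnsfun_approx measurableT mf mn; exact.
Qed.

End weighted_integral.

Section weighted_integral_eq.
Import HBNNSimple.

(** Two weighted image measures that agree on sets agree on nonnegative functions, by simple
    functions and monotone convergence. It serves to write a Gaussian integral with its density, and
    to test a martingale increment against a variable measurable for the past. *)
Lemma weighted_integral_eq d1 d2 d (T1 : measurableType d1) (T2 : measurableType d2) (S : measurableType d)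
    (R : realType) (mu1 : {measure set T1 -> \bar R}) (mu2 : {measure set T2 -> \bar R})
    (phi1 : T1 -> S) (phi2 : T2 -> S) (p1 : T1 -> R) (p2 : T2 -> R) :
  measurable_fun setT phi1 -> measurable_fun setT phi2 ->
  measurable_fun setT p1 -> measurable_fun setT p2 -> (forall x, 0 <= p1 x) -> (forall x, 0 <= p2 x) ->
  (forall A, measurable A -> \int[mu1]_(x in phi1 @^-1` A) (p1 x)%:E = \int[mu2]_(x in phi2 @^-1` A) (p2 x)%:E)%E ->
  forall f : S -> \bar R, measurable_fun setT f -> (forall y, 0 <= f y)%E ->
  (\int[mu1]_x (f (phi1 x) * (p1 x)%:E) = \int[mu2]_x (f (phi2 x) * (p2 x)%:E))%E.
Proof.
move=> mphi1 mphi2 mp1 mp2 p10 p20 E f mf f0; rewrite !(weighted_integral_lim _ _ _ _ mf)//.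
apply: congr_lim; apply/funext => n; rewrite !weighted_integral_nnsfun//.
have mfn : measurable_fun setT (nnsfun_approx measurableT mf n) by [].
apply: eq_fsbigr => y _; case: ifPn => // _; rewrite E//.
Qed.

End weighted_integral_eq.

Section normal_moments.
Context {R : realType}.
Notation mu := (@lebesgue_measure R).

Lemma expr_le_expR m (y : R) : (0 < m)%N -> 0 <= y -> y ^+ m <= m%:R ^+ m * expR y.
Proof.
move=> m0 y0; have mR : (m%:R : R) != 0 by rewrite pnatr_eq0 -lt0n.
have e : expR y = expR (y / m%:R) ^+ m by rewrite -expRM_natr divfK.
rewrite e -exprMn -[y in leLHS](divfK mR) [_ / _ * _]mulrC lerXn2r// ?nnegrE.
- by rewrite mulr_ge0// divr_ge0.
- by rewrite mulr_ge0// expR_ge0.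
- by rewrite ler_wpM2l// (le_trans _ (expR_ge1Dx _))// lerDr.
Qed.

(* Half of the Gaussian exponent absorbs [g]; what is left is, up to the factor
   [Num.sqrt 2], the density with twice the variance. *)
Lemma integral_normal_prob_le (s C : R) (g : R -> R) : s != 0 ->
  measurable_fun setT g -> (forall x, 0 <= g x) ->
  (forall x, g x * expR (- (x ^+ 2 / (4 * s ^+ 2))) <= C) ->
  (\int[normal_prob 0 s]_x (g x)%:E <= (C * (3 / 2))%:E)%E.
Proof.
move=> s0 mg g0 gC; have C0 : 0 <= C by rewrite (le_trans _ (gC 0))// mulr_ge0// expR_ge0.
pose r := Num.sqrt 2 * s.
have r2 : r ^+ 2 = 2 * s ^+ 2 by rewrite exprMn sqr_sqrtr.
have r0 : r != 0 by rewrite mulf_neq0// sqrtr_eq0 -ltNge.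
have s20 : 0 < s ^+ 2 by rewrite exprn_even_gt0.
(* The two peaks differ by the factor [Num.sqrt 2], at most [3 / 2]. This is the [3 / 2] of all the
   moment bounds. *)
have peak : normal_peak s <= 3 / 2 * normal_peak r.
  rewrite /normal_peak r2; set a := s ^+ 2 * pi *+ 2.
  have -> : 2 * s ^+ 2 * pi *+ 2 = 2 * a by rewrite /a; ring.
  have a0 : 0 < a by rewrite /a mulrn_wgt0// mulr_gt0// pi_gt0.
  rewrite sqrtrM// invfM mulrA ler_peMl ?invr_ge0// ler_pdivlMr ?sqrtr_gt0// mul1r.
  rewrite -[leRHS]ger0_norm ?divr_ge0// -sqrtr_sqr ler_wsqrtr//.
  by rewrite expr_div_n ler_pdivlMr ?exprn_gt0//; lra.
have density : (\int[normal_prob 0 s]_x (g x)%:E = \int[mu]_x ((g x)%:E * (normal_pdf 0 s x)%:E))%E.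
  have := @weighted_integral_eq _ _ _ (measurableTypeR R) (measurableTypeR R) (measurableTypeR R) R
    (normal_prob 0 s) mu id id (cst 1) (normal_pdf 0 s) _ _ _ _ _ _ _ (EFin \o g).
  under eq_integral do rewrite mule1.
  apply=> //; first exact: measurable_normal_pdf.
  - by move=> x; exact: normal_pdf_ge0.
  - move=> A mA; transitivity (\int[normal_prob 0 s]_(x in A) cst 1%E x)%E => //.
    by rewrite integral_cst// mul1e.
  - exact/measurable_EFinP.
rewrite density; apply: (@le_trans _ _ (\int[mu]_x ((C * (3 / 2))%:E * (normal_pdf 0 r x)%:E))%E); last first.
  rewrite ge0_integralZl ?lee_fin//.
  - by rewrite integral_normal_pdf mule1.
  - apply/measurable_EFinP; exact: measurable_normal_pdf.
  - by move=> x _; rewrite lee_fin normal_pdf_ge0.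
  - by rewrite mulr_ge0// divr_ge0.
apply: ge0_le_integralW => x; first by rewrite mule_ge0 ?lee_fin// normal_pdf_ge0.
rewrite -!EFinM lee_fin /normal_pdf (negbTE s0) (negbTE r0) /normal_fun subr0.
set E := expR (- (x ^+ 2 / (4 * s ^+ 2))).
have -> : expR (- x ^+ 2 / (s ^+ 2 *+ 2)) = E * E.
  rewrite -expRD; by congr expR; field; rewrite ?s0 ?(gt_eqF s20).
have -> : expR (- x ^+ 2 / (r ^+ 2 *+ 2)) = E.
  rewrite r2; by congr expR; field; rewrite ?s0 ?(gt_eqF s20).
have E0 : 0 <= E by exact: expR_ge0.
have -> : g x * (normal_peak s * (E * E)) = (g x * E) * (normal_peak s * E) by ring.
rewrite -[leRHS]mulrA ler_pM ?mulr_ge0 ?normal_peak_ge0//.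
by rewrite mulrA ler_wpM2r.
Qed.

(** With [y = x^2 / (4 s^2)] the integrand is [(4 s^2)^m y^m], and [y^m <= m^m expR y], which the
    halved Gaussian exponent absorbs. Only the scaling in [s] matters, so the constant is not
    sharp. *)
Lemma normal_prob_even_moment (s : R) m : s != 0 -> (0 < m)%N ->
  (\int[normal_prob 0 s]_x (x ^+ (2 * m))%:E <= ((4 * m%:R) ^+ m * s ^+ (2 * m) * (3 / 2))%:E)%E.
Proof.
move=> s0 m0; have s20 : 0 < s ^+ 2 by rewrite exprn_even_gt0.
apply: (@integral_normal_prob_le s _ (fun x => x ^+ (2 * m))) => //.
- by move=> x; rewrite exprM exprn_ge0// sqr_ge0.
- move=> x; rewrite expRN ler_pdivrMr ?expR_gt0// !exprM.
  set y := x ^+ 2 / (4 * s ^+ 2).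
  have -> : x ^+ 2 = y * (4 * s ^+ 2) by rewrite divfK// mulf_neq0// gt_eqF.
  have y0 : 0 <= y by rewrite divr_ge0 ?sqr_ge0// mulr_ge0// sqr_ge0.
  have h := expr_le_expR m0 y0.
  rewrite [(4 * m%:R) ^+ m]exprMn.
  have k0 : 0 <= 4 ^+ m * (s ^+ 2) ^+ m by apply: mulr_ge0; apply: exprn_ge0 => //; exact: sqr_ge0.
  rewrite (_ : (y * (4 * s ^+ 2)) ^+ m = y ^+ m * (4 ^+ m * (s ^+ 2) ^+ m)); last by rewrite !exprMn.
  rewrite (_ : 4 ^+ m * m%:R ^+ m * (s ^+ 2) ^+ m * expR y = m%:R ^+ m * expR y * (4 ^+ m * (s ^+ 2) ^+ m)); last by ring.
  exact: ler_wpM2r.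
Qed.

Lemma normal_prob_opp (s : R) (A : set (measurableTypeR R)) : s != 0 -> measurable A ->
  normal_prob 0 s (-%R @^-1` A) = normal_prob 0 s A.
Proof.
move=> s0 mA; have mN : measurable_fun setT (-%R : measurableTypeR R -> measurableTypeR R) by exact: oppr_measurable.
rewrite /normal_prob.
have pN (x : R) : normal_pdf 0 s (- x) = normal_pdf 0 s x.
  by rewrite /normal_pdf (negbTE s0) /normal_fun !subr0 sqrrN.
transitivity (\int[pushforward mu (-%R : measurableTypeR R -> measurableTypeR R)]_(x in A) (normal_pdf 0 s x)%:E)%E; last first.
  by apply: eq_measure_integral => /= B mB _; exact: lebesgue_measureN.
rewrite ge0_integral_pushforward//.
- by apply: eq_integral => x _ /=; rewrite pN.
- by apply: measurable_funTS; apply/measurable_EFinP; exact: measurable_normal_pdf.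
- by move=> x _; rewrite lee_fin normal_pdf_ge0.
Qed.

(* The cross term averages out by symmetry. *)
Lemma normal_prob_affine_sqr (s a b : R) : s != 0 ->
  (\int[normal_prob 0 s]_z ((a + b * z) ^+ 2)%:E <= (a ^+ 2 + 6 * s ^+ 2 * b ^+ 2)%:E)%E.
Proof.
move=> s0; set N := normal_prob 0 s : probability (measurableTypeR R) R.
have mf (e : R) : measurable_fun setT (fun z : measurableTypeR R => ((a + e * z) ^+ 2)%:E).
  by apply/measurable_EFinP; apply: measurable_funX; apply: measurable_funD => //; exact: measurable_funM.
have mN : measurable_fun setT (-%R : measurableTypeR R -> measurableTypeR R) by exact: oppr_measurable.
have sym : (\int[N]_z ((a + - b * z) ^+ 2)%:E = \int[N]_z ((a + b * z) ^+ 2)%:E)%E.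
  transitivity (\int[pushforward N (-%R : measurableTypeR R -> measurableTypeR R)]_z ((a + b * z) ^+ 2)%:E)%E.
    rewrite ge0_integral_pushforward//; last by move=> z _; rewrite lee_fin sqr_ge0.
    by rewrite preimage_setT; apply: eq_integral => z _ /=; rewrite mulrN mulNr.
  by apply: eq_measure_integral => /= B mB _; exact: normal_prob_opp.
rewrite -(@lee_pmul2l _ 2%:E)//.
have -> : (2%:E * \int[N]_z ((a + b * z) ^+ 2)%:E =
    \int[N]_z ((2 * a ^+ 2)%:E + (2 * b ^+ 2)%:E * (z ^+ (2 * 1))%:E))%E.
  rewrite mule_natl mule2n -{2}sym -ge0_integralD//; last 2 first.
  - by move=> z _; rewrite lee_fin sqr_ge0.
  - by move=> z _; rewrite lee_fin sqr_ge0.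
  by apply: eq_integral => z _; rewrite -EFinM -!EFinD; congr (_%:E); rewrite muln1; ring.
have mz : measurable_fun setT (fun z : measurableTypeR R => (z ^+ (2 * 1))%:E).
  by apply/measurable_EFinP; exact: measurable_funX.
rewrite ge0_integralD//; last 3 first.
- by move=> z _; rewrite lee_fin mulr_ge0// sqr_ge0.
- by move=> z _; rewrite -EFinM lee_fin; apply: mulr_ge0; rewrite ?sqr_ge0// mulr_ge0// sqr_ge0.
- exact: emeasurable_funM.
rewrite integral_cst// ge0_integralZl//; last 2 first.
- by move=> z _; rewrite lee_fin sqr_ge0.
- by rewrite lee_fin mulr_ge0// sqr_ge0.
have b20 : (0 <= (2 * b ^+ 2)%:E)%E by rewrite lee_fin mulr_ge0// sqr_ge0.
have a20 : (0 <= (2 * a ^+ 2)%:E)%E by rewrite lee_fin mulr_ge0// sqr_ge0.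
apply: le_trans (leeD (lee_wpmul2l a20 (probability_le1 N measurableT))
  (lee_wpmul2l b20 (normal_prob_even_moment s0 (ltn0Sn 0)))) _.
by rewrite mule1 -!EFinM -EFinD lee_fin !expr1; lra.
Qed.

End normal_moments.

(** * Integrating out an independent variable *)

Section independence.
Context {disp : measure_display} {Omega : measurableType disp} {R : realType}.
Variables (P : probability Omega R) (G : set (set Omega)).
Hypothesis sG : sigma_algebra setT G.
Hypothesis Gm : G `<=` measurable.
Notation OmegaG := (g_sigma_algebraType G).

Lemma g_sigma_algebra_measurable (A : set OmegaG) : measurable A -> G A.
Proof. by rewrite -[X in _ -> X A](sigma_algebra_id sG). Qed.

Lemma rv_measurableP (X : Omega -> R) :
  rv_measurable G X <-> measurable_fun setT (X : OmegaG -> measurableTypeR R).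
Proof.
split=> [GX _ B mB|mX B mB].
  by rewrite setTI; rewrite /measurable/= (sigma_algebra_id sG); exact: GX.
by have := mX measurableT B mB; rewrite setTI => /g_sigma_algebra_measurable.
Qed.

Lemma measurable_id_sub : measurable_fun setT (id : Omega -> OmegaG).
Proof. by move=> _ A /g_sigma_algebra_measurable/Gm; rewrite setTI. Qed.

Lemma rv_measurable_fun (X : Omega -> R) : rv_measurable G X ->
  measurable_fun setT (X : Omega -> measurableTypeR R).
Proof. by move=> GX _ B mB; rewrite setTI; apply: Gm; exact: GX. Qed.

(** The identity from [Omega] to [Omega] with the smaller sigma-algebra [G] carries all
    [G]-measurable variables at once. Its joint law with [X] agrees with the product law on
    rectangles, hence everywhere, and Tonelli's theorem integrates [X] out. *)
Lemma independent_law (X : Omega -> measurableTypeR R) (N : probability (measurableTypeR R) R) :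
  measurable_fun setT X ->
  (forall A B, G A -> measurable B -> P (A `&` X @^-1` B) = (P A * N B)%E) ->
  forall h : OmegaG * measurableTypeR R -> \bar R, measurable_fun setT h -> (forall z, 0 <= h z)%E ->
  (\int[P]_w h (w, X w) = \int[P]_w \int[N]_z h (w, z))%E.
Proof.
move=> mX ind h mh h0.
pose idG : {mfun Omega >-> OmegaG} := mfun_Sub (mem_set measurable_id_sub).
have mpair : measurable_fun setT (fun w => (idG w, X w)) by exact/measurable_fun_pair.
pose pairG : {mfun Omega >-> (OmegaG * measurableTypeR R)%type} := mfun_Sub (mem_set mpair).
have law A : measurable A -> (distribution P idG \x N)%E A = distribution P pairG A.
  apply: product_measure_unique => B1 B2 mB1 mB2; rewrite /= /distribution /pushforward.
  rewrite -ind//; last exact: g_sigma_algebra_measurable.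
transitivity (\int[distribution P pairG]_z h z)%E.
  by rewrite ge0_integral_distribution.
transitivity (\int[(distribution P idG \x N)]_z h z)%E.
  by apply: eq_measure_integral => A mA _; exact/esym/law.
rewrite fubini_tonelli1// ge0_integral_distribution//.
- exact: measurable_fun_fubini_tonelli_F.
- by move=> w; apply: integral_ge0.
Qed.

End independence.

Section composition.
Context {d0 : measure_display} {T : measurableType d0} {R : realType} {d : nat}.

Definition row_floor (k : nat) (x : 'rV[R]_d) : 'rV[R]_d :=
  \row_i ((Num.floor (k.+1%:R * x 0 i))%:~R / k.+1%:R).

Lemma floor_div_dist k (y : R) : `|y - (Num.floor (k.+1%:R * y))%:~R / k.+1%:R| <= k.+1%:R^-1.
Proof.
have k0 : 0 < k.+1%:R :> R by [].
have := floor_le (k.+1%:R * y); have := floorD1_gt (k.+1%:R * y).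
set m := Num.floor _; rewrite intrD => h1 h2.
have kK : k.+1%:R * k.+1%:R^-1 = 1 :> R by rewrite mulfV.
rewrite ger0_norm ?subr_ge0 ?ler_pdivrMr// 1?mulrC//.
rewrite -(ler_pM2l k0) mulrBr mulrA kK mul1r lerBlDl ltW//.
Qed.

Lemma row_floor_dist k x : `|x - row_floor k x| <= k.+1%:R^-1.
Proof.
apply: row_norm_le => [|i]; first by rewrite invr_ge0.
by rewrite row_subE mxE floor_div_dist.
Qed.

Lemma row_floor_cvg x : row_floor k x @[k --> \oo] --> x.
Proof.
apply/(@cvgrPdist_le R 'rV[R]_d) => e e0; near=> k.
apply: le_trans (row_floor_dist k x) _.
near: k; have := @cvg_harmonic R; move/cvgrPdist_le => /(_ _ e0).
by apply: filterS => k; rewrite sub0r normrN ger0_norm// invr_ge0.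
Unshelve. all: by end_near. Qed.

(** Measurability is known coordinate by coordinate. Rounding the coordinates to multiples of
    [1 / (k + 1)] leaves countably many values, each taken on an event cut out by the coordinates,
    and [f] of the rounded rows converges to [f (X w)] by continuity. *)
Lemma measurable_row_comp (X : T -> 'rV[R]_d) (f : 'rV[R]_d -> R) :
  (forall i, measurable_fun setT (fun w => X w 0 i)) -> continuous f ->
  measurable_fun setT (fun w => f (X w)).
Proof.
move=> mX cf; apply: (@measurable_fun_cvg _ _ _ _ (fun k w => f (row_floor k (X w)))); last first.
  move=> w _; apply: (@cvg_comp _ _ _ (fun k => row_floor k (X w)) f).
    exact: row_floor_cvg.
  exact: cf.
move=> k _ B mB; rewrite setTI.
pose A (m : 'rV[int]_d) := if `[< B (f (\row_i ((m 0 i)%:~R / k.+1%:R))) >]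
  then \bigcap_(i in [set: 'I_d]) ((fun w => X w 0 i) @^-1`
     [set y | (m 0 i)%:~R <= k.+1%:R * y < (m 0 i)%:~R + 1]) else set0.
have -> : (fun w => f (row_floor k (X w))) @^-1` B = \bigcup_m A m.
  apply/seteqP; split=> [w /= Bw|w [m _]].
    pose m : 'rV[int]_d := \row_i Num.floor (k.+1%:R * X w 0 i).
    have mE : \row_i ((m 0 i)%:~R / k.+1%:R) = row_floor k (X w) by apply/rowP => i; rewrite !mxE.
    exists m => //; rewrite /A mE asboolT// => i _ /=.
    rewrite mxE; have := floor_itv (k.+1%:R * X w 0 i).
    by rewrite intrD.
  rewrite /A; case: asboolP => // Bm mw /=.
  suff -> : row_floor k (X w) = \row_i ((m 0 i)%:~R / k.+1%:R) by [].
  apply/rowP => i; rewrite !mxE; congr (_%:~R / _).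
  have /= := mw i I; rewrite -[X in _ + X]/(1%:~R) -intrD => h.
  exact: floor_def.
apply: countable_bigcupT_measurable; first exact: countableP.
move=> m; rewrite /A; case: asboolP => // _.
apply: fin_bigcap_measurable => // i _.
rewrite -[X in measurable X]setTI; apply: mX => //.
have -> : [set y : R | (m 0 i)%:~R <= k.+1%:R * y < (m 0 i)%:~R + 1] =
    `[(m 0 i)%:~R / k.+1%:R, ((m 0 i)%:~R + 1) / k.+1%:R[%classic.
  apply/seteqP; split => y /=; rewrite in_itv/=.
    by rewrite ler_pdivrMr// ltr_pdivlMr// mulrC.
  by rewrite ler_pdivrMr// ltr_pdivlMr// mulrC.
exact: measurable_itv.
Qed.

End composition.

(** * Exceptional events and boundedness in probability *)

Section off_event.
Context {disp : measure_display} {Omega : measurableType disp} {R : realType}.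
Variable P : probability Omega R.

(* [Q] holds outside an event of probability at most [de]; [Q] itself need not
   be measurable. *)
Definition off_event (de : R) (Q : Omega -> Prop) :=
  exists2 B : set Omega, measurable B /\ (P B <= de%:E)%E & forall w, ~ B w -> Q w.

Lemma off_eventW de Q Q' : (forall w, Q w -> Q' w) -> off_event de Q -> off_event de Q'.
Proof. by move=> QQ' [B PB BQ]; exists B => // w /BQ/QQ'. Qed.

Lemma off_event_le de de' Q : de <= de' -> off_event de Q -> off_event de' Q.
Proof.
move=> dd [B [mB PB] BQ]; exists B => //; split=> //.
by rewrite (le_trans PB)// lee_fin.
Qed.

Lemma off_eventI de de' Q Q' : off_event de Q -> off_event de' Q' ->
  off_event (de + de') (fun w => Q w /\ Q' w).
Proof.
move=> [B [mB PB] BQ] [C [mC PC] CQ]; exists (B `|` C); last first.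
  by move=> w /not_orP[/BQ ? /CQ ?].
split; first exact: measurableU.
by rewrite (le_trans (measureU2 _ _ _))// EFinD leeD.
Qed.

Lemma off_event_ae Q : {ae P, forall w, Q w} -> off_event 0 Q.
Proof.
move=> [B [mB PB BQ]]; exists B; first by rewrite PB.
by move=> w Bw; apply: contrapT => nQ; apply: Bw; exact: BQ.
Qed.

Lemma off_event_forall n de (Q : 'I_n -> Omega -> Prop) : 0 <= de ->
  (forall i, off_event (de / n%:R) (Q i)) -> off_event de (fun w => forall i, Q i w).
Proof.
move=> de0 QP.
have H (s : seq 'I_n) : off_event ((size s)%:R * (de / n%:R)) (fun w => forall i, i \in s -> Q i w).
  elim: s => [|i s ih].
    by rewrite mul0r; exists set0 => //; rewrite measure0.
  have := off_eventI (QP i) ih; rewrite /= -natr1 mulrDl mul1r addrC.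
  by apply: off_eventW => w [Qi Qs] j; rewrite inE => /predU1P[->|/Qs].
apply: off_event_le (off_eventW _ (H (enum 'I_n))) => [|w h i]; last by apply: h; rewrite mem_enum.
rewrite size_enum_ord; have [->|n0] := eqVneq n 0%N; first by rewrite mul0r.
by rewrite mulrC divfK// pnatr_eq0.
Qed.

Lemma off_event_markov (f : Omega -> R) (a e : R) : measurable_fun setT f ->
  (forall w, 0 <= f w) -> (\int[P]_w (f w)%:E <= a%:E)%E -> 0 < e ->
  off_event (a / e) (fun w => f w <= e).
Proof.
move=> mf f0 fa e0; exists [set w | e <= f w]; last first.
  by move=> w /negP; rewrite -ltNge => /ltW.
have mA : measurable [set w | e <= f w].
  rewrite (_ : [set w | _] = f @^-1` `[e, +oo[%classic).
    by rewrite -[X in measurable X]setTI; exact: mf.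
  by apply/seteqP; split=> w /=; rewrite in_itv/= andbT.
split=> //; rewrite EFinM lee_pdivlMr//.
apply: le_trans fa; rewrite muleC.
have -> : (e%:E * P [set w | (e <= f w)%R] = \int[P]_w (e%:E * (\1_[set w | (e <= f w)%R] w)%:E))%E.
  rewrite ge0_integralZl ?lee_fin ?ltW// ?integral_indic ?setIT//.
  exact/measurable_EFinP.
apply: ge0_le_integral => //.
- by move=> w _; rewrite -EFinM lee_fin mulr_ge0// ltW.
- by apply/measurable_EFinP; exact: measurable_funM.
- exact/measurable_EFinP.
- move=> w _; rewrite -EFinM lee_fin indicE.
  by case: (boolP (w \in _)); rewrite ?inE/= ?mulr1// mulr0.
Qed.

(** Boundedness in probability from above. The constant [K] is uniform in the index, the exceptional
    event is not. *)
Definition tight (I : Type) (xi : I -> Omega -> R) :=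
  forall de, 0 < de -> exists2 K, 0 < K & forall i, off_event de (fun w => xi i w <= K).

Lemma nonincreasing_event_small (A : nat -> set Omega) : (forall k, measurable (A k)) ->
  (forall k l, (k <= l)%N -> A l `<=` A k) -> {ae P, forall w, exists k, ~ A k w} ->
  forall de, 0 < de -> exists k, off_event de (fun w => ~ A k w).
Proof.
move=> mA hA [N [mN PN AN]] de de0.
have dA : nonincreasing_seq A by move=> k l kl; apply/subsetPset; exact: hA.
have PA : P (\bigcap_k A k) = 0%E.
  apply/eqP; rewrite eq_le measure_ge0 andbT -PN.
  apply: le_measure; rewrite ?inE//; first exact: bigcapT_measurable.
  by move=> w Aw; apply: AN => -[k]; apply; exact: Aw.
have A0 : (P (A 0%N) < +oo)%E by rewrite (le_lt_trans (probability_le1 P (mA _)))// ltry.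
have : P \o A @ \oo --> (0%:E : \bar R).
  rewrite -[0%:E]PA; exact: (nonincreasing_cvg_mu A0 mA (bigcapT_measurable mA) dA).
move=> /fine_cvgP[_ /cvgrPdist_lt/(_ _ de0)][k _ /(_ _ (leqnn k))]/=.
rewrite sub0r normrN => Pk; exists k; exists (A k) => //; split=> //.
rewrite -(@fineK _ (P (A k))) ?lee_fin; first exact: le_trans (ler_norm _) (ltW Pk).
by rewrite ge0_fin_numE// (le_lt_trans (probability_le1 P (mA _)))// ltry.
Qed.

(** The events that some [xi n] exceeds [k] decrease to a null set as [k] grows. Unlike in [tight],
    one exceptional event serves all [n]. *)
Lemma tight_of_ae_bounded (xi : nat -> Omega -> R) :
  (forall n, measurable_fun setT (xi n)) ->
  {ae P, forall w, exists K, forall n, xi n w <= K} ->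
  forall de, 0 < de -> exists2 K, 0 < K & off_event de (fun w => forall n, xi n w <= K).
Proof.
move=> mxi bxi de de0; pose A k := \bigcup_n [set w | k%:R < xi n w].
have mA k : measurable (A k).
  apply: bigcupT_measurable => n.
  rewrite (_ : [set w | _] = xi n @^-1` `]k%:R, +oo[%classic).
    by rewrite -[X in measurable X]setTI; exact: mxi.
  by apply/seteqP; split=> w /=; rewrite in_itv/= andbT.
have dA k l : (k <= l)%N -> A l `<=` A k.
  by move=> kl w [n _ /= h]; exists n => //=; apply: le_lt_trans h; rewrite ler_nat.
have [|k Pk] := nonincreasing_event_small mA dA _ de0.
  apply: filterS bxi => w [K xiK]; exists (Num.truncn `|K|).+1 => -[n _ /=].
  rewrite ltNge => /negP; apply; rewrite (le_trans (xiK n))// (le_trans (ler_norm _))//.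
  by rewrite ltW// truncnS_gt.
exists k.+1%:R => //; apply: off_eventW Pk => w Ak n; rewrite leNgt.
by apply/negP => h; apply: Ak; exists n => //=; apply: le_lt_trans h; rewrite ler_nat.
Qed.

End off_event.

(** * Brownian increments with adapted weights *)

Section brownian.
Context {disp : measure_display} {Omega : measurableType disp} {R : realType}.
Variables (P : probability Omega R) (F : R -> set (set Omega)) (W : R -> Omega -> R).
Hypothesis hF : complete_filtration P F.
Hypothesis hW : brownian_motion P F W.

Lemma filtration_sigma t : 0 <= t -> sigma_algebra setT (F t).
Proof. by case: hF => _ + _ _ t0 => /(_ t t0)[]. Qed.

Lemma filtration_sub t : 0 <= t -> F t `<=` measurable.
Proof. by case: hF => _ + _ _ t0 => /(_ t t0)[]. Qed.

Lemma rv_measurable_le s t (X : Omega -> R) : 0 <= s -> s <= t -> rv_measurable (F s) X -> rv_measurable (F t) X.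
Proof. by case: hF => _ _ mono _ s0 st mX B mB; apply: (mono s t s0 st); exact: mX. Qed.

Lemma bm_adapted t : 0 <= t -> rv_measurable (F t) (W t).
Proof. by case: hW => + _ _ _ _ t0; apply; rewrite /= in_itv/= t0. Qed.

Lemma adapted_measurable t (X : Omega -> R) : 0 <= t -> rv_measurable (F t) X ->
  measurable_fun setT X.
Proof. by move=> t0 mX; exact: (rv_measurable_fun (filtration_sub t0) mX). Qed.

Lemma bm_measurable t : 0 <= t -> measurable_fun setT (W t).
Proof. by move=> t0; exact: adapted_measurable t0 (bm_adapted t0). Qed.

Lemma bm_law s t : 0 <= s -> s < t ->
  forall h : g_sigma_algebraType (F s) * measurableTypeR R -> \bar R,
  measurable_fun setT h -> (forall z, 0 <= h z)%E ->
  (\int[P]_w h (w, W t w - W s w)%R =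
   \int[P]_w \int[normal_prob 0 (Num.sqrt (t - s))]_z h (w, z))%E.
Proof.
move=> s0 st h mh h0; case: (hW) => _ _ _ nW iW.
apply: (independent_law (filtration_sigma s0) (filtration_sub s0)
  (X := fun w => W t w - W s w)) => //.
  by apply: measurable_funB; apply: bm_measurable => //; rewrite (le_trans s0)// ltW.
by move=> A B FA mB; have := iW s t s0 st A FA B mB; rewrite (nW s t s0 st B mB).
Qed.

Lemma bm_weighted_moment s t m (Y : Omega -> R) : 0 <= s -> s < t -> (0 < m)%N ->
  rv_measurable (F s) Y ->
  (\int[P]_w (Y w ^+ 2 * (W t w - W s w) ^+ (2 * m))%:E <=
   ((4 * m%:R) ^+ m * (3 / 2) * (t - s) ^+ m)%:E * \int[P]_w (Y w ^+ 2)%:E)%E.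
Proof.
move=> s0 st m0 mY; have ts0 : 0 < t - s by rewrite subr_gt0.
have mYG := (rv_measurableP (filtration_sigma s0) Y).1 mY.
have mYP := adapted_measurable s0 mY.
set K := (4 * m%:R) ^+ m * (3 / 2) * (t - s) ^+ m.
have K0 : 0 <= K.
  by rewrite !mulr_ge0// ?invr_ge0// exprn_ge0// ?(ltW ts0)// mulr_ge0.
rewrite (@bm_law s t s0 st (fun z => (Y z.1 ^+ 2 * z.2 ^+ (2 * m))%:E)); last 2 first.
- apply/measurable_EFinP; apply: measurable_funM; apply: measurable_funX => //.
  exact: (measurableT_comp mYG).
- by move=> z; rewrite lee_fin mulr_ge0 ?sqr_ge0// exprM exprn_ge0// sqr_ge0.
rewrite -ge0_integralZl//; first last.
- by move=> w _; rewrite lee_fin sqr_ge0.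
- by apply/measurable_EFinP; exact: measurable_funX.
apply: ge0_le_integralW => [w|w].
  by apply: integral_ge0 => z _; rewrite lee_fin mulr_ge0 ?sqr_ge0// exprM exprn_ge0// sqr_ge0.
under eq_integral do rewrite EFinM /=.
rewrite ge0_integralZl//=; first last.
- by rewrite lee_fin sqr_ge0.
- by move=> z _; rewrite lee_fin exprM exprn_ge0// sqr_ge0.
- by apply/measurable_EFinP; exact: measurable_funX.
rewrite muleC lee_wpmul2r ?lee_fin ?sqr_ge0//.
have st0 : Num.sqrt (t - s) != 0 by rewrite gt_eqF// sqrtr_gt0.
apply: le_trans (normal_prob_even_moment st0 m0) _.
rewrite lee_fin exprM sqr_sqrtr ?(ltW ts0)// /K le_eqVlt; apply/orP; left; apply/eqP; ring.
Qed.

(** Once the increment is integrated out, [S w] and [Z w] are constants and [normal_prob_affine_sqr]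
    removes the cross term. Only integrals of nonnegative functions occur, so infinite values are
    harmless. *)
Lemma bm_isometry s t (S Z : Omega -> R) : 0 <= s -> s < t ->
  rv_measurable (F s) S -> rv_measurable (F s) Z ->
  (\int[P]_w ((S w + Z w * (W t w - W s w)) ^+ 2)%:E <=
   \int[P]_w (S w ^+ 2)%:E + (6 * (t - s))%:E * \int[P]_w (Z w ^+ 2)%:E)%E.
Proof.
move=> s0 st mS mZ; have ts0 : 0 < t - s by rewrite subr_gt0.
have st0 : Num.sqrt (t - s) != 0 by rewrite gt_eqF// sqrtr_gt0.
have mSG := (rv_measurableP (filtration_sigma s0) S).1 mS.
have mZG := (rv_measurableP (filtration_sigma s0) Z).1 mZ.
have mSP := adapted_measurable s0 mS; have mZP := adapted_measurable s0 mZ.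
have sq (f : Omega -> R) : forall w, setT w -> (0 <= (f w ^+ 2)%:E)%E by move=> w _; rewrite lee_fin sqr_ge0.
have mS2 : measurable_fun setT (fun w => (S w ^+ 2)%:E) by apply/measurable_EFinP; exact: measurable_funX.
have mZ2 : measurable_fun setT (fun w => (Z w ^+ 2)%:E) by apply/measurable_EFinP; exact: measurable_funX.
have c0 : (0 <= (6 * (t - s))%:E)%E by rewrite lee_fin mulr_ge0// ltW.
rewrite (@bm_law s t s0 st (fun z => ((S z.1 + Z z.1 * z.2) ^+ 2)%:E)); last 2 first.
- apply/measurable_EFinP; apply: measurable_funX; apply: measurable_funD.
    exact: (measurableT_comp mSG).
  by apply: measurable_funM => //; exact: (measurableT_comp mZG).
- by move=> z; rewrite lee_fin sqr_ge0.
apply: (@le_trans _ _ (\int[P]_w ((S w ^+ 2)%:E + (6 * (t - s))%:E * (Z w ^+ 2)%:E))%E).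
  apply: ge0_le_integralW => w; first by apply: integral_ge0 => z _; rewrite lee_fin sqr_ge0.
  have := normal_prob_affine_sqr (S w) (Z w) st0.
  by rewrite sqr_sqrtr ?(ltW ts0)// EFinD EFinM.
rewrite ge0_integralD//; last 3 first.
- exact: sq.
- by move=> w _; rewrite mule_ge0// lee_fin sqr_ge0.
- exact: emeasurable_funM.
by rewrite ge0_integralZl// => w _; exact: sq.
Qed.

(** The Ito isometry as an inequality, with 6 in place of 1 because of the crude Gaussian moment.
    The sum up to step [n] is measurable at time [tau n], so increments can be added one by one with
    [bm_isometry]. *)
Lemma ito_sum_le (tau : nat -> R) (Z : nat -> Omega -> R) n : 0 <= tau 0%N ->
  (forall i, tau i < tau i.+1) -> (forall i, (i < n)%N -> rv_measurable (F (tau i)) (Z i)) ->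
  (\int[P]_w ((\sum_(i < n) Z i w * (W (tau i.+1) w - W (tau i) w)) ^+ 2)%:E <=
   \sum_(i < n) (6 * (tau i.+1 - tau i))%:E * \int[P]_w (Z i w ^+ 2)%:E)%E.
Proof.
move=> tau0 dtau; have htau : {homo tau : i j / (i <= j)%N >-> i <= j}.
  by apply: homo_leq => // [x y z|i]; [exact: le_trans|rewrite ltW].
have tge i : 0 <= tau i by rewrite (le_trans tau0)// htau.
elim: n => [|n ih] mZ.
  by rewrite big_ord0; under eq_integral do rewrite big_ord0 expr0n/=; rewrite integral0.
under eq_integral do rewrite big_ord_recr/=.
rewrite big_ord_recr/=.
apply: le_trans (@bm_isometry (tau n) (tau n.+1) (fun w => \sum_(i < n) Z i w * (W (tau i.+1) w - W (tau i) w)) (Z n) _ _ _ _) _ => //.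
- apply/(rv_measurableP (filtration_sigma (tge n))); apply: measurable_sum => i.
  have ti : tau i <= tau n by rewrite htau// ltnW.
  apply: measurable_funM.
    apply/(rv_measurableP (filtration_sigma (tge n))).
    by apply: rv_measurable_le ti _ => //; apply: mZ; rewrite ltnS ltnW.
  apply: measurable_funB; apply/(rv_measurableP (filtration_sigma (tge n))).
    by apply: (@rv_measurable_le (tau i.+1)) => //; [exact: htau|exact: bm_adapted].
  by apply: rv_measurable_le ti _ => //; exact: bm_adapted.
- exact: mZ.
- by rewrite leeD2r// ih// => i ni; apply: mZ; rewrite ltnS ltnW.
Qed.

End brownian.

(** * Quadratic variation *)

Section orthogonality.
Context {disp : measure_display} {Omega : measurableType disp} {R : realType}.
Variables (P : probability Omega R) (G : set (set Omega)).
Hypothesis sG : sigma_algebra setT G.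
Hypothesis Gm : G `<=` measurable.

(** The martingale property is given on events only. Split [f] into its positive and negative parts:
    as densities these define measures that agree on [G], hence give the same integral to the
    nonnegative [G]-measurable [Z + K]. The shift by [K] costs a multiple of the integral of [f],
    which is 0. *)
Lemma integral_orthogonal (Z f : Omega -> R) (K : R) : rv_measurable G Z ->
  (forall w, `|Z w| <= K) -> P.-integrable setT (EFin \o f) ->
  (forall A, G A -> \int[P]_(w in A) (f w)%:E = 0)%E ->
  \int[P]_w (Z w * f w) = 0.
Proof.
move=> mZ ZK fi fA; pose p w := Num.max (f w) 0; pose q w := Num.max (- f w) 0.
have mf : measurable_fun setT f by case/integrableP : fi => /measurable_EFinP.
have mp : measurable_fun setT p by exact: measurable_maxr.
have mq : measurable_fun setT q by apply: measurable_maxr => //; exact: measurable_funN.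
have p0 w : 0 <= p w by rewrite le_max lexx orbT.
have q0 w : 0 <= q w by rewrite le_max lexx orbT.
have fE w : f w = p w - q w by rewrite /p /q; have [?|?] := leP (f w) 0; have [?|?] := leP (- f w) 0; lra.
have pf w : `|p w| <= `|f w| by rewrite ger0_norm// /p ge_max normr_ge0 ler_norm.
have qf w : `|q w| <= `|f w| by rewrite ger0_norm// /q ge_max normr_ge0 -normrN ler_norm.
have ip : P.-integrable setT (EFin \o p).
  by apply: le_integrable fi => //; [exact/measurable_EFinP|move=> w _; rewrite lee_fin].
have iq : P.-integrable setT (EFin \o q).
  by apply: le_integrable fi => //; [exact/measurable_EFinP|move=> w _; rewrite lee_fin].
have pq A : G A -> (\int[P]_(w in A) (p w)%:E = \int[P]_(w in A) (q w)%:E)%E.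
  move=> GA; have mA := Gm GA; have := fA A GA.
  have ipA := integrableS measurableT mA (@subsetT _ A) ip.
  have iqA := integrableS measurableT mA (@subsetT _ A) iq.
  under eq_integral do rewrite fE EFinB.
  rewrite integralB//.
  rewrite -(fineK (integrable_fin_num mA ipA)) -(fineK (integrable_fin_num mA iqA)).
  by rewrite -EFinB => -[/eqP]; rewrite subr_eq0 => /eqP ->.
have K0 w : 0 <= Z w + K by have := ZK w; rewrite ler_norml; lra.
have mZG := (rv_measurableP sG Z).1 mZ.
have mZP := rv_measurable_fun Gm mZ.
have E : (\int[P]_w ((Z w + K)%:E * (p w)%:E) = \int[P]_w ((Z w + K)%:E * (q w)%:E))%E.
  apply: (@weighted_integral_eq _ _ _ Omega Omega (g_sigma_algebraType G) R P P id id p q _ _ _ _ _ _ _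
    (fun w => (Z w + K)%:E)) => //.
  - exact: measurable_id_sub.
  - exact: measurable_id_sub.
  - by move=> A /(g_sigma_algebra_measurable sG)/pq.
  - by apply/measurable_EFinP; exact: measurable_funD.
have ib (g h : Omega -> R) (C : R) : measurable_fun setT g -> (forall w, `|g w| <= C) ->
    P.-integrable setT (EFin \o h) -> P.-integrable setT (EFin \o (fun w => g w * h w)).
  move=> mg gC ih; have mh : measurable_fun setT h by case/integrableP : (ih) => /measurable_EFinP.
  apply: (integrable_dominated (C := C)) ih => [|w]; first exact: measurable_funM.
  by rewrite normrM ler_wpM2r.
have mZK : measurable_fun setT (fun w => Z w + K) by exact: measurable_funD.
have ZKK w : `|Z w + K| <= K + K by rewrite ger0_norm// lerD2r (le_trans (ler_norm _)).
have iZp := ib _ _ _ mZK ZKK ip; have iZq := ib _ _ _ mZK ZKK iq.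
have E' : \int[P]_w ((Z w + K) * p w) = \int[P]_w ((Z w + K) * q w).
  rewrite /Rintegral; congr fine.
  by under eq_integral do rewrite EFinM; rewrite E; under [RHS]eq_integral do rewrite EFinM.
have f0 : \int[P]_w f w = 0.
  by rewrite /Rintegral fA//; case: sG => G0 GC _; rewrite -(setD0 setT); exact: GC.
have -> : \int[P]_w (Z w * f w) =
    \int[P]_w (((Z w + K) * p w - (Z w + K) * q w) - K * f w).
  by apply: eq_Rintegral => w _; rewrite [X in Z w * X]fE [X in K * X]fE; ring.
rewrite RintegralB//; last 2 first.
- exact: integrable_sub.
- exact: integrable_scale.
by rewrite RintegralB// E' subrr RintegralZl// f0 mulr0 subrr.
Qed.

End orthogonality.

Section huber.
Context {R : realType}.
Variable K : R.
Hypothesis K0 : 0 <= K.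

Definition clip (x : R) := Num.max (- K) (Num.min x K).

(* The primitive of [2 * clip]: quadratic on [[-K, K]], linear outside. *)
Definition huber (x : R) := 2 * x * clip x - clip x ^+ 2.

Lemma clip_bound x : `|clip x| <= K.
Proof.
rewrite ler_norml /clip le_max lexx/= ge_max ge_min lexx orbT andbT.
by rewrite -subr_ge0 opprK addr_ge0.
Qed.

Lemma clip_id x : `|x| <= K -> clip x = x.
Proof.
rewrite ler_norml => /andP[Kx xK]; rewrite /clip min_l//.
by rewrite max_r.
Qed.

(** The right side minus the left side is [2 (clip y - clip x) (y - clip y)], nonnegative because
    [clip] is the projection onto the interval [[-K, K]], to which [clip x] belongs. *)
Lemma huber_bregman x y :
  (clip y - clip x) ^+ 2 <= huber y - huber x - 2 * clip x * (y - x).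
Proof.
have h : 0 <= (clip y - clip x) * (y - clip y).
  have := clip_bound x; rewrite ler_norml => /andP[Kx xK].
  have [yK|yK] := leP y K; last first.
    have -> : clip y = K.
      by rewrite /clip (min_r (ltW yK)) max_r//; lra.
    by rewrite mulr_ge0 ?subr_ge0// ltW.
  have [Ky|Ky] := leP (- K) y.
    by rewrite clip_id ?subrr ?mulr0// ler_norml Ky yK.
  have -> : clip y = - K by rewrite /clip (min_l yK) max_l// ltW.
  by rewrite mulr_le0// subr_le0// ltW.
rewrite /huber; nra.
Qed.

Lemma huber_ge0 x : 0 <= huber x.
Proof.
have c0 : clip 0 = 0 by rewrite clip_id// normr0.
have := huber_bregman 0 x; rewrite /huber c0 !(subr0, mulr0, expr0n, mul0r)/= => h.
by rewrite (le_trans _ h)// sqr_ge0.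
Qed.

Lemma huber_le x : huber x <= 2 * K * `|x|.
Proof.
rewrite /huber; have h : x * clip x <= `|x| * K.
  by rewrite (le_trans (ler_norm _))// normrM ler_wpM2l// clip_bound.
have := sqr_ge0 (clip x); nra.
Qed.

Lemma measurable_clip : measurable_fun setT clip.
Proof. by apply: measurable_maxr => //; exact: measurable_minr. Qed.

End huber.

Section martingale_qv.
Context {disp : measure_display} {Omega : measurableType disp} {R : realType}.
Variables (P : probability Omega R) (F : R -> set (set Omega)).
Hypothesis hF : complete_filtration P F.
Variable T : R.

Let sF t (t0 : 0 <= t) := filtration_sigma hF t0.
Let Fm t (t0 : 0 <= t) := filtration_sub hF t0.

Lemma rv_measurable_comp (G : set (set Omega)) (X : Omega -> R) (f : R -> R) :
  rv_measurable G X -> measurable_fun setT f -> rv_measurable G (f \o X).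
Proof.
move=> mX mf B mB; rewrite comp_preimage; apply: mX.
by rewrite -[X in measurable X]setTI; exact: mf.
Qed.

(** A martingale is only integrable here, so its squared increments may have infinite mean. Clipping
    makes the squares bounded, while [huber] grows linearly and so keeps [huber K (M t w)]
    integrable. In [huber_bregman] the cross term has mean 0, since [clip K (M s w)] is bounded and
    known at time [s]. *)
Lemma martingale_clip_step (M : R -> Omega -> R) (K s t : R) : 0 <= K ->
  martingale P F T M -> 0 <= s -> s <= t -> t <= T ->
  \int[P]_w ((clip K (M t w) - clip K (M s w)) ^+ 2) <=
  \int[P]_w huber K (M t w) - \int[P]_w huber K (M s w).
Proof.
move=> K0 [aM iM mM] s0 st tT; have t0 : 0 <= t := le_trans s0 st.
have sT : s <= T := le_trans st tT.
have aMs : rv_measurable (F s) (M s) by apply: aM; rewrite /= in_itv/= s0.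
have aMt : rv_measurable (F t) (M t) by apply: aM; rewrite /= in_itv/= t0.
have mMs := rv_measurable_fun (Fm s0) aMs; have mMt := rv_measurable_fun (Fm t0) aMt.
have iMs : P.-integrable setT (EFin \o M s) by apply: iM; rewrite s0.
have iMt : P.-integrable setT (EFin \o M t) by apply: iM; rewrite t0.
have mc (X : Omega -> R) : measurable_fun setT X -> measurable_fun setT (fun w => clip K (X w)).
  by move=> mX; exact: (measurableT_comp (measurable_clip K)).
have mh (X : Omega -> R) : measurable_fun setT X -> measurable_fun setT (fun w => huber K (X w)).
  move=> mX; apply: measurable_funB.
    by apply: measurable_funM; [exact: measurable_funM|exact: mc].
  by apply: measurable_funX; exact: mc.
have ih (X : Omega -> R) : measurable_fun setT X -> P.-integrable setT (EFin \o X) ->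
    P.-integrable setT (EFin \o (fun w => huber K (X w))).
  move=> mX iX; apply: (integrable_dominated (C := 2 * K)) iX => [|w]; first exact: mh.
  by rewrite ger0_norm ?huber_ge0// huber_le.
have iD : P.-integrable setT (EFin \o (fun w => M t w - M s w)) by exact: integrable_sub.
have icD : P.-integrable setT (EFin \o (fun w => 2 * (clip K (M s w) * (M t w - M s w)))).
  apply: (integrable_dominated (C := 2 * K)) iD => [|w].
    by apply: measurable_funM => //; apply: measurable_funM; [exact: mc|exact: measurable_funB].
  by rewrite !normrM ger0_norm// -mulrA ler_wpM2l// ler_wpM2r// clip_bound.
have cross : \int[P]_w (clip K (M s w) * (M t w - M s w)) = 0.
  apply: (@integral_orthogonal _ _ _ P (F s) (sF s0) (Fm s0) (clip K \o M s) _ K) => //.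
  - apply: rv_measurable_comp => //; exact: measurable_clip.
  - by move=> w; exact: clip_bound.
  - move=> A FA; have mA := Fm s0 FA.
    under eq_integral do rewrite EFinB.
    rewrite integralB//; last 2 first.
    + exact: (integrableS measurableT mA (@subsetT _ A) iMt).
    + exact: (integrableS measurableT mA (@subsetT _ A) iMs).
    rewrite (mM s t s0 st tT A FA) subee//.
    exact: (integrable_fin_num mA (integrableS measurableT mA (@subsetT _ A) iMs)).
have icross : P.-integrable setT (EFin \o (fun w => clip K (M s w) * (M t w - M s w))).
  apply: (integrable_dominated (C := K)) iD => [|w].
    by apply: measurable_funM; [exact: mc|exact: measurable_funB].
  by rewrite normrM ler_wpM2r// clip_bound.
have -> : \int[P]_w huber K (M t w) - \int[P]_w huber K (M s w) =
    \int[P]_w (huber K (M t w) - huber K (M s w) - 2 * (clip K (M s w) * (M t w - M s w))).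
  have iB : P.-integrable setT (EFin \o (fun w => huber K (M t w) - huber K (M s w))).
    by apply: integrable_sub; exact: ih.
  rewrite (RintegralB measurableT iB icD) (RintegralZl 2 measurableT icross) cross mulr0 subr0.
  by rewrite (RintegralB measurableT (ih _ mMt iMt) (ih _ mMs iMs)).
have iB : P.-integrable setT (EFin \o (fun w => huber K (M t w) - huber K (M s w) -
    2 * (clip K (M s w) * (M t w - M s w)))).
  by apply: integrable_sub => //; apply: integrable_sub; exact: ih.
have br w : (clip K (M t w) - clip K (M s w)) ^+ 2 <=
    huber K (M t w) - huber K (M s w) - 2 * (clip K (M s w) * (M t w - M s w)).
  by rewrite mulrA huber_bregman.
have mB : measurable_fun setT (fun w => (clip K (M t w) - clip K (M s w)) ^+ 2).
  by apply: measurable_funX; apply: measurable_funB; exact: mc.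
apply: le_Rintegral => //.
apply: (integrable_dominated (C := 1)) iB => // w.
by rewrite mul1r ger0_norm ?sqr_ge0// (le_trans (br w))// ler_norm.
Qed.

Definition qv_sum (X : R -> Omega -> R) (tau : nat -> R) n (w : Omega) : R :=
  \sum_(i < n) (X (tau i.+1) w - X (tau i) w) ^+ 2.

(** The means of [huber] telescope, the initial one is nonnegative, and the final one is bounded by
    linear growth. The result depends on the grid through its last point only. *)
Lemma martingale_clip_qv (M : R -> Omega -> R) (K : R) (tau : nat -> R) n : 0 <= K ->
  martingale P F T M -> 0 <= tau 0%N -> (forall i, tau i <= tau i.+1) -> tau n <= T ->
  (\int[P]_w (qv_sum (fun t w => clip K (M t w)) tau n w)%:E <=
   (2 * K * \int[P]_w `|M (tau n) w|)%:E)%E.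
Proof.
move=> K0 mM t0 dt tT; have [aM iM _] := mM.
have ht : {homo tau : i j / (i <= j)%N >-> i <= j}.
  by apply: homo_leq => // [x y z]; exact: le_trans.
have tge i : 0 <= tau i by rewrite (le_trans t0)// ht.
have mMt i : (i <= n)%N -> measurable_fun setT (M (tau i)).
  move=> ni; apply: (rv_measurable_fun (Fm (tge i))); apply: aM.
  by rewrite /= in_itv/= tge (le_trans (ht _ _ ni)).
have iMt i : (i <= n)%N -> P.-integrable setT (EFin \o M (tau i)).
  by move=> ni; apply: iM; rewrite tge (le_trans (ht _ _ ni)).
have mc i : (i <= n)%N -> measurable_fun setT (fun w => clip K (M (tau i) w)).
  by move=> ni; apply: (measurableT_comp (measurable_clip K)); exact: mMt.
have mh i : (i <= n)%N -> measurable_fun setT (fun w => huber K (M (tau i) w)).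
  move=> ni; apply: measurable_funB.
    by apply: measurable_funM; [apply: measurable_funM => //; exact: mMt|exact: mc].
  by apply: measurable_funX; exact: mc.
have ih i : (i <= n)%N -> P.-integrable setT (EFin \o (fun w => huber K (M (tau i) w))).
  move=> ni; apply: (integrable_dominated (C := 2 * K)) (iMt i ni) => [|w]; first exact: mh.
  by rewrite ger0_norm ?huber_ge0// huber_le.
have mq i : (i < n)%N -> measurable_fun setT (fun w => (clip K (M (tau i.+1) w) - clip K (M (tau i) w)) ^+ 2).
  by move=> ni; apply: measurable_funX; apply: measurable_funB; apply: mc => //; exact: ltnW.
have iq i : (i < n)%N -> P.-integrable setT (EFin \o (fun w => (clip K (M (tau i.+1) w) - clip K (M (tau i) w)) ^+ 2)).
  move=> ni; apply: (@le_integrable _ _ _ _ setT _ _ (fun=> (4 * K ^+ 2)%:E)) => //.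
  - by apply/measurable_EFinP; exact: mq.
  - move=> w _; rewrite lee_fin [X in _ <= X]ger0_norm ?mulr_ge0 ?sqr_ge0// ger0_norm ?sqr_ge0//.
    have := clip_bound K0 (M (tau i.+1) w); have := clip_bound K0 (M (tau i) w).
    rewrite !ler_norml => /andP[? ?] /andP[? ?]; nra.
  - exact: finite_measure_integrable_cst.
have EF (f : Omega -> R) : P.-integrable setT (EFin \o f) -> (\int[P]_w (f w)%:E = (\int[P]_w f w)%:E)%E.
  by move=> fi; rewrite /Rintegral fineK//; exact: (integrable_fin_num measurableT fi).
have step k : (k <= n)%N -> (\int[P]_w (qv_sum (fun t w => clip K (M t w)) tau k w)%:E <=
    (\int[P]_w huber K (M (tau k) w) - \int[P]_w huber K (M (tau 0%N) w))%:E)%E.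
  elim: k => [|k ihk] kn.
    by rewrite subrr; under eq_integral do rewrite /qv_sum big_ord0; rewrite integral0.
  under eq_integral do rewrite /qv_sum big_ord_recr/= EFinD.
  rewrite ge0_integralD//; last 4 first.
  - by move=> w _; rewrite lee_fin sumr_ge0// => i _; exact: sqr_ge0.
  - apply/measurable_EFinP; apply: measurable_sum => i; apply: mq.
    by rewrite (ltn_trans (ltn_ord i)).
  - by move=> w _; rewrite lee_fin sqr_ge0.
  - by apply/measurable_EFinP; exact: mq.
  apply: (@le_trans _ _ ((\int[P]_w huber K (M (tau k) w) - \int[P]_w huber K (M (tau 0%N) w))%:E +
     (\int[P]_w huber K (M (tau k.+1) w) - \int[P]_w huber K (M (tau k) w))%:E)%E).
    apply: leeD; first by apply: ihk; exact: ltnW.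
    rewrite (EF _ (iq k kn)) lee_fin; apply: martingale_clip_step => //.
    by rewrite (le_trans (ht _ _ kn)).
  by rewrite -EFinD lee_fin addrC addrA subrK.
apply: le_trans (step n (leqnn n)) _; rewrite lee_fin.
apply: (@le_trans _ _ (\int[P]_w huber K (M (tau n) w))).
  by rewrite gerBl; apply: Rintegral_ge0 => w _; exact: huber_ge0.
have inM : P.-integrable setT (EFin \o (fun w => `|M (tau n) w|)).
  exact: (integrable_norm (iMt n (leqnn n))).
rewrite -(RintegralZl (2 * K) measurableT inM); apply: le_Rintegral => //.
- exact: ih.
- exact: integrable_scale.
- by move=> w _; exact: huber_le.
Qed.

End martingale_qv.

Section grid.
Context {R : realType}.

Definition grid (t : R) n i : R := t * (i%:R / n.+1%:R).

Lemma grid0 t n : grid t n 0 = 0.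
Proof. by rewrite /grid mul0r mulr0. Qed.

Lemma grid_end t n : grid t n n.+1 = t.
Proof. by rewrite /grid divff ?mulr1// pnatr_eq0. Qed.

Lemma grid_step t n i : grid t n i.+1 - grid t n i = t / n.+1%:R.
Proof. by rewrite /grid -natr1; field; rewrite addrC natr1 pnatr_eq0. Qed.

Lemma grid_lt n i t : 0 < t -> grid t n i < grid t n i.+1.
Proof. by move=> t0; rewrite -subr_gt0 grid_step divr_gt0. Qed.

Lemma grid_mono t n : 0 < t -> {homo grid t n : i j / (i <= j)%N >-> i <= j}.
Proof.
move=> t0; apply: homo_leq => // [x y z|i]; first exact: le_trans.
by rewrite ltW// grid_lt.
Qed.

Lemma grid_ge0 t n i : 0 < t -> 0 <= grid t n i.
Proof. by move=> t0; rewrite -(grid0 t n) grid_mono. Qed.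

Lemma grid_le t n i : 0 < t -> (i <= n.+1)%N -> grid t n i <= t.
Proof. by move=> t0 ni; rewrite -[leRHS](grid_end t n) grid_mono. Qed.

End grid.

Section partition_seq.
Context {R : realType}.
Variable tau : nat -> R.
Hypothesis tau_lt : forall i, tau i < tau i.+1.

Definition partition_seq k : seq R := mkseq (fun j => tau j.+1) k.

Lemma nth_partition_seq x0 k i : (i <= k)%N -> nth x0 (tau 0%N :: partition_seq k) i = tau i.
Proof. by case: i => [|i] //= ik; rewrite nth_mkseq. Qed.

Lemma itv_partition_seq k : itv_partition (tau 0%N) (tau k) (partition_seq k).
Proof.
split; last first.
  by case: k => [|k]//; rewrite (last_nth 0) size_mkseq nth_partition_seq.
apply/(pathP 0) => i; rewrite size_mkseq => ik.
by rewrite nth_partition_seq 1?ltnW// nth_mkseq.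
Qed.

Lemma zip_partition_seq k : zip (tau 0%N :: partition_seq k) (partition_seq k) =
  mkseq (fun j => (tau j, tau j.+1)) k.
Proof.
have zp (a : R) s : zip (a :: s) s = pairmap pair a s by elim: s a => //= x s ih a; rewrite ih.
rewrite zp; apply: (@eq_from_nth _ (0, 0)) => [|i].
  by rewrite size_pairmap !size_mkseq.
rewrite size_pairmap size_mkseq => ik.
rewrite (nth_pairmap 0) ?size_mkseq// nth_partition_seq 1?ltnW//.
by rewrite !nth_mkseq.
Qed.

Lemma big_partition_seq (G : R * R -> R) k :
  \sum_(x <- zip (tau 0%N :: partition_seq k) (partition_seq k)) G x =
  \sum_(i < k) G (tau i, tau i.+1).
Proof.
rewrite zip_partition_seq /mkseq big_map -[k in iota 0 k]subn0.
exact: big_mkord.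
Qed.

Lemma mesh_partition_seq k (eta : R) : (forall i, (i < k)%N -> tau i.+1 - tau i < eta) ->
  mesh_lt (tau 0%N) (partition_seq k) eta.
Proof.
move=> te x; rewrite zip_partition_seq => /(nthP (0, 0))[i].
by rewrite size_mkseq => ik <-; rewrite nth_mkseq//=; exact: te.
Qed.

End partition_seq.

Section qv_tight.
Context {disp : measure_display} {Omega : measurableType disp} {R : realType}.
Variables (P : probability Omega R) (F : R -> set (set Omega)).
Hypothesis hF : complete_filtration P F.
Variable T : R.

Definition qv_tight (X : R -> Omega -> R) (t : R) :=
  tight P (fun n => qv_sum X (grid t n) n.+1).

Lemma continuous_path_bounded (f : R -> R) : {within `[0, T], continuous f} ->
  exists K, forall s, 0 <= s <= T -> `|f s| <= K.
Proof.
move=> cf; have := continuous_compact cf (@segment_compact R 0 T).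
move=> /(@compact_bounded _ R)[M [_ MP]]; exists (`|M| + 1) => s sT.
apply: (MP (`|M| + 1)); first by rewrite (le_lt_trans (ler_norm _))// ltrDl.
by exists s => //; rewrite /= in_itv/=.
Qed.

(** All points of all grids form a countable family, enumerated through [unpickle], so one
    exceptional event covers them. Codes of no grid point get the value 0. *)
Lemma grid_bounded (M : R -> Omega -> R) t : 0 < t -> t <= T ->
  (forall s, 0 <= s <= T -> measurable_fun setT (M s)) ->
  {ae P, forall w, exists K, forall s, 0 <= s <= T -> `|M s w| <= K} ->
  forall de, 0 < de -> exists2 K, 0 < K &
    off_event P de (fun w => forall n i, (i <= n.+1)%N -> `|M (grid t n i) w| <= K).
Proof.
move=> t0 tT mM bM de de0.
have gT n i : (i <= n.+1)%N -> 0 <= grid t n i <= T.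
  by move=> ni; rewrite grid_ge0// (le_trans (grid_le t0 ni)).
pose xi m w := if unpickle m is Some (n, i) then
  (if (i <= n.+1)%N then `|M (grid t n i) w| else 0) else 0 : R.
have [||K K0 KP] := @tight_of_ae_bounded _ _ _ P xi _ _ de de0.
- move=> m; rewrite /xi; case: (unpickle m) => [[n i]|]; last exact: measurable_cst.
  have [ni|ni] := boolP (i <= n.+1)%N; last exact: measurable_cst.
  by apply: measurableT_comp => //; apply: mM; exact: gT.
- apply: filterS bM => w [K KP]; exists `|K| => m; rewrite /xi.
  case: (unpickle m) => [[n i]|//]; case: ifPn => // ni.
  by rewrite (le_trans (KP _ (gT n i ni)))// ler_norm.
exists K => //; apply: off_eventW KP => w xiK n i ni.
by have := xiK (pickle (n, i)); rewrite /xi pickleK ni.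
Qed.

Lemma measurable_qv_sum (X : R -> Omega -> R) t n : 0 < t -> t <= T ->
  (forall s, 0 <= s <= T -> measurable_fun setT (X s)) ->
  measurable_fun setT (qv_sum X (grid t n) n.+1).
Proof.
move=> t0 tT mX; apply: measurable_sum => i; apply: measurable_funX.
have gT j : (j <= n.+1)%N -> 0 <= grid t n j <= T.
  by move=> nj; rewrite grid_ge0// (le_trans (grid_le t0 nj)).
by apply: measurable_funB; apply: mX; apply: gT => //; exact: ltnW.
Qed.

(** Outside a small event the values of [M] on all grids lie in [[-K, K]], where clipping changes
    nothing. There the quadratic sum of [M] is that of the clipped process, whose mean is bounded
    uniformly in the grid, and Markov's inequality applies. *)
Lemma martingale_qv_tight (M : R -> Omega -> R) t : 0 < t -> t <= T ->
  martingale P F T M ->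
  {ae P, forall w, exists K, forall s, 0 <= s <= T -> `|M s w| <= K} ->
  qv_tight M t.
Proof.
move=> t0 tT mM bM de de0; have [aM iM _] := mM.
have mMs s : 0 <= s <= T -> measurable_fun setT (M s).
  move=> /andP[s0 sT]; apply: (rv_measurable_fun (filtration_sub hF s0)); apply: aM.
  by rewrite /= in_itv/= s0.
have de20 : 0 < de / 2 by rewrite divr_gt0.
have [K K0 KP] := grid_bounded t0 tT mMs bM de20.
pose a := 2 * K * \int[P]_w `|M t w|.
have a0 : 0 <= a by rewrite mulr_ge0 ?mulr_ge0 ?(ltW K0)//; apply: Rintegral_ge0.
exists ((a + 1) / (de / 2)) => [|n]; first by rewrite divr_gt0// ltr_pwDr.
have := martingale_clip_qv hF (ltW K0) mM (n := n.+1) (tau := grid t n).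
rewrite grid0 grid_end => /(_ (lexx _) (fun i => ltW (grid_lt _ _ t0)) tT) qvle.
have mq : measurable_fun setT (qv_sum (fun s w => clip K (M s w)) (grid t n) n.+1).
  apply: measurable_qv_sum => // s sT.
  by apply: (measurableT_comp (measurable_clip K)); exact: mMs.
have e0 : 0 < (a + 1) / (de / 2) by rewrite divr_gt0// ltr_pwDr.
have q0 w : 0 <= qv_sum (fun s w => clip K (M s w)) (grid t n) n.+1 w.
  by apply: sumr_ge0 => i _; exact: sqr_ge0.
have mk := off_event_markov mq q0 qvle e0.
apply: (off_event_le _ (off_eventW _ (off_eventI KP mk))).
  rewrite [leRHS](splitr de) lerD2l -/a.
  rewrite ler_pdivrMr// mulrC divfK ?gt_eqF// lerDl//.
move=> w [Mw]; congr (_ <= _); apply: eq_bigr => i _.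
by rewrite !clip_id ?Mw// ltnW.
Qed.

Lemma qv_tight_off (X : R -> Omega -> R) (t : R) : (forall de, 0 < de -> exists Y,
    qv_tight Y t /\ off_event P de (fun w => forall n i, (i <= n.+1)%N -> X (grid t n i) w = Y (grid t n i) w)) ->
  qv_tight X t.
Proof.
move=> XY de de0; have de20 : 0 < de / 2 by rewrite divr_gt0.
have [Y [tY XYw]] := XY _ de20; have [K K0 KP] := tY _ de20.
exists K => // n; rewrite [de]splitr; apply: off_eventW (off_eventI XYw (KP n)) => w [E].
by congr (_ <= _); apply: eq_bigr => i _; rewrite !E// ltnW.
Qed.

(** Outside a small event [tau k] has reached [T], and [M] coincides on the grid with the process
    stopped at [tau k]: a true martingale, with bounded paths because those of [M] are continuous on
    a compact interval. *)
Lemma local_martingale_qv_tight (M : R -> Omega -> R) t : 0 < t -> t <= T ->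
  continuous_local_martingale P F T M -> qv_tight M t.
Proof.
move=> t0 tT [aM cM [tau [st mono ex mart]]].
have T0 : 0 < T := lt_le_trans t0 tT.
(* This is the event [tau k < T], written as a countable union of events [tau k <= s] with [s] in
   [[0, T]], the ones that a stopping time makes measurable. *)
pose S k := \bigcup_m [set w | tau k w <= T - T / m.+2%:R].
have Tm m : 0 <= T - T / m.+2%:R <= T.
  rewrite subr_ge0 gerBl divr_ge0 ?(ltW T0)//= andbT.
  by rewrite ler_pdivrMr// ler_peMr ?(ltW T0)// ler1n.
have mS k : measurable (S k).
  apply: bigcupT_measurable => m; apply: (filtration_sub hF (t := T - T / m.+2%:R)).
    by case/andP: (Tm m).
  exact: (st k).2.
have SE k w : ~ S k w -> T <= tau k w.
  move=> nS; rewrite leNgt; apply/negP => h; apply: nS.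
  have d0 : 0 < T - tau k w by rewrite subr_gt0.
  exists (Num.truncn (T / (T - tau k w))) => //=.
  rewrite lerBrDl -lerBrDr ler_pdivrMr// -ler_pdivrMl// mulrC.
  by rewrite (le_trans (ltW (truncnS_gt _)))// ler_nat.
have hS k l : (k <= l)%N -> S l `<=` S k.
  move=> kl w [m _ /= h]; exists m => //=; apply: le_trans h.
  by elim: l kl => [|l ih]; [case: k|rewrite leq_eqVlt => /predU1P[->//|/ih h]; exact: le_trans (mono l w)].
apply: qv_tight_off => de de0.
have [|k Pk] := @nonincreasing_event_small _ _ _ P S mS hS _ de de0.
  apply: filterS ex => w [k Tk]; exists k => -[m _ /=]; apply/negP; rewrite -ltNge.
  by rewrite (lt_le_trans _ Tk)// gtrBl divr_gt0.
exists (fun s w => M (Num.min s (tau k w)) w); split.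
  apply: martingale_qv_tight => //; apply: filterS cM => w /continuous_path_bounded[K KP].
  exists K => s /andP[s0 sT]; apply: KP.
  by rewrite le_min s0 (st k).1 ge_min sT.
apply: off_eventW Pk => w /SE Tk n i ni.
by rewrite min_l// (le_trans (grid_le t0 ni))// (le_trans tT).
Qed.

Lemma bounded_variation_qv (f : R -> R) t : 0 < t -> t <= T -> bounded_variation 0 T f ->
  exists K, forall n, \sum_(i < n.+1) (f (grid t n i.+1) - f (grid t n i)) ^+ 2 <= K.
Proof.
move=> t0 tT /(bounded_variationl (ltW t0) tT)[K KP]; exists (K ^+ 2) => n.
have vK : \sum_(i < n.+1) `|f (grid t n i.+1) - f (grid t n i)| <= K.
  have := itv_partition_seq (fun i => grid_lt n i t0) n.+1; rewrite grid0 grid_end => part.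
  apply: KP; exists (partition_seq (grid t n) n.+1) => //.
  rewrite /variation size_mkseq big_mkord; apply: eq_bigr => i _.
  by rewrite /comp -(grid0 t n) !nth_partition_seq// ltnW.
set v := fun i : 'I_n.+1 => `|f (grid t n i.+1) - f (grid t n i)|.
have vs (i : 'I_n.+1) : v i <= K.
  by apply: le_trans vK; rewrite (bigD1 i)//= lerDl sumr_ge0.
have K0 : 0 <= K by apply: le_trans (vs ord0); exact: normr_ge0.
rewrite expr2; apply: (@le_trans _ _ (\sum_i v i * K)).
  apply: ler_sum => i _; rewrite -real_normK ?num_real// expr2 ler_wpM2l//.
  exact: vs.
by rewrite -mulr_suml ler_wpM2r.
Qed.

Lemma finite_variation_qv_tight (A : R -> Omega -> R) t : 0 < t -> t <= T ->
  continuous_finite_variation P F T A -> qv_tight A t.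
Proof.
move=> t0 tT [aA _ vA] de de0.
have mA s : 0 <= s <= T -> measurable_fun setT (A s).
  move=> /andP[s0 sT]; apply: (rv_measurable_fun (filtration_sub hF s0)); apply: aA.
  by rewrite /= in_itv/= s0.
have [||K K0 KP] := @tight_of_ae_bounded _ _ _ P (fun n => qv_sum A (grid t n) n.+1) _ _ de de0.
- by move=> n; exact: measurable_qv_sum.
- by apply: filterS vA => w /(bounded_variation_qv t0 tT).
- by exists K => // n; apply: off_eventW KP => w.
Qed.

Lemma semimartingale_qv_tight (Z : R -> Omega -> R) t : 0 < t -> t <= T ->
  continuous_semimartingale P F T Z -> qv_tight Z t.
Proof.
move=> t0 tT [_ _ [M [A [hM hA ZE]]]] de de0; have de20 : 0 < de / 2 by rewrite divr_gt0.
have [K K0 KP] := local_martingale_qv_tight t0 tT hM de20.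
have [L L0 LP] := finite_variation_qv_tight t0 tT hA de20.
exists (2 * K + 2 * L) => [|n]; first by rewrite addr_gt0// mulr_gt0.
have := off_eventI (off_event_ae ZE) (off_eventI (KP n) (LP n)).
rewrite add0r -splitr; apply: off_eventW => w [E [qM qA]].
apply: (@le_trans _ _ (2 * qv_sum M (grid t n) n.+1 w + 2 * qv_sum A (grid t n) n.+1 w)); last first.
  by apply: lerD; apply: ler_wpM2l.
rewrite /qv_sum !mulr_sumr -big_split/=; apply: ler_sum => i _.
have gT j : (j <= n.+1)%N -> 0 <= grid t n j <= T.
  by move=> nj; rewrite grid_ge0// (le_trans (grid_le t0 nj)).
have i1 : (i.+1 <= n.+1)%N := ltn_ord i; have i0 := ltnW i1; rewrite !E ?gT//.
have := sqr_ge0 (M (grid t n i.+1) w - M (grid t n i) w - (A (grid t n i.+1) w - A (grid t n i) w)).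
nra.
Qed.

End qv_tight.

(** * Stratonovich integrals on grids *)

Lemma within_seq_cvg (V W : topologicalType) (f : V -> W) (A : set V) (x : V) (u : nat -> V) :
  {within A, continuous f} -> A x -> (forall n, A (u n)) -> u n @[n --> \oo] --> x ->
  f (u n) @[n --> \oo] --> f x.
Proof.
move=> cf Ax Au ux; have fx : f @ within A (nbhs x) --> f x.
  by rewrite (nbhs_subspace_in Ax); exact: (cf x).
apply: (@cvg_comp _ _ _ u f _ (within A (nbhs x))) fx => B wB.
have := ux _ wB; rewrite /nbhs/=; apply: filterS => n; apply; exact: Au.
Qed.

Section mean_square_continuity.
Context {disp : measure_display} {Omega : measurableType disp} {R : realType}.
Variables (P : probability Omega R) (T : R) (Y : R -> Omega -> R) (K : R).
Hypothesis mY : forall s, 0 <= s <= T -> measurable_fun setT (Y s).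
Hypothesis YK : forall s w, `|Y s w| <= K.
Hypothesis cY : {ae P, forall w, {within `[0, T], continuous (fun s => Y s w)}}.

Let dist2 s r := (\int[P]_w ((Y s w - Y r w) ^+ 2)%:E)%E.

Let mdist s r : 0 <= s <= T -> 0 <= r <= T -> measurable_fun setT (fun w => (Y s w - Y r w) ^+ 2).
Proof. by move=> sT rT; apply: measurable_funX; apply: measurable_funB; exact: mY. Qed.

(** By contradiction: compactness of [[0, T]] provides pairs of times that get close, converge to a
    common limit and keep a mean square distance above [e]. Continuity of the paths and the bound
    [K] contradict this by dominated convergence. There is no rate, and none is needed later. *)
Lemma ms_uniformly_continuous (e : R) : 0 < e -> exists2 ga, 0 < ga &
  forall s r, 0 <= s <= T -> 0 <= r <= T -> `|s - r| <= ga -> (dist2 s r <= e%:E)%E.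
Proof.
move=> e0; apply: contrapT => /forall2NP H.
have /choice[u uP] n : exists z : R * R, [/\ 0 <= z.1 <= T, 0 <= z.2 <= T,
    `|z.1 - z.2| <= n.+1%:R^-1 & (e%:E < dist2 z.1 z.2)%E].
  have [|/existsNP[s /existsNP[r /not_implyP[sT /not_implyP[rT /not_implyP[sr /negP]]]]]] := H n.+1%:R^-1.
    by rewrite invr_gt0.
  by rewrite -ltNge => es; exists (s, r).
have cT : compact (`[0, T]%classic : set R) by exact: segment_compact.
have [|r [/= rT clr]] := cT ((fun n => (u n).1) @ \oo) _ _.
  by exists 0%N => // n _; rewrite /= in_itv/=; case: (uP n).
have /choice[k kP] n : exists k, `|(u k).1 - r| <= 2 * n.+1%:R^-1 /\ `|(u k).2 - r| <= 2 * n.+1%:R^-1.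
  have n0 : 0 < n.+1%:R^-1 :> R by rewrite invr_gt0.
  have [x [[k /= nk <-] xr]] : [set (u j).1 | j in [set j | (n <= j)%N]] `&` [set x | `|r - x| < n.+1%:R^-1] !=set0.
    apply: clr; first by exists n => // j nj; exists j.
    exact: (@nbhsx_ballx R R).
  have [_ _ d12 _] := uP k; have kn : k.+1%:R^-1 <= n.+1%:R^-1 :> R by rewrite lef_pV2 ?posrE// ler_nat.
  exists k; move: n0 kn xr d12; move: (n.+1%:R^-1) (k.+1%:R^-1) => a b a0 ba; rewrite ltr_norml !ler_norml => /andP[? ?] /andP[? ?].
  by split; apply/andP; split; lra.
have near_r (v : nat -> R) : (forall n, `|v n - r| <= 2 * n.+1%:R^-1) -> v n @[n --> \oo] --> r.
  move=> vr; apply/cvgrPdist_le => ep ep0; near=> n; rewrite distrC (le_trans (vr n))//.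
  rewrite mulrC -ler_pdivlMr//; near: n.
  have ep2 : 0 < ep / 2 by rewrite divr_gt0.
  have := @cvg_harmonic R; move/cvgrPdist_le => /(_ _ ep2).
  by apply: filterS => j; rewrite sub0r normrN ger0_norm// invr_ge0.
pose D n w := Y (u (k n)).1 w - Y (u (k n)).2 w.
have K0 : 0 <= K by have := YK 0 point; apply: le_trans.
have DK n w : D n w ^+ 2 <= 4 * K ^+ 2.
  by have := YK (u (k n)).1 w; have := YK (u (k n)).2 w; rewrite /D !ler_norml => /andP[? ?] /andP[? ?]; nra.
have [|||||_ _] := @dominated_convergence _ _ _ P setT measurableT
    (fun n w => (D n w ^+ 2)%:E) (cst 0%E) (cst (4 * K ^+ 2)%:E).
- by move=> n; apply/measurable_EFinP; apply: mdist; case: (uP (k n)).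
- exact: measurable_cst.
- apply: filterS cY => w cw _; apply/fine_cvgP; split; first by near=> n.
  have path (v : nat -> R) : (forall n, 0 <= v n <= T) -> (forall n, `|v n - r| <= 2 * n.+1%:R^-1) ->
      Y (v n) w @[n --> \oo] --> Y r w.
    move=> vT /near_r vr; apply: (within_seq_cvg cw rT _ vr) => n.
    by rewrite /= in_itv/=.
  have Dw : D n w @[n --> \oo] --> Y r w - Y r w.
    by apply: cvgB; apply: path => n; [case: (uP (k n))|case: (kP n)|case: (uP (k n))|case: (kP n)].
  have := cvgM Dw Dw; rewrite subrr mul0r.
  have -> : D^~ w \* D^~ w = (fun n => D n w ^+ 2) by apply/funext => n; rewrite /= expr2.
  exact.
- exact: finite_measure_integrable_cst.
- by apply: nearW => w n _; rewrite lee_fin ger0_norm ?sqr_ge0.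
rewrite /= integral0 => /fine_cvgP[_ /cvgrPdist_lt/(_ _ e0)][n _ /(_ n (leqnn n))]/=.
rewrite sub0r normrN => h; have [_ _ _] := uP (k n); rewrite ltNge => /negP; apply.
rewrite -[dist2 _ _]fineK ?lee_fin; first exact: le_trans (ler_norm _) (ltW h).
rewrite ge0_fin_numE; last by apply: integral_ge0 => w _; rewrite lee_fin sqr_ge0.
apply: (@le_lt_trans _ _ (\int[P]_w (4 * K ^+ 2)%:E)%E).
  by apply: ge0_le_integralW => w; rewrite lee_fin ?sqr_ge0//; exact: DK.
rewrite integral_cst//= lte_mul_pinfty ?lee_fin ?mulr_ge0 ?sqr_ge0//.
by rewrite (le_lt_trans (probability_le1 P measurableT))// ltry.
Unshelve. all: by end_near. Qed.

End mean_square_continuity.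

(** * Bounds on means and convergence in probability *)

Section mean_bound.
Context {disp : measure_display} {Omega : measurableType disp} {R : realType}.
Variable P : probability Omega R.

Definition mean_le (f : Omega -> R) (b : R) :=
  [/\ measurable_fun setT f, forall w, 0 <= f w & (\int[P]_w (f w)%:E <= b%:E)%E].

Lemma mean_leW (f g : Omega -> R) (b c : R) : measurable_fun setT g -> (forall w, 0 <= g w <= f w) ->
  b <= c -> mean_le f b -> mean_le g c.
Proof.
move=> mg gf bc [mf f0 fb]; split=> // [w|]; first by case/andP: (gf w).
apply: (@le_trans _ _ b%:E); last by rewrite lee_fin.
apply: le_trans fb; apply: ge0_le_integralW => w; rewrite lee_fin; by case/andP: (gf w).
Qed.

Lemma mean_leD (f g : Omega -> R) (b c : R) : mean_le f b -> mean_le g c ->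
  mean_le (fun w => f w + g w) (b + c).
Proof.
move=> [mf f0 fb] [mg g0 gc]; split=> [|w|]; first exact: measurable_funD.
  by rewrite addr_ge0.
under eq_integral do rewrite EFinD.
rewrite ge0_integralD//; last 4 first.
- by move=> w _; rewrite lee_fin.
- exact/measurable_EFinP.
- by move=> w _; rewrite lee_fin.
- exact/measurable_EFinP.
by rewrite EFinD leeD.
Qed.

Lemma mean_leZ (f : Omega -> R) (a b : R) : 0 <= a -> mean_le f b -> mean_le (fun w => a * f w) (a * b).
Proof.
move=> a0 [mf f0 fb]; split=> [|w|]; first exact: measurable_funM.
  by rewrite mulr_ge0.
under eq_integral do rewrite EFinM.
rewrite ge0_integralZl//; last 2 first.
- exact/measurable_EFinP.
- by move=> w _; rewrite lee_fin.
by rewrite EFinM lee_wpmul2l.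
Qed.

Lemma mean_le_sum n (f : 'I_n -> Omega -> R) (b : 'I_n -> R) : (forall i, mean_le (f i) (b i)) ->
  mean_le (fun w => \sum_i f i w) (\sum_i b i).
Proof.
elim: n f b => [|n ih] f b fb; last first.
  by rewrite big_ord_recl; under eq_fun do rewrite big_ord_recl; apply: mean_leD => //; exact: ih.
split=> [|w|]; rewrite ?big_ord0//.
  by under eq_fun do rewrite big_ord0; exact: measurable_cst.
by under eq_integral do rewrite big_ord0; rewrite integral0.
Qed.

Lemma mean_le_off (f : Omega -> R) (b e : R) : mean_le f b -> 0 < e ->
  off_event P (b / e) (fun w => f w <= e).
Proof. by move=> [mf f0 fb] e0; exact: off_event_markov. Qed.

(** Convergence to 0 in probability for nonnegative sequences. Phrased through [off_event], it also
    covers variables not known to be measurable. *)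
Definition small_prob (xi : nat -> Omega -> R) := forall e de, 0 < e -> 0 < de ->
  exists N, forall n, (N <= n)%N -> off_event P de (fun w => xi n w <= e).

Lemma small_probW (xi zeta : nat -> Omega -> R) : {ae P, forall w, forall n, xi n w <= zeta n w} ->
  small_prob zeta -> small_prob xi.
Proof.
move=> xz zs e de e0 de0; have [N NP] := zs e de e0 de0; exists N => n Nn.
have := off_eventI (off_event_ae xz) (NP n Nn); rewrite add0r.
by apply: off_eventW => w [h]; exact: le_trans.
Qed.

Lemma small_probD (xi zeta : nat -> Omega -> R) : small_prob xi -> small_prob zeta ->
  small_prob (fun n w => xi n w + zeta n w).
Proof.
move=> xs zs e de e0 de0; have e20 : 0 < e / 2 by rewrite divr_gt0.
have de20 : 0 < de / 2 by rewrite divr_gt0.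
have [N NP] := xs _ _ e20 de20; have [M MP] := zs _ _ e20 de20.
exists (maxn N M) => n; rewrite geq_max => /andP[Nn Mn].
have := off_eventI (NP n Nn) (MP n Mn); rewrite -splitr; apply: off_eventW => w [h1 h2].
by rewrite [e]splitr lerD.
Qed.

Lemma small_prob0 : small_prob (fun _ _ => 0).
Proof.
move=> e de e0 de0; exists 0%N => n _; exists set0 => [|w _]; last exact: ltW.
by rewrite measure0 lee_fin (ltW de0).
Qed.

Lemma small_prob_sum d (xi : 'I_d -> nat -> Omega -> R) : (forall k, small_prob (xi k)) ->
  small_prob (fun n w => \sum_k xi k n w).
Proof.
elim: d xi => [|d ih] xi xs.
  by under eq_fun do under eq_fun do rewrite big_ord0; exact: small_prob0.
under eq_fun do under eq_fun do rewrite big_ord_recl.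
apply: small_probD; [exact: xs|exact: ih].
Qed.

Lemma small_prob_mul_tight (xi zeta : nat -> Omega -> R) : (forall n w, 0 <= xi n w) ->
  (forall n w, 0 <= zeta n w) -> small_prob xi -> tight P zeta ->
  small_prob (fun n w => xi n w * zeta n w).
Proof.
move=> x0 z0 xs zt e de e0 de0; have de20 : 0 < de / 2 by rewrite divr_gt0.
have [K K0 KP] := zt _ de20; have eK0 : 0 < e / K by rewrite divr_gt0.
have [N NP] := xs _ _ eK0 de20; exists N => n Nn.
have := off_eventI (NP n Nn) (KP n); rewrite -splitr; apply: off_eventW => w [h1 h2].
by rewrite -[e](divfK (lt0r_neq0 K0)) ler_pM.
Qed.

Lemma tight_cst (a : R) : tight P (fun (_ : nat) (_ : Omega) => a).
Proof.
move=> de de0; exists (`|a| + 1) => [|n]; first by rewrite ltr_pwDr.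
exists set0 => [|w _]; first by rewrite measure0 lee_fin (ltW de0).
by rewrite (le_trans (ler_norm a))// lerDl.
Qed.

Lemma small_probZ (a : R) (xi : nat -> Omega -> R) : 0 <= a -> (forall n w, 0 <= xi n w) -> small_prob xi ->
  small_prob (fun n w => a * xi n w).
Proof.
move=> a0 x0 xs; under eq_fun do under eq_fun do rewrite mulrC.
by apply: small_prob_mul_tight => //; exact: tight_cst.
Qed.

Lemma tight_leD (xi zeta eta : nat -> Omega -> R) : (forall n w, eta n w <= xi n w + zeta n w) ->
  tight P xi -> tight P zeta -> tight P eta.
Proof.
move=> h xt zt de de0; have de20 : 0 < de / 2 by rewrite divr_gt0.
have [K K0 KP] := xt _ de20; have [L L0 LP] := zt _ de20.
exists (K + L) => [|n]; first by rewrite addr_gt0.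
have := off_eventI (KP n) (LP n); rewrite -splitr; apply: off_eventW => w [h1 h2].
by rewrite (le_trans (h n w))// lerD.
Qed.

Lemma tightZ (a : R) (xi zeta : nat -> Omega -> R) : 0 <= a -> (forall n w, zeta n w <= a * xi n w) ->
  tight P xi -> tight P zeta.
Proof.
move=> a0 h xt de de0; have [K K0 KP] := xt _ de0.
exists ((a + 1) * K) => [|n]; first by rewrite mulr_gt0// ltr_pwDr.
apply: off_eventW (KP n) => w hw; rewrite (le_trans (h n w))// (le_trans (ler_wpM2l a0 hw))//.
by rewrite ler_pM2r// lerDl.
Qed.

Lemma tight_sum d (xi : 'I_d -> nat -> Omega -> R) : (forall k, tight P (xi k)) ->
  tight P (fun n w => \sum_k xi k n w).
Proof.
elim: d xi => [|d ih] xi xt.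
  by under eq_fun do under eq_fun do rewrite big_ord0; exact: tight_cst.
apply: (@tight_leD (xi ord0) (fun n w => \sum_(k < d) xi (lift ord0 k) n w)) => //.
  by move=> n w; rewrite big_ord_recl.
exact: ih.
Qed.

Lemma inv_nat_small (a e : R) : 0 <= a -> 0 < e -> exists N, forall n, (N <= n)%N -> a / n.+1%:R <= e.
Proof.
move=> a0 e0; exists (Num.truncn (a / e)) => n Nn.
rewrite ler_pdivrMr// mulrC -ler_pdivrMr// (le_trans (ltW (truncnS_gt _)))//.
by rewrite ler_nat ltnS.
Qed.

Lemma mean_small_prob (xi : nat -> Omega -> R) (a : R) : 0 <= a -> (forall n, mean_le (xi n) (a / n.+1%:R)) ->
  small_prob xi.
Proof.
move=> a0 xa e de e0 de0; have [N NP] := inv_nat_small a0 (mulr_gt0 e0 de0).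
exists N => n Nn; apply: off_event_le (mean_le_off (xa n) e0).
by rewrite ler_pdivrMr// [de * e]mulrC NP.
Qed.

Lemma mean_tight (I : Type) (xi : I -> Omega -> R) (a : R) : 0 <= a -> (forall n, mean_le (xi n) a) -> tight P xi.
Proof.
move=> a0 xa de de0; exists ((a + 1) / de) => [|i]; first by rewrite divr_gt0// ltr_pwDr.
have e0 : 0 < (a + 1) / de by rewrite divr_gt0// ltr_pwDr.
apply: off_event_le (mean_le_off (xa i) e0).
by rewrite ler_pdivrMr// mulrC divfK ?gt_eqF// lerDl.
Qed.

End mean_bound.

Section block_sum.
Context {R : realType}.

Lemma sum_block (f : nat -> R) i m :
  \sum_(j < i.+1 * m) f j = \sum_(j < i * m) f j + \sum_(j < m) f (i * m + j)%N.
Proof. by rewrite mulSnr big_split_ord. Qed.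

Lemma sum_blocks (f : nat -> R) n m :
  \sum_(i < n) \sum_(j < m) f (i * m + j)%N = \sum_(j < n * m) f j.
Proof.
elim: n => [|n ih]; first by rewrite big_ord0 mul0n big_ord0.
by rewrite big_ord_recr/= ih sum_block.
Qed.

(** A grid is indexed by its number of steps minus one. This is the index of the grid that cuts each
    of the [n + 1] steps into [m + 1] equal parts. *)
Definition refine_grid n m := (n.+1 * m.+1).-1.

Lemma refine_gridE n m : (refine_grid n m).+1 = (n.+1 * m.+1)%N.
Proof. by []. Qed.

Lemma grid_refine (t : R) n m i : grid t (refine_grid n m) (i * m.+1) = grid t n i.
Proof.
rewrite /grid refine_gridE !natrM; field.
by rewrite ![1 + _]addrC !natr1 !pnatr_eq0.
Qed.

End block_sum.

Section brownian_grid.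
Context {disp : measure_display} {Omega : measurableType disp} {R : realType}.
Variables (P : probability Omega R) (F : R -> set (set Omega)) (W : R -> Omega -> R).
Hypothesis hF : complete_filtration P F.
Hypothesis hW : brownian_motion P F W.

Lemma bm_increment_moment s t m : 0 <= s -> s < t -> (0 < m)%N ->
  mean_le P (fun w => (W t w - W s w) ^+ (2 * m)) ((4 * m%:R) ^+ m * (3 / 2) * (t - s) ^+ m).
Proof.
move=> s0 st m0; split=> [|w|].
- apply: measurable_funX; apply: measurable_funB; apply: (bm_measurable hF hW) => //.
  exact: le_trans (ltW st).
- by rewrite exprM exprn_ge0// sqr_ge0.
have mc : rv_measurable (F s) (cst 1 : Omega -> R).
  by apply/(rv_measurableP (filtration_sigma hF s0)); exact: measurable_cst.
have := bm_weighted_moment hF hW s0 st m0 mc.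
under eq_integral do rewrite expr1n mul1r.
move=> /le_trans; apply.
under eq_integral do rewrite expr1n.
rewrite integral_cst//= mul1e -[leRHS]mule1 lee_pmul//; last exact: (probability_le1 P measurableT).
by rewrite lee_fin !mulr_ge0// ?invr_ge0// exprn_ge0// ?subr_ge0 ?ltW// mulr_ge0.
Qed.

Definition dW (t : R) n i w := W (grid t n i.+1) w - W (grid t n i) w.

Lemma bm_dW_moment t n i m : 0 < t -> (0 < m)%N ->
  mean_le P (fun w => dW t n i w ^+ (2 * m)) ((4 * m%:R) ^+ m * (3 / 2) * (t / n.+1%:R) ^+ m).
Proof.
move=> t0 m0; rewrite -(grid_step t n i); apply: bm_increment_moment => //.
  exact: grid_ge0.
exact: grid_lt.
Qed.

Lemma bm_dW_sqr t n i : 0 < t -> mean_le P (fun w => dW t n i w ^+ 2) (6 * (t / n.+1%:R)).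
Proof.
move=> t0; have := @bm_dW_moment t n i 1 t0 (ltn0Sn 0).
by rewrite !expr1 mulr1 (_ : 4 * (3 / 2) = 6 :> R)//; lra.
Qed.

Lemma bm_qv_mean t n : 0 < t -> mean_le P (qv_sum W (grid t n) n.+1) (6 * t).
Proof.
move=> t0; have := @mean_le_sum _ _ _ P n.+1 (fun i w => dW t n i w ^+ 2) (fun=> 6 * (t / n.+1%:R))
  (fun i => bm_dW_sqr n i t0).
rewrite sumr_const card_ord; congr mean_le.
by rewrite -[LHS]mulr_natr -mulrA divfK// pnatr_eq0.
Qed.

Lemma bm_qv_tight t : 0 < t -> qv_tight P W t.
Proof.
move=> t0; apply: (@mean_tight _ _ _ P _ _ (6 * t)) => [|n]; last exact: bm_qv_mean.
by rewrite mulr_ge0// ltW.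
Qed.

Lemma bm_fourth_small t : 0 < t -> small_prob P (fun n w => \sum_(i < n.+1) dW t n i w ^+ 4).
Proof.
(* The fourth moment of an increment is at most [96 (t / (n + 1))^2], where
   [96 = (4 * 2)^2 * (3 / 2)]; summing [n + 1] of them leaves one factor [1 / (n + 1)]. *)
move=> t0; apply: (@mean_small_prob _ _ _ P _ (96 * t ^+ 2)) => [|n].
  by rewrite mulr_ge0// sqr_ge0.
have := @mean_le_sum _ _ _ P n.+1 (fun i w => dW t n i w ^+ 4) (fun=> (4 * 2) ^+ 2 * (3 / 2) * (t / n.+1%:R) ^+ 2)
  (fun i => @bm_dW_moment t n i 2 t0 (ltn0Sn 1)).
rewrite sumr_const card_ord -(mulr_natr _ n.+1); congr mean_le.
by field; rewrite addrC natr1 pnatr_eq0.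
Qed.

(** The fourth power of the largest increment is at most the sum of all fourth powers, which tends
    to 0 in probability. *)
Lemma bm_increments_small t e de : 0 < t -> 0 < e -> 0 < de -> exists N, forall n, (N <= n)%N ->
  off_event P de (fun w => forall i, (i < n.+1)%N -> `|dW t n i w| <= e).
Proof.
move=> t0 e0 de0; have [N NP] := bm_fourth_small t0 (exprn_gt0 4 e0) de0.
exists N => n Nn; apply: off_eventW (NP n Nn) => w d4 i ni.
rewrite -(@ler_pXn2r _ 4)// ?nnegrE// ?(ltW e0)// -normrX ger0_norm; last first.
  by rewrite (exprM _ 2 2) sqr_ge0.
apply: le_trans d4; rewrite (bigD1 (Ordinal ni))//= lerDl sumr_ge0// => j _.
by rewrite (exprM _ 2 2) sqr_ge0.
Qed.

(** Weights of total mass bounded in probability meet uniformly small increments. This disposes of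
    the terms of third order, both for [X] and for the flow. *)
Lemma bm_weighted_small t (a : nat -> nat -> Omega -> R) : 0 < t -> (forall n i w, 0 <= a n i w) ->
  tight P (fun n w => \sum_(i < n.+1) a n i w) ->
  small_prob P (fun n w => \sum_(i < n.+1) a n i w * `|dW t n i w|).
Proof.
move=> t0 a0 ta e de e0 de0; have de20 : 0 < de / 2 by rewrite divr_gt0.
have [K K0 KP] := ta _ de20; have eK0 : 0 < e / K by rewrite divr_gt0.
have [N NP] := bm_increments_small t0 eK0 de20.
exists N => n Nn; have := off_eventI (KP n) (NP n Nn); rewrite -splitr.
apply: off_eventW => w [aK dK].
apply: (@le_trans _ _ (\sum_(i < n.+1) a n i w * (e / K))).
  by apply: ler_sum => i _; rewrite ler_wpM2l// dK.
by rewrite -mulr_suml -[leRHS](divfK (lt0r_neq0 K0)) [leRHS]mulrC ler_wpM2r// ltW.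
Qed.

End brownian_grid.

(** * The Stratonovich integral over the steps of a grid *)

Section stratonovich_remainder.
Context {disp : measure_display} {Omega : measurableType disp} {R : realType}.
Variables (P : probability Omega R) (F : R -> set (set Omega)) (W : R -> Omega -> R).
Hypothesis hF : complete_filtration P F.
Hypothesis hW : brownian_motion P F W.
Variables (T : R) (Y J : R -> Omega -> R) (K : R).
Hypothesis aY : forall s, 0 <= s <= T -> rv_measurable (F s) (Y s).
Hypothesis YK : forall s w, `|Y s w| <= K.
Hypothesis cY : {ae P, forall w, {within `[0, T], continuous (fun s => Y s w)}}.
Hypothesis mJ : forall s, 0 <= s <= T -> measurable_fun setT (J s).
Hypothesis hJ : forall s, 0 <= s <= T -> is_stratonovich_integral P Y W s (J s).

Let mY s : 0 <= s <= T -> measurable_fun setT (Y s).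
Proof. by move=> sT; case/andP: (sT) => s0 _; exact: (adapted_measurable hF s0 (aY sT)). Qed.

Let mW s : 0 <= s -> measurable_fun setT (W s).
Proof. by move=> s0; exact: (bm_measurable hF hW s0). Qed.

Definition trapezoid (tau : nat -> R) j w :=
  2^-1 * (Y (tau j) w + Y (tau j.+1) w) * (W (tau j.+1) w - W (tau j) w).

Lemma trapezoid_off s e de : 0 <= s <= T -> 0 < e -> 0 < de -> exists2 eta, 0 < eta &
  forall tau k, tau 0%N = 0 -> (forall i, tau i < tau i.+1) -> tau k = s ->
    (forall i, (i < k)%N -> tau i.+1 - tau i < eta) ->
    off_event P de (fun w => `|\sum_(j < k) trapezoid tau j w - J s w| <= e).
Proof.
move=> sT e0 de0; have [eta eta0 etaP] := hJ sT e0 de0; exists eta => // tau k tau0 tlt tk tm.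
have htau : {homo tau : i j / (i <= j)%N >-> i <= j}.
  by apply: homo_leq => // [x y z|i]; [exact: le_trans|exact: ltW].
have tT i : (i <= k)%N -> 0 <= tau i <= T.
  move=> ik; rewrite -tau0 htau//= (le_trans (htau _ _ ik))// tk; by case/andP: sT.
have := itv_partition_seq tlt k; rewrite tau0 tk => part.
have := mesh_partition_seq tm; rewrite tau0 => mesh.
have E w : stratonovich_sum Y W 0 (partition_seq tau k) w = \sum_(j < k) trapezoid tau j w.
  have := big_partition_seq tau (fun x => 2^-1 * (Y x.1 w + Y x.2 w) * (W x.2 w - W x.1 w)) k.
  by rewrite tau0.
have h := etaP _ part mesh.
exists [set w | e < `|stratonovich_sum Y W 0 (partition_seq tau k) w - J s w|]; last first.
  by move=> w /negP; rewrite -leNgt E.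
split; last exact: ltW.
have mf : measurable_fun setT (fun w => `|\sum_(j < k) trapezoid tau j w - J s w|).
  apply: measurableT_comp => //; apply: measurable_funB; last exact: mJ.
  apply: measurable_sum => j; have jk := ltn_ord j; have jk' := ltnW jk.
  apply: measurable_funM.
    by apply: measurable_funM => //; apply: measurable_funD; apply: mY; exact: tT.
  by apply: measurable_funB; apply: mW; [case/andP: (tT _ jk)|case/andP: (tT _ jk')].
rewrite (_ : [set w | _] = (fun w => `|\sum_(j < k) trapezoid tau j w - J s w|) @^-1` `]e, +oo[%classic).
  by rewrite -[X in measurable X]setTI; exact: mf.
by apply/seteqP; split=> w /=; rewrite E in_itv/= andbT.
Qed.

Lemma telescope_from (g : nat -> R) a k : \sum_(j < k) (g (a + j).+1 - g (a + j)%N) = g (a + k)%N - g a.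
Proof.
elim: k => [|k ih]; first by rewrite big_ord0 addn0 subrr.
by rewrite big_ord_recr/= ih addnS addrC addrA subrK.
Qed.

Section fixed_time.
Variable t : R.
Hypothesis t0 : 0 < t.
Hypothesis tT : t <= T.
Hypothesis qY : qv_tight P Y t.

Let gT n i : (i <= n.+1)%N -> 0 <= grid t n i <= T.
Proof. by move=> ni; rewrite grid_ge0// (le_trans (grid_le t0 ni)). Qed.

(* A block of the fine grid makes up one step of the coarse grid. *)
Let fluct n m i w := \sum_(j < m.+1)
  (Y (grid t (refine_grid n m) (i * m.+1 + j)) w - Y (grid t (refine_grid n m) (i * m.+1)) w) *
  dW W t (refine_grid n m) (i * m.+1 + j) w.

Let covar n m i w := \sum_(j < m.+1)
  (Y (grid t (refine_grid n m) (i * m.+1 + j).+1) w - Y (grid t (refine_grid n m) (i * m.+1 + j)) w) *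
  dW W t (refine_grid n m) (i * m.+1 + j) w.

(** Inside block [i], the mean of two neighbouring values of [Y] is the value at the start of the
    block, plus the change since then (giving [fluct]), plus half the next increment (giving
    [covar]). *)
Let block_trapezoid n m i w :
  \sum_(j < i.+1 * m.+1) trapezoid (grid t (refine_grid n m)) j w -
  \sum_(j < i * m.+1) trapezoid (grid t (refine_grid n m)) j w =
  fluct n m i w + Y (grid t n i) w * dW W t n i w + 2^-1 * covar n m i w.
Proof.
rewrite (sum_block (fun j => trapezoid (grid t (refine_grid n m)) j w)) addrAC subrr add0r.
rewrite -(grid_refine t n m i); set g := grid t (refine_grid n m).
have -> : dW W t n i w = \sum_(j < m.+1) (W (g (i * m.+1 + j)%N.+1) w - W (g (i * m.+1 + j)%N) w).
  by rewrite (telescope_from (fun j => W (g j) w)) /dW -!(grid_refine t n m) mulSnr.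
rewrite /fluct /covar !mulr_sumr -!big_split/=; apply: eq_bigr => j _.
by rewrite /trapezoid /dW -/g; field.
Qed.

(** An Ito sum over one block, whose weights are the changes of [Y] since the start of the block:
    they are adapted, of mean square at most [s^2], and the block has length [t / (n + 1)]. *)
Let fluct_mean n m i s : 0 < s -> (i < n.+1)%N ->
  (forall s' r, 0 <= s' <= T -> 0 <= r <= T -> `|s' - r| <= t / n.+1%:R ->
     (\int[P]_w ((Y s' w - Y r w) ^+ 2)%:E <= (s ^+ 2)%:E)%E) ->
  mean_le P (fun w => fluct n m i w ^+ 2) (6 * (t / n.+1%:R) * s ^+ 2).
Proof.
move=> s0 ni msY; set N := refine_grid n m.
have idx j : (j <= m.+1)%N -> (i * m.+1 + j <= N.+1)%N.
  by move=> jm; rewrite refine_gridE (leq_trans (_ : _ <= i.+1 * m.+1)%N)// ?leq_mul2r ?ni ?orbT// mulSnr leq_add2l.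
have idx0 : (i * m.+1 <= N.+1)%N by rewrite -[X in (X <= _)%N]addn0 idx.
split=> [|w|]; last 1 first.
- have := @ito_sum_le _ _ _ P F W hF hW (fun j => grid t N (i * m.+1 + j))
    (fun j w => Y (grid t N (i * m.+1 + j)) w - Y (grid t N (i * m.+1)) w) m.+1.
  rewrite /fluct /dW -/N; under eq_integral do under eq_bigr do rewrite addnS.
  move=> /(_ _ _ _)/le_trans; apply.
  + exact: grid_ge0.
  + by move=> j; rewrite addnS; exact: grid_lt.
  + move=> j jm; have g0 : 0 <= grid t N (i * m.+1 + j) by exact: grid_ge0.
    apply/(rv_measurableP (filtration_sigma hF g0)); apply: measurable_funB.
      by apply/(rv_measurableP (filtration_sigma hF g0)); apply: aY; apply: gT; rewrite idx// ltnW.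
    apply/(rv_measurableP (filtration_sigma hF g0)).
    apply: (rv_measurable_le hF (s := grid t N (i * m.+1))); [exact: grid_ge0| |].
      by apply: grid_mono => //; rewrite leq_addr.
    by apply: aY; exact: gT.
  apply: (@le_trans _ _ (\sum_(j < m.+1) (6 * (t / N.+1%:R) * s ^+ 2)%:E)%E).
    apply: lee_sum => j _; rewrite addnS grid_step [X in (_ <= X)%E]EFinM lee_pmul2l//; last first.
      by rewrite lte_fin mulr_gt0// divr_gt0.
    have jm : (j <= m.+1)%N := ltnW (ltn_ord j).
    apply: msY; rewrite ?gT ?idx// ger0_norm; last first.
      by rewrite subr_ge0 grid_mono// leq_addr.
    rewrite -(grid_step t n i) -!(grid_refine t n m) lerD2r grid_mono//.
    by rewrite mulSnr leq_add2l.
  rewrite sumEFin lee_fin sumr_const card_ord -[leLHS]mulr_natr /N refine_gridE natrM.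
  rewrite le_eqVlt; apply/orP; left; apply/eqP; field.
  by rewrite ![1 + _]addrC !natr1 !pnatr_eq0.
- apply: measurable_funX; apply: measurable_sum => j; have jm := ltn_ord j.
  apply: measurable_funM.
    by apply: measurable_funB; apply: mY; apply: gT; rewrite ?idx// ltnW.
  by apply: measurable_funB; apply: mW; exact: grid_ge0.
- exact: sqr_ge0.
Qed.

(** The integral [J] is accessible only through trapezoidal sums, so each coarse step is subdivided
    until the fine sums are close to [J] at all coarse points. By [block_trapezoid], three errors
    remain on a step. The part [fluct] is small in mean square by the continuity of [Y]. The part
    [covar] is bounded by quadratic sums on the fine grid, which tightness controls uniformly in the
    grid, and is multiplied by a small [dW]. The approximation error is made small after [n] is
    fixed. These parts get [e / 4], [e / 4] and [e / 2], and [de] is shared by five events. *)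
Lemma stratonovich_remainder_small : small_prob P (fun n w => \sum_(i < n.+1)
  `|J (grid t n i.+1) w - J (grid t n i) w - Y (grid t n i) w * dW W t n i w| * `|dW W t n i w|).
Proof.
move=> e de e0 de0; have de50 : 0 < de / 5 by rewrite divr_gt0.
(* The [fluct] part has mean at most [6 s t] and is to stay below [e / 4] up to probability
   [de / 5]; hence [120 = 6 * 4 * 5]. *)
pose s := e * de / (120 * t); have s0 : 0 < s by rewrite divr_gt0 ?mulr_gt0//.
have [ga ga0 gaP] := ms_uniformly_continuous mY YK cY (exprn_gt0 2 s0).
have [N1 N1P] := inv_nat_small (ltW t0) ga0.
have [KY KY0 KYP] := qY de50.
have [KW KW0 KWP] := bm_qv_tight hF hW t0 de50.
(* On a block, [|V| |D| / 2] is at most [eta / 4] times the quadratic sums of [Y] and [W]; over all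
   blocks this amounts to at most [eta / 4 * (KY + KW) = e / 4]. *)
pose eta := e / (KY + KW); have eta0 : 0 < eta by rewrite divr_gt0// addr_gt0.
have [N2 N2P] := bm_increments_small hF hW t0 eta0 de50.
exists (maxn N1 N2) => n; rewrite geq_max => /andP[N1n N2n].
(* Both ends of each of the [n + 1] steps contribute [e'], multiplied by an increment of size at
   most [eta]: [2 e' eta (n + 1) = e / 2]. *)
pose e' := e / (4 * n.+1%:R * eta); have e'0 : 0 < e' by rewrite divr_gt0// mulr_gt0// mulr_gt0//.
have d'0 : 0 < de / 5 / n.+2%:R by rewrite divr_gt0.
have /choice[h hP] (i : 'I_n.+2) : exists eta, 0 < eta /\
    forall tau k, tau 0%N = 0 -> (forall i, tau i < tau i.+1) -> tau k = grid t n i ->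
    (forall i, (i < k)%N -> tau i.+1 - tau i < eta) ->
    off_event P (de / 5 / n.+2%:R) (fun w => `|\sum_(j < k) trapezoid tau j w - J (grid t n i) w| <= e').
  have ni : (i <= n.+1)%N by rewrite -ltnS.
  by have [x x0 xP] := trapezoid_off (gT ni) e'0 d'0; exists x.
(* The sum over [i] dominates each [t / h i], so the fine mesh lies below all the thresholds [h i]
   at once. *)
pose m := Num.truncn (\sum_i t / h i); pose N := refine_grid n m; pose g := grid t N.
have gh (i : 'I_n.+2) j : g j.+1 - g j < h i.
  have [hi _] := hP i; rewrite /g grid_step /N refine_gridE.
  rewrite ltr_pdivrMr// mulrC -ltr_pdivrMr//.
  apply: (@le_lt_trans _ _ (\sum_i t / h i)).
    rewrite (bigD1 i)//= lerDl sumr_ge0// => l _; rewrite divr_ge0 ?(ltW t0)// ltW//.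
    by case: (hP l).
  by rewrite (lt_le_trans (truncnS_gt _))// ler_nat -/m leq_pmull.
have rho : off_event P (de / 5) (fun w => forall i : 'I_n.+2,
    `|\sum_(j < i * m.+1) trapezoid g j w - J (grid t n i) w| <= e').
  apply: off_event_forall (ltW de50) _ => i; apply: (hP i).2.
  - exact: grid0.
  - by move=> j; exact: grid_lt.
  - exact: grid_refine.
  - by move=> j _; exact: gh.
have sn0 : 0 < t / n.+1%:R by rewrite divr_gt0.
(* Young's inequality with weight [s] will separate [|U| |D|]; the bounds on the means of both
   halves are then equal, [3 s t / (n + 1)] each. *)
have young_split (a b : R) : 0 < a ->
    6 * a * b = (2 * a)^-1 * (6 * b * a ^+ 2) + a / 2 * (6 * b).
  by move=> a0; field; rewrite gt_eqF.
have mU : mean_le P (fun w => \sum_(i < n.+1) ((2 * s)^-1 * fluct n m i w ^+ 2 + s / 2 * dW W t n i w ^+ 2))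
    (\sum_(i < n.+1) 6 * s * (t / n.+1%:R)).
  apply: mean_le_sum => i.
  have -> : 6 * s * (t / n.+1%:R) = (2 * s)^-1 * (6 * (t / n.+1%:R) * s ^+ 2) + s / 2 * (6 * (t / n.+1%:R)).
    exact: young_split.
  apply: mean_leD; apply: mean_leZ.
  - by rewrite invr_ge0 mulr_ge0// ltW.
  - apply: fluct_mean => // s' r s'T rT s'r; apply: gaP => //.
    by rewrite (le_trans s'r)// N1P.
  - by rewrite divr_ge0// ltW.
  - exact: (bm_dW_sqr hF hW).
have e40 : 0 < e / 4 by rewrite divr_gt0.
have := off_eventI (mean_le_off mU e40) (off_eventI rho (off_eventI (N2P n N2n) (off_eventI (KYP N) (KWP N)))).
move=> H; apply: off_event_le (off_eventW _ H).
  have -> : \sum_(i < n.+1) 6 * s * (t / n.+1%:R) = 6 * s * t.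
    by rewrite sumr_const card_ord -[LHS]mulr_natr -mulrA divfK ?pnatr_eq0.
  have -> : 6 * s * t / (e / 4) = de / 5.
    by rewrite /s; field; rewrite !gt_eqF.
  lra.
move=> w [Ue [re [dWe [QY QW]]]].
apply: (@le_trans _ _ (\sum_(i < n.+1) (((2 * s)^-1 * fluct n m i w ^+ 2 + s / 2 * dW W t n i w ^+ 2) +
   eta / 4 * (\sum_(j < m.+1) ((Y (g (i * m.+1 + j)%N.+1) w - Y (g (i * m.+1 + j)%N) w) ^+ 2 +
     dW W t N (i * m.+1 + j) w ^+ 2)) + 2 * e' * eta))); last first.
  have blocks := sum_blocks (fun j => (Y (g j.+1) w - Y (g j) w) ^+ 2 + dW W t N j w ^+ 2) n.+1 m.+1.
  rewrite [X in _ = X]big_split/= in blocks.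
  rewrite big_split/= big_split/= -[X in _ + X + _]mulr_sumr blocks.
  rewrite sumr_const card_ord -[2 * e' * eta *+ _]mulr_natr.
  have -> : 2 * e' * eta * n.+1%:R = e / 2.
    rewrite /e'; field; rewrite gt_eqF//= [1 + _]addrC natr1 pnatr_eq0//.
  have QYW : \sum_(j < n.+1 * m.+1) (Y (g j.+1) w - Y (g j) w) ^+ 2 + \sum_(j < n.+1 * m.+1) dW W t N j w ^+ 2 <= KY + KW.
    exact: lerD.
  have := ler_wpM2l (ltW eta0) QYW; rewrite {2}/eta divfK ?gt_eqF ?addr_gt0//.
  move: Ue; lra.
apply: ler_sum => i _.
have ni : (i < n.+1)%N := ltn_ord i.
have rho0 := re (Ordinal (ltnW ni : (i < n.+2)%N)); have rho1 := re (Ordinal (ni : (i.+1 < n.+2)%N)).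
rewrite /= in rho0 rho1; have := block_trapezoid n m i w; rewrite -/N -/g.
set S1 := \sum_(j < i.+1 * _) _; set S0 := \sum_(j < i * _) _ in rho0 rho1 *.
rewrite -/S1 in rho1 *.
set U := fluct n m i w; set V := covar n m i w; set D := dW W t n i w => B.
set J1 := J (grid t n i.+1) w in rho1 *; set J0 := J (grid t n i) w in rho0 *.
have VQ : 2 * `|V| <= \sum_(j < m.+1) ((Y (g (i * m.+1 + j)%N.+1) w - Y (g (i * m.+1 + j)%N) w) ^+ 2 +
     dW W t N (i * m.+1 + j) w ^+ 2).
  rewrite mulrC -ler_pdivlMr// mulr_suml (le_trans (ler_norm_sum _ _ _))//; apply: ler_sum => j _.
  rewrite ler_pdivlMr// -/g -/N; set a := Y _ _ - _; set b := dW _ _ _ _ _.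
  have := sqr_ge0 (a - b); have := sqr_ge0 (a + b).
  by case: (ger0P (a * b)) => _; nra.
set Q := \sum_(j < m.+1) _ in VQ *.
have DE : `|D| <= eta by exact: dWe.
have -> : J1 - J0 - Y (grid t n i) w * D = U + 2^-1 * V - (S1 - J1) + (S0 - J0).
  by move: B; set y := _ * D; lra.
have h1 : `|U + 2^-1 * V - (S1 - J1) + (S0 - J0)| <= `|U| + 2^-1 * `|V| + 2 * e'.
  move: rho0 rho1; set a := S0 - J0; set b := S1 - J1 => ha hb.
  rewrite (le_trans (ler_normD _ _))// (le_trans (lerD (ler_normB _ _) ha))//.
  have := ler_normD U (2^-1 * V); rewrite normrM (@ger0_norm _ 2^-1)//; lra.
have D0 := normr_ge0 D; have V0 := normr_ge0 V.
apply: (le_trans (ler_wpM2r D0 h1)).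
have h2 : `|U| * `|D| <= (2 * s)^-1 * U ^+ 2 + s / 2 * D ^+ 2.
  rewrite -(real_normK (num_real U)) -(real_normK (num_real D)).
  move: (`|U|) (`|D|) => u v; rewrite -subr_ge0.
  have -> : (2 * s)^-1 * u ^+ 2 + s / 2 * v ^+ 2 - u * v = (2 * s)^-1 * (u - s * v) ^+ 2.
    by field; rewrite gt_eqF.
  by rewrite mulr_ge0 ?sqr_ge0// invr_ge0 mulr_ge0// ltW.
have h3 : `|V| * `|D| <= Q / 2 * eta by apply: ler_pM => //; lra.
have h4 : e' * `|D| <= e' * eta by rewrite ler_wpM2l// ltW.
lra.
Qed.

End fixed_time.

End stratonovich_remainder.

Section within_row.
Context {R : realType} {d : nat}.

Lemma within_row_comp (A : set R) (X : R -> 'rV[R]_d) (f : 'rV[R]_d -> R) :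
  (forall i, {within A, continuous (fun s => X s 0 i)}) -> continuous f ->
  {within A, continuous (fun s => f (X s))}.
Proof.
move=> cX cf s; apply: (@continuous_comp (subspace A) 'rV[R]_d R X f s); last exact: cf.
by apply: row_cvg => i; exact: cX.
Qed.

Lemma row_norm_sqr_le (v : 'rV[R]_d) : `|v| ^+ 2 <= \sum_k v 0 k ^+ 2.
Proof.
have S0 : 0 <= \sum_k v 0 k ^+ 2 by apply: sumr_ge0 => k _; exact: sqr_ge0.
rewrite -[leRHS](sqr_sqrtr S0) lerXn2r ?nnegrE ?sqrtr_ge0//.
apply: row_norm_le => [|i]; first exact: sqrtr_ge0.
by rewrite -sqrtr_sqr ler_wsqrtr// (bigD1 i)//= lerDl sumr_ge0// => k _; exact: sqr_ge0.
Qed.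

End within_row.

(** * The Ito form of the characteristic equation *)

Section characteristic_ito.
Context {disp : measure_display} {Omega : measurableType disp} {R : realType}.
Variables (P : probability Omega R) (F : R -> set (set Omega)) (W : R -> Omega -> R).
Hypothesis hF : complete_filtration P F.
Hypothesis hW : brownian_motion P F W.
Variables (d : nat) (c : 'rV[R]_d -> 'rV[R]_d) (T : R).
Hypothesis hc : torus_Ck_vect 2 c.
Variables (x : 'rV[R]_d) (X : R -> Omega -> 'rV[R]_d).
Hypothesis hX : characteristic P F W c T x X.

Let cC k : torus_Ck 2 (fun y => c y 0 k).
Proof. by case: hc => pc cC; split=> // y i; rewrite pc. Qed.

Let cC1 k : torus_Ck 1 (fun y => c y 0 k).
Proof. exact: torus_Ck_le (cC k). Qed.

Lemma characteristic_adapted s k : 0 <= s <= T -> rv_measurable (F s) (fun w => X s w 0 k).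
Proof. by move=> sT; case: hX => /(_ k)[aX _ _] _ _; apply: aX; rewrite /= in_itv. Qed.

Lemma adapted_row_comp (Z : Omega -> 'rV[R]_d) (f : 'rV[R]_d -> R) s : 0 <= s ->
  (forall k, rv_measurable (F s) (fun w => Z w 0 k)) -> continuous f ->
  rv_measurable (F s) (fun w => f (Z w)).
Proof.
move=> s0 aZ cf; apply/(rv_measurableP (filtration_sigma hF s0)).
apply: (@measurable_row_comp _ (g_sigma_algebraType (F s)) R d Z f) => // k.
exact/(rv_measurableP (filtration_sigma hF s0)).
Qed.

Lemma characteristic_continuous (f : 'rV[R]_d -> R) : continuous f ->
  {ae P, forall w, {within `[0, T], continuous (fun s => f (X s w))}}.
Proof.
move=> cf; have : {ae P, forall w, forall k, {within `[0, T], continuous (fun s => X s w 0 k)}}.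
  by apply: filter_forall => k; case: hX => /(_ k)[_ cX _] _ _.
by apply: filterS => w cX; exact: within_row_comp.
Qed.

Section fixed_time.
Variable t : R.
Hypothesis t0 : 0 < t.
Hypothesis tT : t <= T.

Let gT n i : (i <= n.+1)%N -> 0 <= grid t n i <= T.
Proof. by move=> ni; rewrite grid_ge0// (le_trans (grid_le t0 ni)). Qed.

Let dX n i w : 'rV[R]_d := X (grid t n i.+1) w - X (grid t n i) w.

Let qvX : tight P (fun n w => \sum_(i < n.+1) \sum_k dX n i w 0 k ^+ 2).
Proof.
have -> : (fun n w => \sum_(i < n.+1) \sum_k dX n i w 0 k ^+ 2) =
    (fun n w => \sum_k qv_sum (fun s w => X s w 0 k) (grid t n) n.+1 w).
  apply/funext => n; apply/funext => w; rewrite exchange_big/=; apply: eq_bigr => k _.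
  by apply: eq_bigr => i _; rewrite row_subE.
apply: (tight_sum (xi := fun k n w => qv_sum (fun s w => X s w 0 k) (grid t n) n.+1 w)) => k.
by apply: (semimartingale_qv_tight hF t0 tT); case: hX => /(_ k).
Qed.

Let qvc k : qv_tight P (fun s w => c (X s w) 0 k) t.
Proof.
have [L L0 LP] := torus_C1_lipschitz (cC1 k).
apply: (tightZ (sqr_ge0 L)) qvX => n w; rewrite mulr_sumr; apply: ler_sum => i _.
apply: (@le_trans _ _ (L ^+ 2 * `|dX n i w| ^+ 2)).
  rewrite -exprMn -(real_normK (num_real (_ - _))) lerXn2r ?nnegrE ?mulr_ge0//.
by rewrite ler_wpM2l ?sqr_ge0// row_norm_sqr_le.
Qed.

(** The previous lemma with [c (X s w)] as integrand and [x - X] as integral: on each step [dX] is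
    [- c(X) dW] up to an error that remains negligible after multiplication by [dW] and
    summation. *)
Let remainder k : small_prob P (fun n w => \sum_(i < n.+1)
  `|dX n i w 0 k + c (X (grid t n i) w) 0 k * dW W t n i w| * `|dW W t n i w|).
Proof.
have [B B0 BP] := periodic_bounded (cC k).1 (Ck_continuous (cC k).2).
have := @stratonovich_remainder_small _ _ _ P F W hF hW T (fun s w => c (X s w) 0 k)
  (fun s w => x 0 k - X s w 0 k) B _ _ _ _ _ t t0 tT (qvc k).
have -> : (fun n w => \sum_(i < n.+1) `|x 0 k - X (grid t n i.+1) w 0 k - (x 0 k - X (grid t n i) w 0 k) -
      c (X (grid t n i) w) 0 k * dW W t n i w| * `|dW W t n i w|) =
    (fun n w => \sum_(i < n.+1)
      `|dX n i w 0 k + c (X (grid t n i) w) 0 k * dW W t n i w| * `|dW W t n i w|).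
  apply/funext => n; apply/funext => w; apply: eq_bigr => i _; congr (_ * _).
  by rewrite -[RHS]normrN /dX row_subE; congr `|_|; ring.
apply.
- move=> s sT; have /andP[s0 _] := sT.
  apply: (@adapted_row_comp (X s) (fun y => c y 0 k) s s0); last exact: Ck_continuous (cC k).2.
  by move=> l; exact: characteristic_adapted.
- by move=> s w; exact: BP.
- exact: (@characteristic_continuous (fun y => c y 0 k) (Ck_continuous (cC k).2)).
- move=> s sT; have /andP[s0 _] := sT; apply: measurable_funB => //.
  exact: (adapted_measurable hF s0 (characteristic_adapted k sT)).
- by move=> s sT; case: hX => _ _ /(_ s k sT).
Qed.

(** The trapezoidal sum is the left-point sum plus half of the sum of
    [(c_l(X_{i+1}) - c_l(X_i)) dW_i]. Taylor's formula for [c_l] replaces the bracket by a linear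
    term in [dX], with an error of order [|dX|^2], a term of third order after multiplication by
    [dW]. In the linear term [remainder] replaces [dX] by [- c dW], which explains the minus sign of
    the correction. [E i] is what these replacements leave. *)
Lemma characteristic_ito l : small_prob P (fun n w => `|x 0 l - X t w 0 l -
  \sum_(i < n.+1) (c (X (grid t n i) w) 0 l * dW W t n i w -
    2^-1 * transport c (fun y => c y 0 l) (X (grid t n i) w) * dW W t n i w ^+ 2)|).
Proof.
have [K K0 KP] := torus_C2_taylor (cC l).
have /choice[B BP] k : exists B : R, 0 <= B /\ forall y, `|'D_('e_k) (fun y => c y 0 l) y| <= B.
  have [B B0 BP] := periodic_bounded (torus_Ck_derive k (cC l)).1 (Ck_continuous (torus_Ck_derive k (cC l)).2).
  by exists B.
pose Y s w : R := c (X s w) 0 l.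
have trap : small_prob P (fun n w => `|\sum_(j < n.+1) trapezoid W Y (grid t n) j w - (x 0 l - X t w 0 l)|).
  move=> e de e0 de0.
  have [||||eta eta0 etaP] := @trapezoid_off _ _ _ P F W hF hW T Y (fun s w => x 0 l - X s w 0 l) _ _ _ t e de _ e0 de0.
  - move=> s sT; have /andP[s0 _] := sT.
    apply: (@adapted_row_comp (X s) (fun y => c y 0 l) s s0); last exact: Ck_continuous (cC l).2.
    by move=> k; exact: characteristic_adapted.
  - move=> s sT; have /andP[s0 _] := sT; apply: measurable_funB => //.
    exact: (adapted_measurable hF s0 (characteristic_adapted l sT)).
  - by move=> s sT; case: hX => _ _ /(_ s l sT).
  - by rewrite (ltW t0).
  have [N NP] := inv_nat_small (ltW t0) (divr_gt0 eta0 (ltr0n R 2)).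
  exists N => n Nn; apply: etaP => [|i||i _].
  - exact: grid0.
  - exact: grid_lt.
  - exact: grid_end.
  - by rewrite grid_step (le_lt_trans (NP n Nn))// ltr_pdivrMr// mulr_natr mulr2n ltrDl.
have quad : small_prob P (fun n w => K * \sum_(i < n.+1) (\sum_k dX n i w 0 k ^+ 2) * `|dW W t n i w|).
  apply: small_probZ => // [n w|].
    by apply: sumr_ge0 => i _; rewrite mulr_ge0// sumr_ge0// => k _; exact: sqr_ge0.
  apply: (bm_weighted_small hF hW (a := fun n i w => \sum_k dX n i w 0 k ^+ 2)) => //.
  by move=> n i w; apply: sumr_ge0 => k _; exact: sqr_ge0.
have lin : small_prob P (fun n w => \sum_k B k * \sum_(i < n.+1)
    `|dX n i w 0 k + c (X (grid t n i) w) 0 k * dW W t n i w| * `|dW W t n i w|).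
  apply: (small_prob_sum (xi := fun k n w => B k * \sum_(i < n.+1)
    `|dX n i w 0 k + c (X (grid t n i) w) 0 k * dW W t n i w| * `|dW W t n i w|)) => k.
  apply: small_probZ => //; first by case: (BP k).
  by move=> n w; apply: sumr_ge0 => i _; rewrite mulr_ge0.
apply: small_probW (small_probD trap (small_probD quad lin)).
apply: aeW => w n; set S := \sum_(i < n.+1) (_ - _).
pose E i : R := (Y (grid t n i.+1) w - Y (grid t n i) w +
  transport c (fun y => c y 0 l) (X (grid t n i) w) * dW W t n i w) * dW W t n i w.
have trapE : \sum_(j < n.+1) trapezoid W Y (grid t n) j w = S + 2^-1 * \sum_(i < n.+1) E i.
  rewrite mulr_sumr -big_split/=; apply: eq_bigr => i _.
  by rewrite /trapezoid /E /Y /dW; field.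
have EB : `|\sum_(i < n.+1) E i| <= K * (\sum_(i < n.+1) (\sum_k dX n i w 0 k ^+ 2) * `|dW W t n i w|) +
    \sum_k B k * \sum_(i < n.+1)
    `|dX n i w 0 k + c (X (grid t n i) w) 0 k * dW W t n i w| * `|dW W t n i w|.
  under [X in _ + X]eq_bigr do rewrite mulr_sumr.
  rewrite [X in _ + X]exchange_big/= mulr_sumr -big_split/=.
  rewrite (le_trans (ler_norm_sum _ _ _))//; apply: ler_sum => i _.
  set D := dW W t n i w; set y := X (grid t n i) w; pose z := X (grid t n i.+1) w.
  have -> : E i = (c z 0 l - c y 0 l - \sum_k 'D_('e_k) (fun y => c y 0 l) y * (z 0 k - y 0 k)) * D +
      \sum_k 'D_('e_k) (fun y => c y 0 l) y * ((dX n i w 0 k + c y 0 k * D) * D).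
    have -> : \sum_k 'D_('e_k) (fun y => c y 0 l) y * ((dX n i w 0 k + c y 0 k * D) * D) =
       ((\sum_k 'D_('e_k) (fun y => c y 0 l) y * (z 0 k - y 0 k)) + transport c (fun y => c y 0 l) y * D) * D.
      rewrite /transport mulr_suml -big_split/= mulr_suml; apply: eq_bigr => k _.
      by rewrite /dX row_subE -/y -/z; ring.
    by rewrite /E /Y -/y -/z -/D; ring.
  rewrite (le_trans (ler_normD _ _))//; apply: lerD.
    rewrite normrM mulrA ler_wpM2r// (le_trans (KP y z))// ler_wpM2l//.
    exact: row_norm_sqr_le.
  rewrite (le_trans (ler_norm_sum _ _ _))//; apply: ler_sum => k _.
  by rewrite normrM [`|_ * D|]normrM ler_wpM2r ?mulr_ge0// (BP k).2.
move: EB; set U := K * _; set V := \sum_k B k * _; set A := \sum_(i < n.+1) E i => EB.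
rewrite trapE -/A; set J := x 0 l - X t w 0 l.
have -> : J - S = - (S + 2^-1 * A - J) + 2^-1 * A by ring.
rewrite (le_trans (ler_normD _ _))// normrN lerD2l normrM ger0_norm//.
rewrite (le_trans _ EB)// ler_piMl// invf_le1//; lra.
Qed.

End fixed_time.

End characteristic_ito.

(** * Identification of the characteristics *)

Section flow_taylor.
Context {R : realType} {d : nat}.
Variable c : 'rV[R]_d -> 'rV[R]_d.

Lemma torus_Ck_vect_le k l : (k <= l)%N -> torus_Ck_vect l c -> torus_Ck_vect k c.
Proof. by move=> kl [pc cC]; split=> // i; exact: Ck_le kl (cC i). Qed.

Lemma torus_Ck_iter_transport p j (f : 'rV[R]_d -> R) : torus_Ck_vect p c -> torus_Ck p f -> (j <= p)%N ->
  torus_Ck (p - j) (iter j (transport c) f).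
Proof.
move=> cC fC; elim: j => [|j ih] jp; first by rewrite subn0.
rewrite iterS; apply: torus_Ck_transport; first exact: torus_Ck_vect_le (leq_subr _ _) cC.
by rewrite subnSK//; apply: ih; exact: ltnW.
Qed.

Lemma is_derive_iter_transport p j (f : 'rV[R]_d -> R) x g : torus_Ck_vect p c -> torus_Ck p f ->
  integral_curve c x g -> (j < p)%N -> forall s : R,
  is_derive s (1:R) (fun r => iter j (transport c) f (g r)) (iter j.+1 (transport c) f (g s)).
Proof.
move=> cC fC [_ dg] jp s; have [_] := torus_Ck_iter_transport cC fC (ltnW jp).
rewrite -subnSK// => fjC.
have -> : iter j.+1 (transport c) f (g s) = \sum_i 'D_('e_i) (iter j (transport c) f) (g s) * c (g s) 0 i.
  by rewrite iterS; apply: eq_bigr => i _; rewrite mulrC.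
exact: (is_derive_along_curve fjC (dg s)).
Qed.

Lemma flow_taylor p (f : 'rV[R]_d -> R) : torus_Ck_vect p c -> torus_Ck p f ->
  exists2 K : R, 0 <= K & forall x g, integral_curve c x g -> forall s s0,
    `|f (g s) - \sum_(j < p) iter j (transport c) f (g s0) * (s - s0) ^+ j / j`!%:R| <= K * `|s - s0| ^+ p.
Proof.
move=> cC fC; have := torus_Ck_iter_transport cC fC (leqnn p); rewrite subnn => -[pp cp].
have [K K0 KP] := periodic_bounded pp cp; exists K => // x g xg s s0.
apply: (taylor_chain_bound (f := fun j s => iter j (transport c) f (g s))) => // j r jp.
exact: is_derive_iter_transport xg jp r.
Qed.

(** A coordinate of [R^d] is not periodic, but its derivative along a curve is the periodic function
    [c_l]. Putting the coordinate in front of the chain built on [c_l] gives an expansion of order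
    three for a field that is only C^2. *)
Lemma flow_taylor_coord (l : 'I_d) : torus_Ck_vect 2 c ->
  exists2 K : R, 0 <= K & forall x g, integral_curve c x g -> forall s s0,
    `|g s 0 l - (g s0 0 l + c (g s0) 0 l * (s - s0) +
       2^-1 * transport c (fun y => c y 0 l) (g s0) * (s - s0) ^+ 2)| <= K * `|s - s0| ^+ 3.
Proof.
move=> cC; have fC : torus_Ck 2 (fun y => c y 0 l) by case: cC => pc cC; split=> // y i; rewrite pc.
have := torus_Ck_iter_transport cC fC (leqnn 2); rewrite subnn => -[pp cp].
have [K K0 KP] := periodic_bounded pp cp; exists K => // x g xg s s0.
have := @taylor_chain_bound R 3 (fun j s => if j is j'.+1 then iter j' (transport c) (fun y => c y 0 l) (g s)
  else g s 0 l) K s0 K0 _ _ s.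
have -> : \sum_(j < 3) (if j : nat is j'.+1 then iter j' (transport c) (fun y => c y 0 l) (g s0) else g s0 0 l) *
    (s - s0) ^+ j / j`!%:R = g s0 0 l + c (g s0) 0 l * (s - s0) +
       2^-1 * transport c (fun y => c y 0 l) (g s0) * (s - s0) ^+ 2.
  by rewrite !big_ord_recr big_ord0/= (_ : 0`! = 1)%N// (_ : 1`! = 1)%N// (_ : 2`! = 2)%N//; field.
apply=> [[|j] r jp|r]; last exact: KP.
- exact: xg.2.
- exact: (is_derive_iter_transport cC fC xg (jp : (j < 2)%N) r).
Qed.

(** A deterministic statement: [a] stands for the values of a Brownian path on a grid, and the
    one-step expansions at the times [- a i] are added up, each leaving a cubic error. *)
Lemma flow_ito (l : 'I_d) : torus_Ck_vect 2 c ->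
  exists2 K : R, 0 <= K & forall x g, integral_curve c x g -> forall (a : nat -> R) n, a 0%N = 0 ->
    `|x 0 l - g (- a n) 0 l - \sum_(i < n) (c (g (- a i)) 0 l * (a i.+1 - a i) -
       2^-1 * transport c (fun y => c y 0 l) (g (- a i)) * (a i.+1 - a i) ^+ 2)| <=
    K * \sum_(i < n) `|a i.+1 - a i| ^+ 3.
Proof.
move=> cC; have [K K0 KP] := flow_taylor_coord l cC; exists K => // x g xg a n a0.
elim: n => [|n ih].
  by rewrite !big_ord0 a0 !oppr0 xg.1 subrr addr0 normr0 mulr0.
rewrite !big_ord_recr/= [K * (_ + _)]mulrDr.
have := KP x g xg (- a n.+1) (- a n).
have -> : - a n.+1 - - a n = - (a n.+1 - a n) by ring.
rewrite [X in _ * X ^+ 3]normrN.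
move: ih; set S := \sum_(i < n) _; set Q := K * _; set D := a n.+1 - a n.
set g1 := g (- a n.+1) 0 l; set g0 := g (- a n) 0 l; set cn := c _ 0 l; set bn := transport _ _ _ => h1 h2.
have -> : x 0 l - g1 - (S + (cn * D - 2^-1 * bn * D ^+ 2)) = (x 0 l - g0 - S) +
   - (g1 - (g0 + cn * - D + 2^-1 * bn * (- D) ^+ 2)) by ring.
by rewrite (le_trans (ler_normD _ _))// lerD// normrN.
Qed.

End flow_taylor.

Section sums.
Context {R : realType}.

Lemma sqr_sum_le n (a : 'I_n -> R) : (\sum_i a i) ^+ 2 <= n%:R * \sum_i a i ^+ 2.
Proof.
have -> : n%:R * \sum_i a i ^+ 2 = \sum_i \sum_j (a i ^+ 2 + a j ^+ 2) / 2.
  have -> : \sum_i \sum_j (a i ^+ 2 + a j ^+ 2) / 2 = \sum_(i < n) (n%:R * a i ^+ 2 + \sum_j a j ^+ 2) / 2.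
    apply: eq_bigr => i _; rewrite -mulr_suml big_split/= sumr_const card_ord.
    by rewrite [n%:R * _]mulr_natl.
  rewrite -mulr_suml big_split/= sumr_const card_ord -mulr_sumr -mulr_natl.
  by field.
rewrite expr2 mulr_suml; apply: ler_sum => i _; rewrite mulr_sumr; apply: ler_sum => j _.
have := sqr_ge0 (a i - a j); nra.
Qed.

(** The left Riemann sum of an increasing function stays below its integral. This is the discrete
    counterpart of the gain [1 / l] of [le_derive_expR]. *)
Lemma expR_grid_sum (l t : R) n : 0 < l -> 0 < t ->
  t / n.+1%:R * \sum_(i < n.+1) expR (l * grid t n i) <= expR (l * t) / l.
Proof.
move=> l0 t0; suff H m : t / n.+1%:R * \sum_(i < m) expR (l * grid t n i) <= expR (l * grid t n m) / l.
  by have := H n.+1; rewrite grid_end.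
elim: m => [|m ih].
  by rewrite big_ord0 mulr0 divr_ge0 ?expR_ge0// ltW.
rewrite big_ord_recr/= mulrDr (le_trans (lerD ih (lexx _)))//.
have -> : grid t n m.+1 = grid t n m + t / n.+1%:R by rewrite -(grid_step t n m) addrC subrK.
rewrite mulrDr expRD ler_pdivlMr// mulrDl divfK ?gt_eqF//.
have := expR_ge1Dx (l * (t / n.+1%:R)); have := expR_gt0 (l * grid t n m).
set a := expR (l * grid t n m); set b := t / n.+1%:R => a0 h.
have := ler_wpM2l (ltW a0) h; lra.
Qed.

(** Truncated coordinate by coordinate, since the Ito forms to be subtracted are stated for one
    coordinate at a time. *)
Definition trunc_dist d (v : 'rV[R]_d) : R := \sum_l Num.min `|v 0 l| 1 ^+ 2.

Lemma trunc_dist_ge0 d (v : 'rV[R]_d) : 0 <= trunc_dist v.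
Proof. by apply: sumr_ge0 => l _; exact: sqr_ge0. Qed.

Lemma trunc_dist_le d (v : 'rV[R]_d) : trunc_dist v <= d%:R.
Proof.
apply: (@le_trans _ _ (\sum_(l < d) 1)); last by rewrite sumr_const card_ord.
by apply: ler_sum => l _; rewrite expr_le1// ge_min lexx orbT.
Qed.

Lemma trunc_dist_eq0 d (v : 'rV[R]_d) : trunc_dist v = 0 -> v = 0.
Proof.
move=> v0; apply/rowP => l; rewrite mxE; apply/eqP; rewrite -normr_le0.
have : Num.min `|v 0 l| 1 ^+ 2 <= 0.
  by rewrite -v0 /trunc_dist (bigD1 l)//= lerDl sumr_ge0// => k _; exact: sqr_ge0.
rewrite le_eqVlt ltNge sqr_ge0 orbF sqrf_eq0 => /eqP h.
move: h; have [v1|/ltW v1] := leP `|v 0 l| 1; first by move=> ->.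
by move=> /eqP; rewrite oner_eq0.
Qed.

(** If all the coordinates of [x - y] are at most 1, truncation has no effect and the Lipschitz
    bound applies; otherwise [trunc_dist] is at least 1 and the crude bound [4 B^2] suffices. Thus
    the coefficients of the Ito form are controlled by the truncated distance, which closes the
    Gronwall loop. *)
Lemma lipschitz_trunc_dist d (f : 'rV[R]_d -> R) (L B : R) x y :
  (forall x y, `|f x - f y| <= L * `|x - y|) -> (forall x, `|f x| <= B) ->
  (f x - f y) ^+ 2 <= (L ^+ 2 + 4 * B ^+ 2) * trunc_dist (x - y).
Proof.
move=> fL fB; have q0 := trunc_dist_ge0 (x - y); rewrite mulrDl.
have [small|/existsNP[l /negP]] := pselect (forall l, `|(x - y) 0 l| <= 1).
  apply: (@le_trans _ _ (L ^+ 2 * trunc_dist (x - y))); last first.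
    by rewrite lerDl mulr_ge0// mulr_ge0// sqr_ge0.
  have -> : trunc_dist (x - y) = \sum_l (x - y) 0 l ^+ 2.
    by apply: eq_bigr => l _; rewrite min_l// real_normK// num_real.
  apply: le_trans (ler_wpM2l (sqr_ge0 L) (row_norm_sqr_le (x - y))).
  rewrite -exprMn -(real_normK (num_real (f x - f y))) lerXn2r ?nnegrE//.
  exact: le_trans (fL x y).
rewrite -ltNge => vl; have q1 : 1 <= trunc_dist (x - y).
  rewrite /trunc_dist (bigD1 l)//= min_r ?(ltW vl)// expr1n lerDl sumr_ge0// => k _; exact: sqr_ge0.
apply: (@le_trans _ _ (4 * B ^+ 2 * 1)).
  have := fB x; have := fB y; rewrite !ler_norml => /andP[? ?] /andP[? ?]; nra.
apply: (@le_trans _ _ (4 * B ^+ 2 * trunc_dist (x - y))).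
  by rewrite ler_wpM2l// mulr_ge0// sqr_ge0.
by rewrite lerDr mulr_ge0// sqr_ge0.
Qed.

End sums.

Section flow_identification.
Context {disp : measure_display} {Omega : measurableType disp} {R : realType}.
Variables (P : probability Omega R) (F : R -> set (set Omega)) (W : R -> Omega -> R).
Hypothesis hF : complete_filtration P F.
Hypothesis hW : brownian_motion P F W.
Variables (d : nat) (c : 'rV[R]_d -> 'rV[R]_d).
Hypothesis hc : torus_Ck_vect 2 c.
Variable psi : R -> 'rV[R]_d -> 'rV[R]_d.
Hypothesis psiP : forall y, integral_curve c y (psi^~ y).

Let cC k : torus_Ck 2 (fun y => c y 0 k).
Proof. by case: hc => pc cC; split=> // y i; rewrite pc. Qed.

Let bC k : torus_Ck 1 (transport c (fun y => c y 0 k)).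
Proof. by apply: torus_Ck_transport => //; exact: torus_Ck_vect_le hc. Qed.

Lemma flow_ito_small (x : 'rV[R]_d) (t : R) (l : 'I_d) : 0 < t -> small_prob P (fun n w => `|x 0 l - psi (- W t w) x 0 l -
  \sum_(i < n.+1) (c (psi (- W (grid t n i) w) x) 0 l * dW W t n i w -
    2^-1 * transport c (fun y => c y 0 l) (psi (- W (grid t n i) w) x) * dW W t n i w ^+ 2)|).
Proof.
move=> t0; have [K K0 KP] := flow_ito l hc.
have cube : small_prob P (fun n w => K * \sum_(i < n.+1) dW W t n i w ^+ 2 * `|dW W t n i w|).
  apply: small_probZ => // [n w|].
    by apply: sumr_ge0 => i _; rewrite mulr_ge0// sqr_ge0.
  apply: (bm_weighted_small hF hW (a := fun n i w => dW W t n i w ^+ 2)) => //.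
    by move=> n i w; exact: sqr_ge0.
  exact: (bm_qv_tight hF hW t0).
apply: small_probW cube; have [_ W0 _ _ _] := hW; apply: filterS W0 => w W0 n.
have := KP x _ (psiP x) (fun i => W (grid t n i) w) n.+1.
rewrite grid0 grid_end => /(_ W0); rewrite /dW => /le_trans; apply.
rewrite le_eqVlt; apply/orP; left; apply/eqP; congr (_ * _); apply: eq_bigr => i _.
by rewrite [LHS]exprSr -normrX ger0_norm ?sqr_ge0.
Qed.

Lemma small_prob_mean (r xi : nat -> Omega -> R) : (forall n, measurable_fun setT (r n)) ->
  (forall n w, `|r n w| <= xi n w) -> small_prob P xi -> forall e, 0 < e ->
  exists N, forall n, (N <= n)%N -> mean_le P (fun w => Num.min `|r n w| 1 ^+ 2) e.
Proof.
move=> mr rxi xs e e0; have e20 : 0 < e / 2 by rewrite divr_gt0.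
have [N NP] := xs _ _ e20 e20; exists N => n Nn; split=> [|w|].
- by apply: measurable_funX; apply: measurable_minr => //; exact: measurableT_comp.
- exact: sqr_ge0.
have [B [mB PB] BP] := NP n Nn.
apply: (@le_trans _ _ (\int[P]_w ((e / 2)%:E + (\1_B w)%:E))%E).
  apply: ge0_le_integralW => w; first by rewrite lee_fin sqr_ge0.
  rewrite -EFinD lee_fin indicE.
  have m0 : 0 <= Num.min `|r n w| 1 by rewrite le_min normr_ge0/=.
  have m1 : Num.min `|r n w| 1 <= 1 by rewrite ge_min lexx orbT.
  have [wB|] := boolP (w \in B).
    by rewrite (@le_trans _ _ 1)// ?expr_le1// lerDr ltW.
  rewrite notin_setE => /BP xe; rewrite addr0 expr2 (@le_trans _ _ (Num.min `|r n w| 1))//.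
    by rewrite ler_piMr.
  by rewrite ge_min (le_trans (rxi n w)).
rewrite ge0_integralD//; last 2 first.
- by move=> w _; rewrite lee_fin ltW.
- by apply/measurable_EFinP; exact: measurable_indic.
rewrite integral_indic// setIT integral_cst//=.
rewrite [e in leRHS]splitr EFinD leeD//.
rewrite -[leRHS]mule1 lee_pmul ?lee_fin ?(ltW e20)//; exact: (probability_le1 P measurableT).
Qed.

Variables (T : R) (x : 'rV[R]_d) (X : R -> Omega -> 'rV[R]_d).
Hypothesis T0 : 0 < T.
Hypothesis hX : characteristic P F W c T x X.

Let Z s w := psi (- W s w) x.
Let gap s w := trunc_dist (X s w - Z s w).

Let psi_continuous (y : 'rV[R]_d) l : continuous (fun s => psi s y 0 l).
Proof. by move=> s; exact: is_derive_continuous ((psiP y).2 s l). Qed.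

Let aZ s k : 0 <= s -> rv_measurable (F s) (fun w => Z s w 0 k).
Proof.
move=> s0; apply: (rv_measurable_comp (X := W s) (f := fun r => psi (- r) x 0 k)).
  exact: (bm_adapted hW s0).
apply: continuous_measurable_fun => r.
apply: (@continuous_comp _ _ _ (fun r : R => - r) (fun r => psi r x 0 k)).
  exact: oppr_continuous.
exact: psi_continuous.
Qed.

Let aX s k : 0 <= s <= T -> rv_measurable (F s) (fun w => X s w 0 k).
Proof. by move=> sT; exact: (characteristic_adapted hX k sT). Qed.

Let mgap s : 0 <= s <= T -> measurable_fun setT (gap s).
Proof.
move=> sT; have /andP[s0 _] := sT; apply: measurable_sum => l.
apply: measurable_funX; apply: measurable_minr => //; apply: measurableT_comp => //.
under eq_fun do rewrite row_subE.
apply: measurable_funB.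
  exact: (adapted_measurable hF s0 (aX l sT)).
exact: (adapted_measurable hF s0 (aZ l s0)).
Qed.

Section step.
Variables (f : 'rV[R]_d -> R) (C t : R).
Hypothesis fC : continuous f.
Hypothesis C0 : 0 <= C.
Hypothesis fD : forall y z, (f y - f z) ^+ 2 <= C * trunc_dist (y - z).
Hypothesis t0 : 0 < t.
Hypothesis tT : t <= T.
Variables (n : nat) (b : nat -> R).
Hypothesis hb : forall i, (i < n.+1)%N -> mean_le P (gap (grid t n i)) (b i).

Let D i w := f (X (grid t n i) w) - f (Z (grid t n i) w).

Let gT i : (i <= n.+1)%N -> 0 <= grid t n i <= T.
Proof. by move=> ni; rewrite grid_ge0// (le_trans (grid_le t0 ni)). Qed.

Let aD i : (i < n.+1)%N -> rv_measurable (F (grid t n i)) (D i).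
Proof.
move=> ni; have iT := gT (ltnW ni); have /andP[i0 _] := iT.
apply/(rv_measurableP (filtration_sigma hF i0)); apply: measurable_funB.
  apply/(rv_measurableP (filtration_sigma hF i0)).
  by apply: (adapted_row_comp hF i0) => // k; exact: aX.
apply/(rv_measurableP (filtration_sigma hF i0)).
by apply: (adapted_row_comp hF i0) => // k; exact: aZ.
Qed.

Let mD i : (i < n.+1)%N -> measurable_fun setT (D i).
Proof.
by move=> ni; have /andP[i0 _] := gT (ltnW ni); exact: (adapted_measurable hF i0 (aD ni)).
Qed.

Let meanD i : (i < n.+1)%N -> mean_le P (fun w => D i w ^+ 2) (C * b i).
Proof.
move=> ni; apply: mean_leW (lexx _) (mean_leZ C0 (hb ni)).
  by apply: measurable_funX; exact: mD.
by move=> w; rewrite sqr_ge0 fD.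
Qed.

Let mdW i : measurable_fun setT (dW W t n i).
Proof. by apply: measurable_funB; apply: (bm_measurable hF hW); exact: grid_ge0. Qed.

Lemma ito_step : mean_le P (fun w => (\sum_(i < n.+1) D i w * dW W t n i w) ^+ 2)
  (6 * C * (t / n.+1%:R * \sum_(i < n.+1) b i)).
Proof.
split=> [|w|]; last 1 first.
- apply: le_trans (ito_sum_le hF hW (tau := grid t n) (Z := D) (n := n.+1) _ _ _) _.
  + exact: grid_ge0.
  + by move=> i; exact: grid_lt.
  + exact: aD.
  apply: (@le_trans _ _ (\sum_(i < n.+1) (6 * (t / n.+1%:R) * (C * b i))%:E)%E).
    apply: lee_sum => i _; rewrite grid_step [X in (_ <= X)%E]EFinM lee_pmul2l//; last first.
      by rewrite lte_fin mulr_gt0// divr_gt0.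
    by case: (meanD (ltn_ord i)).
  rewrite sumEFin lee_fin -mulr_sumr -mulr_sumr le_eqVlt; apply/orP; left; apply/eqP; ring.
- apply: measurable_funX; apply: measurable_sum => i; apply: measurable_funM; last exact: mdW.
  by apply: mD.
- exact: sqr_ge0.
Qed.

(** Nothing is centred here. The Cauchy-Schwarz inequality costs a factor [n + 1], paid for by the
    fourth moment [96 (t / (n + 1))^2] of the increments, and one factor [t] is bounded by [T]. *)
Lemma qv_step : mean_le P (fun w => (\sum_(i < n.+1) D i w * dW W t n i w ^+ 2) ^+ 2)
  (96 * T * C * (t / n.+1%:R * \sum_(i < n.+1) b i)).
Proof.
have b0 i : (i < n.+1)%N -> 0 <= b i.
  move=> ni; case: (hb ni) => _ g0 gb; rewrite -lee_fin; apply: le_trans gb.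
  by apply: integral_ge0 => w _; rewrite lee_fin.
have S0 : 0 <= \sum_(i < n.+1) b i by apply: sumr_ge0 => i _; exact: b0.
have term i : (i < n.+1)%N -> mean_le P (fun w => D i w ^+ 2 * dW W t n i w ^+ 4) (96 * (t / n.+1%:R) ^+ 2 * (C * b i)).
  move=> ni; have /andP[i0 _] := gT (ltnW ni); split=> [|w|].
  - by apply: measurable_funM; apply: measurable_funX; [exact: mD|exact: mdW].
  - by rewrite mulr_ge0 ?sqr_ge0// (exprM _ 2 2) sqr_ge0.
  have := bm_weighted_moment hF hW i0 (grid_lt n i t0) (ltn0Sn 1) (aD ni).
  rewrite grid_step (_ : (4 * 2) ^+ 2 * (3 / 2) = 96 :> R); last by field.
  move=> /le_trans; apply; rewrite [X in (_ <= X)%E]EFinM.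
  rewrite lee_wpmul2l ?lee_fin ?mulr_ge0 ?sqr_ge0 ?divr_ge0 ?(ltW t0)//.
  by case: (meanD ni).
have := mean_leZ (ler0n R n.+1) (mean_le_sum (fun i : 'I_n.+1 => term i (ltn_ord i))).
apply: mean_leW => [|w|].
- apply: measurable_funX; apply: measurable_sum => i; apply: measurable_funM; first exact: mD.
  by apply: measurable_funX; exact: mdW.
- rewrite sqr_ge0/= (le_trans (sqr_sum_le _))// ler_wpM2l//; apply: ler_sum => i _.
  by rewrite exprMn -exprM.
- rewrite -mulr_sumr -mulr_sumr.
  have -> : n.+1%:R * (96 * (t / n.+1%:R) ^+ 2 * (C * \sum_(i < n.+1) b i)) =
     96 * t * C * (t / n.+1%:R * \sum_(i < n.+1) b i).
    by field; rewrite addrC natr1 pnatr_eq0.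
  rewrite ler_wpM2r//; first by rewrite mulr_ge0// divr_ge0// ltW.
  by rewrite ler_wpM2r// ler_wpM2l.
Qed.

End step.

(** Subtracting the Ito forms of [X] and of the flow bounds the gap at [t] by the gaps at earlier
    grid points. The constant [C] depends on neither [t] nor [e]; only the grid does. *)
Lemma gap_step : exists2 C, 0 < C & forall t e, 0 < t -> t <= T -> 0 < e ->
  exists n, forall b : nat -> R, (forall i, (i < n.+1)%N -> mean_le P (gap (grid t n i)) (b i)) ->
    mean_le P (gap t) (C * (t / n.+1%:R * \sum_(i < n.+1) b i) + e).
Proof.
have bound (f : 'rV[R]_d -> R) : torus_Ck 1 f -> exists C : R, 0 <= C /\
    forall y z, (f y - f z) ^+ 2 <= C * trunc_dist (y - z).
  move=> fC; have [L L0 LP] := torus_C1_lipschitz fC.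
  have [B B0 BP] := periodic_bounded fC.1 (Ck_continuous fC.2).
  exists (L ^+ 2 + 4 * B ^+ 2); split; first by rewrite addr_ge0 ?mulr_ge0 ?sqr_ge0.
  by move=> y z; exact: lipschitz_trunc_dist.
have cC1 k : torus_Ck 1 (fun y => c y 0 k) by exact: torus_Ck_le (cC k).
have /choice[Cc CcP] := fun k => bound _ (cC1 k).
have /choice[Cb CbP] := fun k => bound _ (bC k).
(* From [v = r - A + B / 2] follows [v^2 <= 3 r^2 + 3 A^2 + B^2]: the Ito part [A] counts three
   times, the quadratic part [B] once. *)
pose C := \sum_(l < d) (3 * (6 * Cc l) + 96 * T * Cb l).
have C0 : 0 <= C.
  apply: sumr_ge0 => l _; have [? _] := CcP l; have [? _] := CbP l.
  by rewrite addr_ge0 ?mulr_ge0// ltW.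
exists (C + 1) => [|t e t0 tT e0]; first by rewrite ltr_pwDr.
pose S g (f : 'rV[R]_d -> R) n w := \sum_(i < n.+1) (f (X (grid t n i) w) - f (Z (grid t n i) w)) * g (dW W t n i w).
pose b_ l := transport c (fun y => c y 0 l).
pose r l n w := (X t w - Z t w) 0 l + S id (fun y => c y 0 l) n w - 2^-1 * S (fun r => r ^+ 2) (b_ l) n w.
have sT : 0 <= t <= T by rewrite (ltW t0).
have gT n i : (i <= n.+1)%N -> 0 <= grid t n i <= T.
  by move=> ni; rewrite grid_ge0// (le_trans (grid_le t0 ni)).
have mS g f n : continuous f -> measurable_fun setT g -> measurable_fun setT (S g f n).
  move=> fC mg; apply: measurable_sum => i; have iT := gT n i (ltnW (ltn_ord i)).
  have /andP[i0 _] := iT; apply: measurable_funM.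
    apply: measurable_funB.
      by apply: (adapted_measurable hF i0); apply: (adapted_row_comp hF i0) => // k; exact: aX.
    by apply: (adapted_measurable hF i0); apply: (adapted_row_comp hF i0) => // k; exact: aZ.
  apply: (measurableT_comp mg); apply: measurable_funB; apply: (bm_measurable hF hW) => //.
  exact: grid_ge0.
have mr l n : measurable_fun setT (r l n).
  apply: measurable_funB.
    apply: measurable_funD; last exact: mS (Ck_continuous (cC l).2) _.
    under eq_fun do rewrite row_subE.
    by apply: measurable_funB; apply: (adapted_measurable hF (ltW t0)); [exact: aX|apply: aZ; exact: ltW].
  by apply: measurable_funM => //; apply: mS; [exact: Ck_continuous (bC l).2|exact: measurable_funX].
have rs l := small_probD (characteristic_ito hF hW hc hX t0 tT l) (flow_ito_small x l t0).
have rle l n w : `|r l n w| <= `|x 0 l - X t w 0 l -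
    \sum_(i < n.+1) (c (X (grid t n i) w) 0 l * dW W t n i w - 2^-1 * b_ l (X (grid t n i) w) * dW W t n i w ^+ 2)| +
   `|x 0 l - psi (- W t w) x 0 l -
    \sum_(i < n.+1) (c (psi (- W (grid t n i) w) x) 0 l * dW W t n i w -
     2^-1 * b_ l (psi (- W (grid t n i) w) x) * dW W t n i w ^+ 2)|.
  rewrite -[X in _ <= X + _]normrN addrC; apply: le_trans (ler_normD _ _).
  rewrite le_eqVlt; apply/orP; left; apply/eqP; congr `|_|; rewrite /r row_subE -/(Z t w).
  rewrite -[LHS]addrA; have -> : S id (fun y => c y 0 l) n w - 2^-1 * S (fun r => r ^+ 2) (b_ l) n w =
    \sum_(i < n.+1) (c (X (grid t n i) w) 0 l * dW W t n i w - 2^-1 * b_ l (X (grid t n i) w) * dW W t n i w ^+ 2) -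
    \sum_(i < n.+1) (c (Z (grid t n i) w) 0 l * dW W t n i w - 2^-1 * b_ l (Z (grid t n i) w) * dW W t n i w ^+ 2).
    by rewrite /S mulr_sumr -!sumrB; apply: eq_bigr => i _; ring.
  set A := \sum_(i < n.+1) _; set B := \sum_(i < n.+1) _; rewrite -/B; ring.
(* The remainder enters with the factor 3 and there are [d] coordinates, so the total stays below
   [e]; [d + 1] keeps the denominator positive. *)
have ed0 : 0 < e / (3 * d.+1%:R) by rewrite divr_gt0// mulr_gt0.
have /choice[N NP] l : exists N, forall n, (N <= n)%N -> mean_le P (fun w => Num.min `|r l n w| 1 ^+ 2) (e / (3 * d.+1%:R)).
  exact: (small_prob_mean (mr l) (rle l) (rs l) ed0).
pose n := (\max_l N l)%N; exists n => b hb.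
have b0 i : (i < n.+1)%N -> 0 <= b i.
  move=> ni; case: (hb i ni) => _ g0 gb; rewrite -lee_fin; apply: le_trans gb.
  by apply: integral_ge0 => w _; rewrite lee_fin.
set Q := t / n.+1%:R * \sum_(i < n.+1) b i.
have Q0 : 0 <= Q by rewrite mulr_ge0 ?divr_ge0 ?(ltW t0)// sumr_ge0// => i _; exact: b0.
have part l : mean_le P (fun w => Num.min `|(X t w - Z t w) 0 l| 1 ^+ 2)
    ((3 * (6 * Cc l) + 96 * T * Cb l) * Q + e / d.+1%:R).
  have [Cc0 ccP] := CcP l; have [Cb0 cbP] := CbP l.
  have m1 := ito_step (Ck_continuous (cC l).2) Cc0 ccP t0 tT hb.
  have m2 := qv_step (Ck_continuous (bC l).2) Cb0 cbP t0 tT hb.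
  have m3 := NP l n (leq_bigmax l).
  have := mean_leD (mean_leD (mean_leZ (ler0n R 3) m1) m2) (mean_leZ (ler0n R 3) m3).
  apply: mean_leW => [|w|].
  - apply: measurable_funX; apply: measurable_minr => //; apply: measurableT_comp => //.
    under eq_fun do rewrite row_subE.
    by apply: measurable_funB; apply: (adapted_measurable hF (ltW t0)); [exact: aX|apply: aZ; exact: ltW].
  - rewrite sqr_ge0/=; have : (X t w - Z t w) 0 l = r l n w - S id (fun y => c y 0 l) n w + 2^-1 * S (fun r => r ^+ 2) (b_ l) n w.
      by rewrite /r; ring.
    rewrite -/(S (fun r => r ^+ 2) (b_ l) n w).
    rewrite -[\sum_(i < n.+1) (c _ 0 l - _) * dW _ _ _ _ _]/(S id (fun y => c y 0 l) n w).
    move: ((X t w - Z t w) 0 l) (r l n w) (S id (fun y => c y 0 l) n w) (S (fun r => r ^+ 2) (b_ l) n w) => v ra A B vE.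
    (* A remainder larger than 1 truncates to 1, which already dominates the truncated left side. *)
    have [r1|/ltW r1] := leP `|ra| 1.
      apply: (@le_trans _ _ (v ^+ 2)).
        rewrite -(real_normK (num_real v)) lerXn2r ?nnegrE ?le_min ?normr_ge0//=.
        by rewrite ge_min lexx.
      rewrite real_normK ?num_real// vE; have := sqr_ge0 (ra + A); have := sqr_ge0 (A + 2^-1 * B); have := sqr_ge0 (ra - 2^-1 * B); have := sqr_ge0 B; nra.
    apply: (@le_trans _ _ 1).
      by apply: exprn_ile1; rewrite ?le_min ?normr_ge0//= ge_min lexx orbT.
    have := sqr_ge0 A; have := sqr_ge0 B; rewrite expr1n; lra.
  - have -> : 3 * (e / (3 * d.+1%:R)) = e / d.+1%:R by field; rewrite addrC natr1 pnatr_eq0.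
    by rewrite lerD2r le_eqVlt; apply/orP; left; apply/eqP; rewrite /Q; ring.
split=> [|w|]; [exact: mgap|exact: trunc_dist_ge0|].
have [_ _] := mean_le_sum part; move=> /le_trans; apply; rewrite lee_fin.
rewrite big_split/= -mulr_suml -/C sumr_const card_ord mulrDl mul1r -addrA lerD2l.
apply: (@le_trans _ _ e); last by rewrite lerDr.
by rewrite -[leLHS]mulr_natr mulrAC ler_pdivrMr// ler_wpM2l ?(ltW e0)// ler_nat.
Qed.

(** Gronwall's lemma by iteration, in the weight [expR (l * s)] with [l = 2 C]: starting from the
    trivial bound [d], each use of [gap_step] halves the bound, the slack [e] being arbitrary. Time
    integrals are replaced by the sums of [expR_grid_sum], so regularity of the mean gap in time
    never enters. *)
Lemma characteristic_eq_flow t : 0 <= t <= T -> {ae P, forall w, X t w = psi (- W t w) x}.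
Proof.
move=> tT; have [C C0 CP] := gap_step; pose l := 2 * C; have l0 : 0 < l by rewrite mulr_gt0.
have start : {ae P, forall w, X 0 w = Z 0 w}.
  case: hX => _ X0 _; case: hW => _ W0 _ _ _; apply: filterS2 X0 W0 => w -> W0.
  by rewrite /Z W0 oppr0; case: (psiP x) => ->.
have mean k s : 0 <= s <= T -> mean_le P (gap s) (d%:R / 2 ^+ k * expR (l * s)).
  elim: k s => [|k ih] s sT.
    split=> [|w|]; [exact: mgap|exact: trunc_dist_ge0|].
    have /andP[s0 _] := sT.
    apply: (@le_trans _ _ (\int[P]_w (d%:R)%:E)%E).
      by apply: ge0_le_integralW => w; rewrite lee_fin ?trunc_dist_ge0 ?trunc_dist_le.
    rewrite integral_cst//= expr0 divr1 EFinM lee_pmul ?lee_fin//.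
    rewrite (le_trans (probability_le1 P measurableT))// lee_fin -expR0 ler_expR.
    by rewrite mulr_ge0// ltW.
  (* [gap_step] concerns positive times; at time 0 both processes equal [x] almost surely. *)
  have [s0|s0] := leP s 0.
    have -> : s = 0 by apply/eqP; rewrite eq_le s0; case/andP: sT.
    split=> [|w|]; [by apply: mgap; rewrite lexx ltW|exact: trunc_dist_ge0|].
    have -> : (\int[P]_w (gap 0 w)%:E = \int[P]_w 0)%E.
      apply: ge0_ae_eq_integral => //.
      - by apply/measurable_EFinP; apply: mgap; rewrite lexx ltW.
      - by move=> w _; rewrite lee_fin trunc_dist_ge0.
      apply: filterS start => w E _; rewrite /gap E subrr /trunc_dist big1// => i _.
      by rewrite mxE normr0 min_l// expr0n.
    by rewrite integral0 lee_fin mulr_ge0 ?expR_ge0// divr_ge0.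
  split=> [|w|]; [exact: mgap|exact: trunc_dist_ge0|].
  apply/lee_addgt0Pr => e e0; have /andP[_ sT'] := sT.
  have [n nP] := CP s e s0 sT' e0.
  have [|_ _] := nP (fun i => d%:R / 2 ^+ k * expR (l * grid s n i)).
    move=> i ni; apply: ih; rewrite grid_ge0//=.
    by rewrite (le_trans (grid_le s0 (ltnW ni))).
  move=> /le_trans; apply; rewrite -EFinD lee_fin lerD2r -mulr_sumr.
  have := expR_grid_sum n l0 s0; set G := \sum_(i < _) _; set E := expR _ => h.
  have k0 : 0 <= d%:R / 2 ^+ k :> R by rewrite divr_ge0.
  have -> : C * (s / n.+1%:R * (d%:R / 2 ^+ k * G)) = C * (d%:R / 2 ^+ k) * (s / n.+1%:R * G) by ring.
  apply: le_trans (ler_wpM2l _ h) _; first by rewrite mulr_ge0// ltW.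
  rewrite le_eqVlt; apply/orP; left; apply/eqP; rewrite /l exprS; field.
  by rewrite expf_neq0//= gt_eqF.
have int0 : (\int[P]_w (gap t w)%:E = 0)%E.
  apply/eqP; rewrite eq_le integral_ge0 ?andbT; last by move=> w _; rewrite lee_fin trunc_dist_ge0.
  have fin : (\int[P]_w (gap t w)%:E \is a fin_num)%E.
    rewrite ge0_fin_numE; last by apply: integral_ge0 => w _; rewrite lee_fin trunc_dist_ge0.
    by case: (mean 0%N t tT) => _ _ /le_lt_trans; apply; rewrite ltry.
  rewrite -(fineK fin) lee_fin; apply: (@le_add_geometric _ _ _ (d%:R * expR (l * t))) => k.
  by rewrite add0r mulrAC -lee_fin fineK//; case: (mean k t tT).
have [] := (@ae_eq_integral_abs _ _ _ P setT measurableT (EFin \o gap t) _).1.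
- by apply/measurable_EFinP; exact: mgap.
- rewrite -int0; apply: eq_integral => w _ /=.
  by rewrite ger0_norm// trunc_dist_ge0.
move=> N [mN PN NP]; exists N; split=> // w /= nE; apply: NP => /= h; apply: nE.
by have /h[] := I => /trunc_dist_eq0/eqP; rewrite subr_eq0 => /eqP.
Qed.

End flow_identification.

(** * From fixed times and points to the whole flow *)

Section solution_along_flow.
Context {disp : measure_display} {Omega : measurableType disp} {R : realType}.
Variables (P : probability Omega R) (F : R -> set (set Omega)) (W : R -> Omega -> R).
Hypothesis hF : complete_filtration P F.
Hypothesis hW : brownian_motion P F W.
Variables (d : nat) (c : 'rV[R]_d -> 'rV[R]_d) (T L B : R).
Hypothesis hc : torus_Ck_vect 2 c.
Hypothesis T0 : 0 < T.
Hypothesis L0 : 0 < L.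
Hypothesis cL : forall x y, `|c x - c y| <= L * `|x - y|.
Hypothesis cB : forall x, `|c x| <= B.
Variable psi : R -> 'rV[R]_d -> 'rV[R]_d.
Hypothesis psiP : forall y, integral_curve c y (psi^~ y).

Lemma flow_inverse s x : psi s (psi (- s) x) = x.
Proof. by rewrite -(flow_group L0 cL cB psiP) subrr; case: (psiP x). Qed.

Lemma flow_seq_cvg (s : nat -> R) (y : nat -> 'rV[R]_d) s0 y0 :
  s n @[n --> \oo] --> s0 -> y n @[n --> \oo] --> y0 -> psi (s n) (y n) @[n --> \oo] --> psi s0 y0.
Proof.
move=> ss yy; have B0 : 0 <= B by exact: le_trans (cB 0).
have bnd n : `|psi s0 y0 - psi (s n) (y n)| <= B * `|s0 - s n| + (2 * expR (2 * L * (`|s0| + `|s0 - s n|))) * `|y0 - y n|.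
  rewrite -[psi s0 y0](subrK (psi (s n) y0)) -addrA (le_trans (ler_normD _ _))// lerD//.
    exact: (integral_curve_lipschitz cB (psiP y0)).
  have := integral_curve_dist L0 cL cB (psiP y0) (psiP (y n)) (s n).
  move=> /le_trans; apply; rewrite mulrAC ler_wpM2r// ler_wpM2l// ler_expR ler_wpM2l ?mulr_ge0 ?(ltW L0)//.
  by rewrite -{1}[s n](subKr s0) (le_trans (ler_normB _ _)).
have ds : `|s0 - s n| @[n --> \oo] --> (0 : R).
  by rewrite -(normr0 R) -(subrr s0); apply: cvg_norm; apply: cvgB => //; exact: cvg_cst.
apply/(@cvgrPdist_le R 'rV[R]_d) => e e0.
pose K := 2 * expR (2 * L * (`|s0| + 1)); have K0 : 0 < K by rewrite mulr_gt0// expR_gt0.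
have e1 : 0 < e / (2 * (B + 1)) by rewrite divr_gt0// mulr_gt0// ltr_pwDr.
have e2 : 0 < e / (2 * K) by rewrite divr_gt0// mulr_gt0.
move/cvgrPdist_le : ds => ds; move/(@cvgrPdist_le R 'rV[R]_d) : yy => yy.
near=> n; apply: le_trans (bnd n) _.
have h1 : `|s0 - s n| <= e / (2 * (B + 1)).
  by near: n; have := ds _ e1; apply: filterS => k; rewrite sub0r normrN normr_id.
have h2 : `|s0 - s n| <= 1.
  by near: n; have := ds _ (ltr01); apply: filterS => k; rewrite sub0r normrN normr_id.
have h3 : `|y0 - y n| <= e / (2 * K) by near: n; exact: yy.
rewrite [e]splitr lerD//.
  apply: le_trans (ler_wpM2l B0 h1) _.
  have -> : B * (e / (2 * (B + 1))) = e / 2 * (B / (B + 1)) by field; rewrite gt_eqF// ltr_pwDr.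
  by rewrite ler_piMr ?divr_ge0 ?(ltW e0)// ler_pdivrMr ?ltr_pwDr// mul1r lerDl.
apply: le_trans (_ : K * (e / (2 * K)) <= _); last first.
  by rewrite le_eqVlt; apply/orP; left; apply/eqP; field; rewrite gt_eqF.
rewrite ler_pM ?mulr_ge0 ?expR_ge0// ler_wpM2l// ler_expR ler_wpM2l ?lerD2l//.
by rewrite mulr_ge0// ltW.
Unshelve. all: by end_near. Qed.

Definition grid_floor t k : R := grid T k (Num.truncn (k.+1%:R * (t / T))).

Lemma grid_floor_dist t k : 0 <= t -> `|t - grid_floor t k| <= T / k.+1%:R.
Proof.
move=> t0; have tT0 : 0 <= k.+1%:R * (t / T) by rewrite mulr_ge0// divr_ge0// ltW.
have := truncn_itv tT0; rewrite /grid_floor /grid; set m := Num.truncn _ => /andP[m1 m2].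
have -> : t - T * (m%:R / k.+1%:R) = T / k.+1%:R * (k.+1%:R * (t / T) - m%:R).
  by field; rewrite gt_eqF//= addrC natr1 pnatr_eq0.
have Tk : 0 <= T / k.+1%:R by rewrite divr_ge0// ltW.
rewrite normrM (ger0_norm Tk) ler_piMr// ger0_norm ?subr_ge0// lerBlDl.
by rewrite natr1 ltW.
Qed.

Lemma grid_floor_in t k : 0 <= t <= T -> 0 <= grid_floor t k <= T.
Proof.
move=> /andP[t0 tT]; rewrite grid_ge0//=; apply: grid_le => //.
rewrite -(ler_nat R) (@le_trans _ _ (k.+1%:R * (t / T)))//.
  by rewrite truncn_le mulr_ge0// divr_ge0// ltW.
by rewrite ler_piMr// ler_pdivrMr// mul1r.
Qed.

Lemma grid_floor_cvg t : 0 <= t -> grid_floor t k @[k --> \oo] --> t.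
Proof.
move=> t0; apply/cvgrPdist_le => e e0; have [N NP] := inv_nat_small (ltW T0) e0.
by exists N => // k Nk; rewrite (le_trans (grid_floor_dist k t0))// NP.
Qed.

(** The null set in [characteristic_eq_flow] depends on the time and on the starting point. One null
    set covers the countably many grid times and grid points; from there the joint continuity of
    [X], of the flow and of the Brownian path reaches every [(t, y)]. The inverse of [psi (- W t w)]
    is [psi (W t w)]. *)
Lemma characteristic_flow_eq X Y : characteristic_flow P F W c T X Y ->
  {ae P, forall w, forall t y, 0 <= t <= T -> Y t y w = psi (W t w) y}.
Proof.
move=> [hX cX _ XY].
have eqX : {ae P, forall w, forall t y, 0 <= t <= T -> X t y w = psi (- W t w) y}.
  pose Q (z : nat * nat * 'rV[int]_d) w := let t := grid T z.1.1 z.1.2 in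
    let y := \row_i ((z.2 0 i)%:~R / z.1.1.+1%:R) in 0 <= t <= T -> X t y w = psi (- W t w) y.
  have Qae : {ae P, forall w, forall n, if unpickle n is Some z then Q z w else True}.
    apply: ae_foralln => n; case: (unpickle n) => [[[k i] m]|]; last exact: aeW.
    have [iT|niT] := boolP (0 <= grid T k i <= T).
      by have := characteristic_eq_flow hF hW hc psiP T0 (hX (\row_i ((m 0 i)%:~R / k.+1%:R))) iT; apply: filterS => w E; rewrite /Q/= => _.
    by apply: aeW => w; rewrite /Q/= (negbTE niT).
  have [_ _ cW _ _] := hW; apply: filterS3 Qae cX cW => w Qw cXw cWw t y tT.
  have /andP[t0 _] := tT; have tc := grid_floor_cvg t0; have yc := @row_floor_cvg _ _ y.
  have E k : X (grid_floor t k) (row_floor k y) w = psi (- W (grid_floor t k) w) (row_floor k y).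
    pose m : 'rV[int]_d := \row_i Num.floor (k.+1%:R * y 0 i).
    have := Qw (pickle (k, Num.truncn (k.+1%:R * (t / T)), m)); rewrite pickleK /Q/=.
    have -> : \row_i ((m 0 i)%:~R / k.+1%:R) = row_floor k y by apply/rowP => i; rewrite !mxE.
    by apply; exact: grid_floor_in.
  have lX : X (grid_floor t k) (row_floor k y) w @[k --> \oo] --> X t y w.
    apply: (@within_seq_cvg (R * 'rV[R]_d)%type 'rV[R]_d (fun tx => X tx.1 tx.2 w) (`[0, T]%classic `*` setT)
      (t, y) (fun k => (grid_floor t k, row_floor k y)) cXw).
    - by split=> //=; rewrite in_itv.
    - by move=> n; split=> //=; rewrite in_itv/= grid_floor_in.
    - move=> A [[A1 A2] /= [tA1 yA2] A12]; have h1 := tc _ tA1; have h2 := yc _ yA2.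
      rewrite /nbhs/= /nbhs/= in h1 h2 *; move: h1 h2; apply: filterS2 => k h1 h2.
      exact: A12.
  have lW : W (grid_floor t k) w @[k --> \oo] --> W t w.
    apply: (within_seq_cvg cWw) tc; first by rewrite /= in_itv/= t0.
    by move=> n; rewrite /= in_itv/=; have /andP[-> _] := grid_floor_in n tT.
  have lpsi := flow_seq_cvg (cvgN lW) yc.
  move: lX; under eq_fun do rewrite E; move=> lX.
  exact: (@norm_cvg_unique R 'rV[R]_d _ _ _ _ lX (lpsi _)).
apply: filterS2 eqX XY => w Xw XYw t y tT; have [_ YX] := XYw t tT.
by rewrite -[in RHS](YX y) Xw// flow_inverse.
Qed.

Lemma solution_along_flow u0 u : transport_solution P F W c T u0 u ->
  {ae P, forall w, forall t y, 0 <= t <= T -> u t y w = u0 (psi (W t w) y)}.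
Proof.
move=> [X [Y [XY uE]]]; apply: filterS2 (characteristic_flow_eq XY) uE => w Yw uw t y tT.
by have [_ ->] := uw t tT; rewrite Yw.
Qed.

End solution_along_flow.

(** * Finite-dimensional subspaces of L^2 *)

Section square_integrable.
Context {disp : measure_display} {S : measurableType disp} {R : realType}.
Variable mu : {measure set S -> \bar R}.
Notation L2 := (Lfun mu 2%:E).
Implicit Types f g h : S -> R.

Lemma Lfun2P f : f \in L2 <-> measurable_fun setT f /\ mu.-integrable setT (EFin \o (fun x => f x ^+ 2)).
Proof.
split=> [f2|[mf if2]].
  by split; [by move: f2; rewrite inE => /andP[+ _]; rewrite inE|exact: Lfun2_integrable_sqr].
rewrite inE; apply/andP; split; rewrite inE//= /finite_norm unlock poweR_lty//.
have [_ + ] := integrableP _ _ _ if2; apply: le_lt_trans.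
rewrite le_eqVlt; apply/orP; left; apply/eqP; apply: eq_integral => x _ /=.
by rewrite powR_mulrn// -normrX.
Qed.

Lemma Lfun2_measurable f : f \in L2 -> measurable_fun setT f.
Proof. by move=> /Lfun2P[]. Qed.

Lemma integrable_inner f g : f \in L2 -> g \in L2 -> mu.-integrable setT (EFin \o (fun x => f x * g x)).
Proof. by move=> f2 g2; exact/Lfun1_integrable/Lfun2_mul_Lfun1. Qed.

Lemma integrable_add f g : mu.-integrable setT (EFin \o f) -> mu.-integrable setT (EFin \o g) ->
  mu.-integrable setT (EFin \o (fun x => f x + g x)).
Proof. by move=> fi gi; have := integrableD measurableT fi gi; apply: eq_integrable. Qed.

Lemma Lfun2_lin (a : R) f g : f \in L2 -> g \in L2 -> (fun x => a * f x + g x) \in L2.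
Proof.
move=> f2 g2; have mf := Lfun2_measurable f2; have mg := Lfun2_measurable g2; apply/Lfun2P; split.
  by apply: measurable_funD => //; exact: measurable_funM.
have -> : (fun x => (a * f x + g x) ^+ 2) = (fun x => a ^+ 2 * (f x * f x) + ((2 * a) * (f x * g x) + g x * g x)).
  by apply/funext => x; ring.
apply: integrable_add; first by apply: integrable_scale; exact: integrable_inner.
apply: integrable_add; last exact: integrable_inner.
by apply: integrable_scale; exact: integrable_inner.
Qed.

Lemma Lfun2_cst0 : (cst 0 : S -> R) \in L2.
Proof.
apply/Lfun2P; split; first exact: measurable_cst.
rewrite (_ : _ \o _ = cst 0%E); first exact: integrable0.
by apply/funext => x /=; rewrite expr0n.
Qed.

Lemma Lfun2_sum m (a : nat -> R) (e : nat -> S -> R) : (forall i, (i < m)%N -> e i \in L2) ->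
  (fun x => \sum_(i < m) a i * e i x) \in L2.
Proof.
elim: m => [|m ih] em; first by under eq_fun do rewrite big_ord0; exact: Lfun2_cst0.
under eq_fun do rewrite big_ord_recr/= addrC.
by apply: Lfun2_lin; [exact: em|apply: ih => i im; apply: em; exact: ltnW].
Qed.

Lemma Lfun2_sub f g : f \in L2 -> g \in L2 -> f \- g \in L2.
Proof.
move=> f2 g2; have := Lfun2_lin (-1) g2 f2; congr (_ \in L2).
by apply/funext => x /=; rewrite mulN1r addrC.
Qed.

Lemma L2_innerC f g : L2_inner mu f g = L2_inner mu g f.
Proof. by apply: eq_Rintegral => x _; rewrite mulrC. Qed.

Lemma L2_inner_lin (a : R) f g h : f \in L2 -> g \in L2 -> h \in L2 ->
  L2_inner mu (fun x => a * f x + g x) h = a * L2_inner mu f h + L2_inner mu g h.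
Proof.
move=> f2 g2 h2; have ifh := integrable_inner f2 h2; have igh := integrable_inner g2 h2.
rewrite /L2_inner -(RintegralZl a measurableT ifh) -RintegralD//; last exact: integrable_scale.
by apply: eq_Rintegral => x _; ring.
Qed.

Lemma L2_inner_sub f g h : f \in L2 -> g \in L2 -> h \in L2 ->
  L2_inner mu (f \- g) h = L2_inner mu f h - L2_inner mu g h.
Proof.
move=> f2 g2 h2; have := L2_inner_lin (-1) g2 f2 h2; rewrite mulN1r addrC => <-.
by congr L2_inner; apply/funext => x /=; rewrite mulN1r addrC.
Qed.

Lemma L2_inner_sum m (a : nat -> R) (e : nat -> S -> R) h : (forall i, (i < m)%N -> e i \in L2) ->
  h \in L2 -> L2_inner mu (fun x => \sum_(i < m) a i * e i x) h = \sum_(i < m) a i * L2_inner mu (e i) h.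
Proof.
move=> em h2; elim: m em => [|m ih] em.
  by rewrite big_ord0 /L2_inner; under eq_Rintegral do rewrite big_ord0 mul0r; rewrite Rintegral_cst// mul0r.
have em' i : (i < m)%N -> e i \in L2 by move=> im; apply: em; exact: ltnW.
rewrite big_ord_recr/= addrC -(ih em') -L2_inner_lin//; last 2 first.
- exact: em.
- exact: Lfun2_sum.
by congr L2_inner; apply/funext => x; rewrite big_ord_recr/= addrC.
Qed.

Lemma L2_inner_ae f g h : f \in L2 -> g \in L2 -> h \in L2 -> f = g %[ae mu] ->
  L2_inner mu f h = L2_inner mu g h.
Proof.
move=> /Lfun2_measurable mf /Lfun2_measurable mg /Lfun2_measurable mh fg; rewrite /L2_inner /Rintegral; congr fine.
apply: ae_eq_integral => //.
- by apply/measurable_EFinP; exact: measurable_funM.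
- by apply/measurable_EFinP; exact: measurable_funM.
- by apply: filterS fg => x fgx _; rewrite /= fgx.
Qed.

Lemma L2_inner_sqr_ge0 f : 0 <= L2_inner mu f f.
Proof. by apply: Rintegral_ge0 => x _; rewrite -expr2 sqr_ge0. Qed.

Lemma L2_inner_sqrE f : f \in L2 -> (\int[mu]_x (f x ^+ 2)%:E = (L2_inner mu f f)%:E)%E.
Proof.
move=> f2; rewrite /L2_inner /Rintegral fineK; last exact: integrable_fin_num (integrable_inner f2 f2).
by apply: eq_integral => x _; rewrite expr2.
Qed.

Lemma L2_inner_eq0 f : f \in L2 -> L2_inner mu f f = 0 -> f = cst 0 %[ae mu].
Proof.
move=> f2 f0; have mf := Lfun2_measurable f2.
have mf2 : measurable_fun setT (EFin \o (fun x => f x ^+ 2)) by apply/measurable_EFinP; exact: measurable_funX.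
have int0 : (\int[mu]_x `|(EFin \o (fun x => (f x ^+ 2)%R)) x| = 0)%E.
  rewrite -[RHS](_ : (L2_inner mu f f)%:E = 0)%E; last by rewrite f0.
  rewrite -L2_inner_sqrE//; apply: eq_integral => x _ /=.
  by rewrite ger0_norm// sqr_ge0.
have := (ae_eq_integral_abs mu measurableT mf2).1 int0; apply: filterS => x /(_ I) [/eqP].
by rewrite sqrf_eq0 => /eqP fx _.
Qed.

Definition orthonormal_family (e : nat -> S -> R) m := (forall i, (i < m)%N -> e i \in L2) /\
  forall i j, (i < m)%N -> (j < m)%N -> L2_inner mu (e i) (e j) = (i == j)%:R.

(** Closed under equality almost everywhere, as [L2_subspace] requires. Membership in L^2 is imposed
    separately, since changing a function on a null set may destroy its measurability. *)
Definition L2_span (e : nat -> S -> R) m : set (S -> R) := [set g | g \in L2 /\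
  exists a : nat -> R, g = (fun x => \sum_(i < m) a i * e i x) %[ae mu]].

Lemma L2_span_comb e m (a : nat -> R) : orthonormal_family e m -> L2_span e m (fun x => \sum_(i < m) a i * e i x).
Proof. by move=> [e2 _]; split; [exact: Lfun2_sum|exists a; exact: aeW]. Qed.

Lemma inner_comb e m (a : nat -> R) i : orthonormal_family e m -> (i < m)%N ->
  L2_inner mu (fun x => \sum_(j < m) a j * e j x) (e i) = a i.
Proof.
move=> [e2 eo] im; rewrite L2_inner_sum//; last exact: e2.
rewrite (bigD1 (Ordinal im))//= eo// eqxx mulr1 big1 ?addr0// => j ji.
by rewrite eo// (_ : (j == i :> nat) = false) ?mulr0//; apply/negbTE; exact: ji.
Qed.

Lemma L2_span_subspace e m : orthonormal_family e m -> L2_subspace mu (L2_span e m).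
Proof.
move=> eo; split.
- by move=> f [].
- split; first exact: Lfun2_cst0.
  by exists (fun=> 0); apply: aeW => x; rewrite big1// => i _; rewrite mul0r.
- move=> b f g [f2 [a fa]] [g2 [a' ga]]; split; first exact: Lfun2_lin.
  exists (fun i => b * a i + a' i); apply: filterS2 fa ga => x /(_ I) fx /(_ I) gx _ /=.
  by rewrite fx gx /GRing.scale/= mulr_sumr -big_split/=; apply: eq_bigr => i _; rewrite mulrDl mulrA.
- move=> f g [f2 [a fa]] g2 fg; split=> //; exists a.
  by apply: filterS2 fa fg => x /(_ I) fx /(_ I) <-.
Qed.

Lemma L2_span_dim e m : orthonormal_family e m -> L2_dim mu (L2_span e m) m.
Proof.
move=> eo; have [e2 _] := eo; exists (fun i : 'I_m => e i); split.
- move=> i; split; first exact: e2.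
  exists (fun j => (j == i :> nat)%:R); apply: aeW => x.
  rewrite (bigD1 i)//= eqxx mul1r big1 ?addr0// => j ji.
  by rewrite (_ : (j == i :> nat) = false) ?mul0r//; exact: negbTE.
- move=> a a0 i; pose b j := if insub j is Some k then a k else 0 : R.
  have b0 : (fun x => \sum_(j < m) b j * e j x) = cst 0 %[ae mu].
    apply: filterS a0 => x a0x Ix; rewrite -(a0x Ix).
    by apply: eq_bigr => j _; rewrite /b valK.
  have := inner_comb b eo (ltn_ord i); rewrite {2}/b valK => <-.
  rewrite (L2_inner_ae _ Lfun2_cst0 _ b0); [|exact: Lfun2_sum|exact: e2].
  by rewrite /L2_inner; under eq_Rintegral do rewrite mul0r; rewrite Rintegral_cst// mul0r.
- by move=> f [_ [a fa]]; exists (fun i => a i).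
Qed.

Lemma orthogonal_span e m f : orthonormal_family e m -> f \in L2 ->
  (forall i, (i < m)%N -> L2_inner mu f (e i) = 0) -> forall v, L2_span e m v -> L2_inner mu f v = 0.
Proof.
move=> eo f2 fe v [v2 [a va]]; have [e2 _] := eo.
rewrite L2_innerC (L2_inner_ae v2 _ f2 va); last exact: Lfun2_sum.
by rewrite L2_inner_sum// big1// => i _; rewrite L2_innerC fe ?mulr0.
Qed.

(** [L2_proj] is a choice among the elements of the space with orthogonal residual. The sum of the
    Fourier coefficients shows that there is one, so the chosen function has the property. *)
Lemma L2_proj_spec e m f : orthonormal_family e m -> f \in L2 ->
  L2_span e m (L2_proj mu (L2_span e m) f) /\
  forall v, L2_span e m v -> L2_inner mu (f \- L2_proj mu (L2_span e m) f) v = 0.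
Proof.
move=> eo f2; have [e2 _] := eo.
apply: (@xgetPex _ (cst 0) [set g | L2_span e m g /\ forall v, L2_span e m v -> L2_inner mu (f \- g) v = 0]).
pose a i := L2_inner mu f (e i).
exists (fun x => \sum_(i < m) a i * e i x); split; first exact: L2_span_comb.
have g2 : (fun x => \sum_(i < m) a i * e i x) \in L2 by exact: Lfun2_sum.
apply: orthogonal_span => // [|i im]; first exact: Lfun2_sub.
by rewrite L2_inner_sub ?e2// inner_comb// subrr.
Qed.

(** Pythagoras: the residual of the projection is orthogonal to [g \- v], which lies in the
    space. *)
Lemma L2_proj_min e m f v : orthonormal_family e m -> f \in L2 -> L2_span e m v ->
  (\int[mu]_x ((L2_proj mu (L2_span e m) f x - f x) ^+ 2)%:E <= \int[mu]_x ((v x - f x) ^+ 2)%:E)%E.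
Proof.
move=> eo f2 vV; have [gV gO] := L2_proj_spec eo f2; set g := L2_proj _ _ _ in gV gO *.
have [_ _ lin _] := L2_span_subspace eo.
have v2 := vV.1; have g2 := gV.1.
have D2 := Lfun2_sub f2 g2; have E2 := Lfun2_sub g2 v2.
have gvV : L2_span e m (g \- v).
  have := lin (-1) v g vV gV; congr (L2_span e m _).
  by apply/funext => x /=; rewrite [_ *: _]mulN1r addrC.
have cross := gO _ gvV.
have -> : (\int[mu]_x ((g x - f x) ^+ 2)%:E = \int[mu]_x ((f \- g) x ^+ 2)%:E)%E.
  by apply: eq_integral => x _ /=; rewrite -sqrrN opprB.
have -> : (\int[mu]_x ((v x - f x) ^+ 2)%:E = \int[mu]_x ((f \- v) x ^+ 2)%:E)%E.
  by apply: eq_integral => x _ /=; rewrite -sqrrN opprB.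
have fv2 := Lfun2_sub f2 v2; rewrite !L2_inner_sqrE// lee_fin.
have fvE : f \- v = (fun x => 1 * (f \- g) x + (g \- v) x) by apply/funext => x /=; ring.
have -> : L2_inner mu (f \- v) (f \- v) = L2_inner mu (f \- g) (f \- g) + L2_inner mu (g \- v) (g \- v).
  rewrite {1}fvE L2_inner_lin// ![L2_inner mu _ (f \- v)]L2_innerC fvE !L2_inner_lin//.
  by rewrite [L2_inner mu (g \- v) (f \- g)]L2_innerC cross; ring.
by rewrite lerDl L2_inner_sqr_ge0.
Qed.

(** A vector whose residual has norm 0 adds nothing to the family, whence [m <= n] instead of
    equality. The functions to be spanned are not known to be independent. *)
Lemma gram_schmidt (v : nat -> S -> R) n : (forall j, (j < n)%N -> v j \in L2) ->
  exists m e, [/\ (m <= n)%N, orthonormal_family e m & forall j, (j < n)%N -> L2_span e m (v j)].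
Proof.
elim: n => [|n ih] vn; first by exists 0%N, (fun _ _ => 0); split.
have [m [e [mn eo ev]]] := ih (fun j jn => vn j (ltnW jn)); have [e2 eO] := eo.
pose a i := L2_inner mu (v n) (e i); pose g x := \sum_(i < m) a i * e i x.
have g2 : g \in L2 by exact: Lfun2_sum.
have vn2 := vn n (ltnSn n); pose r := v n \- g; have r2 : r \in L2 by exact: Lfun2_sub.
have rO i : (i < m)%N -> L2_inner mu r (e i) = 0.
  by move=> im; rewrite /r L2_inner_sub ?e2// inner_comb// subrr.
have [r0|r0] := eqVneq (L2_inner mu r r) 0.
  exists m, e; split => // [|j]; first exact: leqW.
  rewrite ltnS leq_eqVlt => /predU1P[->|]; last exact: ev.
  split=> //; exists a; apply: filterS (L2_inner_eq0 r2 r0) => x /(_ I)/= /eqP.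
  by rewrite subr_eq0 => /eqP.
have N0 : 0 < L2_inner mu r r by rewrite lt0r r0 L2_inner_sqr_ge0.
pose N := Num.sqrt (L2_inner mu r r); have N00 : 0 < N by rewrite sqrtr_gt0.
pose em x := N^-1 * r x; pose e' i := if i == m then em else e i.
have em2 : em \in L2.
  have := Lfun2_lin N^-1 r2 Lfun2_cst0; congr (_ \in L2).
  by apply/funext => x; rewrite /= addr0.
have emE h : h \in L2 -> L2_inner mu em h = N^-1 * L2_inner mu r h.
  move=> h2; rewrite /L2_inner -(RintegralZl _ measurableT (integrable_inner r2 h2)).
  by apply: eq_Rintegral => x _; rewrite /em mulrA.
have e'm : e' m = em by rewrite /e' eqxx.
have e'i i : (i < m)%N -> e' i = e i by move=> im; rewrite /e' ltn_eqF.
have emm : L2_inner mu em em = 1.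
  rewrite emE// L2_innerC emE// mulrA -invfM -expr2 sqr_sqrtr ?(ltW N0)//.
  by rewrite mulVf.
have eo' : orthonormal_family e' m.+1.
  split=> [i|i j]; rewrite ltnS leq_eqVlt => /predU1P[->|im].
  - by rewrite e'm.
  - by rewrite e'i// e2.
  - rewrite ltnS leq_eqVlt => /predU1P[->|jm]; first by rewrite e'm eqxx.
    by rewrite e'm e'i// emE ?e2// rO// mulr0 gtn_eqF.
  - rewrite ltnS leq_eqVlt => /predU1P[->|jm]; last by rewrite !e'i// eO.
    by rewrite e'm e'i// L2_innerC emE ?e2// rO// mulr0 ltn_eqF.
exists m.+1, e'; split=> // j; rewrite ltnS leq_eqVlt => /predU1P[->|jn].
  split=> //; exists (fun i => if i == m then N else a i); apply: aeW => x.
  rewrite big_ord_recr/= eqxx e'm /em mulrA mulfV ?gt_eqF// mul1r /r/=.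
  rewrite (_ : \sum_(i < m) _ = g x); first by rewrite addrC subrK.
  by apply: eq_bigr => i _; rewrite ltn_eqF ?ltn_ord// e'i.
have [v2 [b vb]] := ev j jn; split=> //; exists (fun i => if i == m then 0 else b i).
apply: filterS vb => x /(_ I) -> _; rewrite big_ord_recr/= eqxx mul0r addr0.
by apply: eq_bigr => i _; rewrite ltn_eqF ?ltn_ord// e'i.
Qed.

End square_integrable.

(** * Integration in time *)

Section liminf.
Context {R : realType}.
Local Open Scope ereal_scope.

Lemma le_limn_einf (u v : (\bar R)^nat) : (forall n, u n <= v n) -> limn_einf u <= limn_einf v.
Proof.
move=> uv; rewrite !limn_einf_lim; apply: lee_lim; [exact: is_cvg_einfs|exact: is_cvg_einfs|].
apply: nearW => n; apply: le_ereal_inf_tmp => _ [k /= nk <-].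
by apply: le_trans (uv k); apply: ereal_inf_lbound; exists k.
Qed.

Lemma limn_einf_le (u : (\bar R)^nat) l : (forall n, u n <= l) -> limn_einf u <= l.
Proof.
move=> ul; rewrite -[l](_ : limn_einf (fun=> l) = l); first exact: le_limn_einf.
by have [-> _] := @cvg_limn_einf_sup R (fun=> l) l (cvg_cst l).
Qed.

Lemma cvg_le_limn_einf (u v : (\bar R)^nat) l : u n @[n --> \oo] --> l -> (forall n, u n <= v n) -> l <= limn_einf v.
Proof. by move=> /cvg_limn_einf_sup[<- _]; exact: le_limn_einf. Qed.

Lemma measurable_limn_einf d (S : measurableType d) (f : (S -> \bar R)^nat) :
  (forall n, measurable_fun setT (f n)) -> measurable_fun setT (fun x => limn_einf (f ^~ x)).
Proof.
move=> mf; rewrite /limn_einf; apply: measurableT_comp => //.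
apply: (measurable_fun_limn_esup (f := fun n x => - f n x)) => n.
exact: measurableT_comp.
Qed.

End liminf.

Lemma mrestr_setC d (S : measurableType d) (R : realType) (mu : {measure set S -> \bar R})
  (D : set S) (mD : measurable D) : mrestr mu mD (~` D) = 0%E.
Proof. by rewrite /mrestr setICl measure0. Qed.

Section time_integral.
Context {disp : measure_display} {Omega : measurableType disp} {R : realType}.
Variables (P : probability Omega R) (F : R -> set (set Omega)) (W : R -> Omega -> R).
Hypothesis hF : complete_filtration P F.
Hypothesis hW : brownian_motion P F W.
Variable T : R.
Hypothesis T0 : 0 < T.

Lemma bm_moment t m : 0 <= t -> (0 < m)%N ->
  mean_le P (fun w => W t w ^+ (2 * m)) ((4 * m%:R) ^+ m * (3 / 2) * t ^+ m).
Proof.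
move=> t0 m0; have [_ W0 _ _ _] := hW.
have mWt : measurable_fun setT (fun w => W t w ^+ (2 * m)).
  by apply: measurable_funX; exact: (bm_measurable hF hW).
have even (r : R) : 0 <= r ^+ (2 * m) by rewrite exprM exprn_ge0// sqr_ge0.
split=> //; have [t00|] := leP t 0.
  have tE : t = 0 by apply/eqP; rewrite eq_le t00.
  have -> : (\int[P]_w (W t w ^+ (2 * m))%:E = \int[P]_w 0)%E.
    apply: ge0_ae_eq_integral => //.
    - exact/measurable_EFinP.
    - by move=> w _; rewrite lee_fin.
    - by apply: filterS W0 => w W0 _; rewrite tE W0 expr0n muln_eq0/= eqn0Ngt m0.
  by rewrite integral0 lee_fin !mulr_ge0// ?invr_ge0// exprn_ge0// mulr_ge0.
move=> tpos; have [_ _] := bm_increment_moment hF hW (lexx 0) tpos m0; rewrite subr0.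
apply: le_trans; rewrite le_eqVlt; apply/orP; left; apply/eqP.
have m2 : measurable_fun setT (fun w => (W t w - W 0 w) ^+ (2 * m)).
  by apply: measurable_funX; apply: measurable_funB; exact: (bm_measurable hF hW).
apply: ge0_ae_eq_integral => //.
- exact/measurable_EFinP.
- exact/measurable_EFinP.
- by move=> w _; rewrite lee_fin.
- by move=> w _; rewrite lee_fin.
- by apply: filterS W0 => w W0 _; rewrite W0 subr0.
Qed.

Notation nu := (mrestr (@lebesgue_measure R) (measurable_itv `[0, T])).

(** Interchanging the integrals directly would ask for measurability in time and chance jointly.
    Instead [phi (W t w)] is a limit of step functions in time along each continuous path; their
    time integrals are at most finite sums of random variables, whose means are bounded term by
    term. Fatou's lemma is applied in time and then on [Omega]. *)
Lemma mean_time_integral (phi : R -> R) (b : R) (f : R -> Omega -> \bar R) : continuous phi -> (forall r, 0 <= phi r) ->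
  (forall t, 0 <= t <= T -> mean_le P (fun w => phi (W t w)) b) ->
  (forall t w, 0 <= f t w)%E ->
  {ae P, forall w, forall t, 0 <= t <= T -> (f t w <= (phi (W t w))%:E)%E} ->
  (\int[P]_w \int[nu]_t f t w <= (2 * T * b)%:E)%E.
Proof.
move=> cphi phi0 mphi f0 fphi.
(* The cells are half-open and there are [n + 2] of them, so that [t = T] belongs to one. This is
   the origin of the factor 2, a bound for [(n + 2) / (n + 1)]. *)
pose A n (i : nat) : set R := `[grid T n i, grid T n i.+1[%classic.
pose s n w t : \bar R := (\sum_(i < n.+2) (phi (W (grid T n i) w) * \1_(A n i) t)%:E)%E.
pose r n w : R := \sum_(i < n.+2) phi (W (grid T n i) w) * (T / n.+1%:R).
have gT n (i : 'I_n.+2) : 0 <= grid T n i <= T.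
  by rewrite grid_ge0//= grid_le// -ltnS.
have mr n : mean_le P (r n) (2 * T * b).
  have mi (i : 'I_n.+2) : mean_le P (fun w => T / n.+1%:R * phi (W (grid T n i) w)) (T / n.+1%:R * b).
    by apply: mean_leZ; [rewrite divr_ge0// ltW|exact: mphi].
  have [mS S0 Sb] := mean_le_sum mi.
  have b0 : 0 <= b.
    have zT : 0 <= (0 : R) <= T by rewrite lexx ltW.
    have [_ g0 gb] := mphi 0 zT.
    rewrite -lee_fin; apply: le_trans gb; apply: integral_ge0 => w _; by rewrite lee_fin.
  have rE : r n = (fun w => \sum_(i < n.+2) T / n.+1%:R * phi (W (grid T n i) w)).
    by apply/funext => w; apply: eq_bigr => i _; rewrite mulrC.
  rewrite rE; split=> //; apply: le_trans Sb _; rewrite lee_fin sumr_const card_ord -[leLHS]mulr_natr.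
  rewrite mulrAC ler_wpM2r// mulrAC ler_pdivrMr// [leRHS]mulrAC [leRHS]mulrC.
  by rewrite ler_wpM2l ?(ltW T0)// -natrM ler_nat mul2n -addnn addSnnS leq_addl.
have mA n i : measurable (A n i : set (measurableTypeR R)) by exact: measurable_itv.
have mI n i : measurable_fun setT (\1_(A n i) : measurableTypeR R -> R) by exact: measurable_indic.
have leb_A n i : (lebesgue_measure (A n i) = (T / n.+1%:R)%:E)%E.
  by rewrite lebesgue_measure_itv/= lte_fin grid_lt// -EFinB grid_step.
have int_s n w : (\int[nu]_t s n w t <= (r n w)%:E)%E.
  rewrite /s ge0_integral_sum//; last 2 first.
  - by move=> i; apply/measurable_EFinP; exact: measurable_funM.
  - by move=> i t _; rewrite lee_fin mulr_ge0.
  rewrite /r -sumEFin; apply: lee_sum => i _.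
  under eq_integral do rewrite EFinM.
  rewrite ge0_integralZl//; last 2 first.
  - by apply/measurable_EFinP.
  - by rewrite lee_fin.
  rewrite EFinM lee_wpmul2l ?lee_fin// (integral_indic _ measurableT (mA n i)) setIT -(leb_A n i).
  rewrite /mrestr; apply: le_measure; rewrite ?inE//; exact: measurableI.
have key w : {within `[0, +oo[, continuous (fun t => W t w)} ->
    (forall t, 0 <= t <= T -> (f t w <= (phi (W t w))%:E)%E) ->
    (\int[nu]_t f t w <= limn_einf (fun n => (r n w)%:E))%E.
  move=> cW fw; apply: (@le_trans _ _ (\int[nu]_t limn_einf (fun n => s n w t))%E).
    apply: ae_ge0_le_integralW => //.
    - move=> t; apply: (@cvg_le_limn_einf R (fun=> 0%E) _ 0%E); first exact: cvg_cst.
      by move=> n; apply: sume_ge0 => i _; rewrite lee_fin mulr_ge0.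
    - apply: measurable_limn_einf => n; apply: emeasurable_sum => i.
      by apply/measurable_EFinP; exact: measurable_funM.
    exists (~` `[0, T]%classic); split.
    - by apply: measurableC; exact: measurable_itv.
    - exact: mrestr_setC.
    move=> t /=; apply: contra_not; rewrite in_itv/= => tT; have /andP[t0 tT'] := tT.
    apply: le_trans (fw t tT) _.
    apply: (@cvg_le_limn_einf R (fun n => (phi (W (grid_floor T t n) w))%:E)).
      apply: cvg_EFin; first by near=> n.
      apply: (@cvg_comp _ _ _ (fun n => W (grid_floor T t n) w) phi); last exact: cphi.
      apply: (within_seq_cvg cW) (grid_floor_cvg T0 t0); first by rewrite /= in_itv/= t0.
      by move=> n; rewrite /= in_itv/=; have /andP[-> _] := grid_floor_in T0 n tT.
    move=> n; pose i := Num.truncn (n.+1%:R * (t / T)).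
    have ni : (i < n.+2)%N.
      have /andP[_] := grid_floor_in T0 n tT; rewrite /grid_floor -/i ltnS -{2}(grid_end T n).
      by rewrite /grid ler_pM2l// ler_pM2r ?invr_gt0// ler_nat.
    rewrite /s (bigD1 (Ordinal ni))//= (_ : \1_(A n i) t = 1).
      by rewrite mulr1 leeDl// sume_ge0// => j _; rewrite lee_fin mulr_ge0.
    rewrite indicE mem_set// /A /= in_itv/= /grid.
    have tn0 : 0 <= n.+1%:R * (t / T) by rewrite mulr_ge0// divr_ge0// ltW.
    have /andP[i1 i2] := truncn_itv tn0; rewrite -/i in i1 i2.
    have gridE (x : R) : T * (n.+1%:R * (x / T) / n.+1%:R) = x.
      by rewrite [n.+1%:R * _]mulrC mulfK ?pnatr_eq0// mulrC divfK ?gt_eqF.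
    rewrite -[X in _ <= X]gridE -[X in X < _]gridE.
    by rewrite ler_pM2l// ltr_pM2l// ler_pM2r ?invr_gt0// ltr_pM2r ?invr_gt0// i1.
  apply: le_trans (fatou _ _ _ _) _ => //.
  - move=> n; apply: emeasurable_sum => i.
    by apply/measurable_EFinP; exact: measurable_funM.
  - by move=> n t _; apply: sume_ge0 => i _; rewrite lee_fin mulr_ge0.
  by apply: le_limn_einf => n; exact: int_s.
have mrn n : measurable_fun setT (fun w => (r n w)%:E) by apply/measurable_EFinP; case: (mr n).
have rn0 n w : (0 <= (r n w)%:E)%E by rewrite lee_fin; case: (mr n).
apply: (@le_trans _ _ (\int[P]_w limn_einf (fun n => (r n w)%:E))%E).
  apply: ae_ge0_le_integralW.
  - by move=> w; apply: integral_ge0.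
  - by move=> w; apply: (@cvg_le_limn_einf R (fun=> 0%E) _ 0%E); [exact: cvg_cst|move=> n].
  - exact: measurable_limn_einf.
  - by have [_ _ cW _ _] := hW; apply: filterS2 cW fphi => w; exact: key.
apply: le_trans (fatou _ _ _ _) _ => //.
by apply: limn_einf_le => n; case: (mr n).
Unshelve. all: by end_near. Qed.

End time_integral.

Section L2_norms.
Context {disp : measure_display} {Omega : measurableType disp} {R : realType}.
Variable P : probability Omega R.

Lemma Lnorm2_sqr d (S : measurableType d) (mu : {measure set S -> \bar R}) (f : S -> \bar R) :
  (forall x, 0 <= f x)%E -> (Lnorm mu 2%:E f `^ 2 = \int[mu]_x (f x `^ 2))%E.
Proof.
move=> f0; rewrite poweR_Lnorm//; apply: eq_integral => x _.
by rewrite gee0_abs.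
Qed.

Lemma poweR2_le (x : \bar R) (a : R) : (0 <= x)%E -> 0 <= a -> (x `^ 2 <= (a ^+ 2)%:E -> x <= a%:E)%E.
Proof.
move=> x0 a0 h; have sq (y : \bar R) : (0 <= y -> y = (y `^ 2) `^ 2^-1)%E.
  by move=> y0; rewrite -poweRrM mulfV// poweRe1.
rewrite (sq x)// (sq a%:E)//; apply: gt0_ler_poweR => //.
- by rewrite in_itv/= poweR_ge0 leey.
- by rewrite in_itv/= lee_fin powR_ge0 leey.
- by rewrite poweR_EFin powR_mulrn.
Qed.

Lemma L2_norm3_le d' (S : measurableType d') (mu : {measure set S -> \bar R}) (T a : R)
    (v : R -> Omega -> S -> R) : 0 <= a ->
  (\int[P]_w \int[mrestr lebesgue_measure (measurable_itv `[0%R, T])]_t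
     \int[mu]_y ((v t w y) ^+ 2)%:E <= (a ^+ 2)%:E)%E ->
  (L2_norm3 P mu T v <= a%:E)%E.
Proof.
move=> a0 h; apply: poweR2_le => //; first exact: Lnorm_ge0.
rewrite /L2_norm3 Lnorm2_sqr => [|w]; last exact: Lnorm_ge0.
apply: le_trans h; rewrite le_eqVlt; apply/orP; left; apply/eqP.
apply: eq_integral => w _; rewrite Lnorm2_sqr => [|t]; last exact: Lnorm_ge0.
apply: eq_integral => t _.
rewrite poweR_Lnorm//; apply: eq_integral => y _ /=.
by rewrite powR_mulrn// real_normK ?num_real.
Qed.

Lemma L2_subspace_sum d' (S : measurableType d') (mu : {measure set S -> \bar R}) (V : set (S -> R))
    m (a : nat -> R) (v : nat -> S -> R) : L2_subspace mu V -> (forall i, (i < m)%N -> V (v i)) ->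
  V (fun y => \sum_(i < m) a i * v i y).
Proof.
move=> [_ V0 lin _]; elim: m => [|m ih] Vv.
  by under eq_fun do rewrite big_ord0.
under eq_fun do rewrite big_ord_recr/= addrC.
by apply: (lin (a m) (v m)); [exact: Vv|apply: ih => i im; apply: Vv; exact: ltnW].
Qed.

End L2_norms.

Section flow_functions.
Context {R : realType} {d : nat}.
Variables (c : 'rV[R]_d -> 'rV[R]_d) (L B : R).
Hypothesis L0 : 0 < L.
Hypothesis cL : forall x y, `|c x - c y| <= L * `|x - y|.
Hypothesis cB : forall x, `|c x| <= B.
Variable psi : R -> 'rV[R]_d -> 'rV[R]_d.
Hypothesis psiP : forall y, integral_curve c y (psi^~ y).

Lemma flow_continuous s : continuous (psi s).
Proof.
apply: (@dist_le_continuous R 'rV[R]_d 'rV[R]_d (psi s) (2 * expR (2 * L * `|s|))) => x y.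
by rewrite mulrAC; exact: (integral_curve_dist L0 cL cB (psiP x) (psiP y)).
Qed.

Lemma Lfun2_bounded d' (S : measurableType d') (mu : {finite_measure set S -> \bar R}) (f : S -> R) (K : R) :
  measurable_fun setT f -> (forall y, `|f y| <= K) -> f \in Lfun mu 2%:E.
Proof.
move=> mf fK; apply/Lfun2P; split=> //.
apply: (@le_integrable _ _ _ _ setT _ _ (fun=> (K ^+ 2)%:E)) => //.
- by apply/measurable_EFinP; exact: measurable_funX.
- move=> y _; rewrite lee_fin normrX [leRHS]ger0_norm ?sqr_ge0//.
  by rewrite lerXn2r ?nnegrE// (le_trans _ (fK y)).
- exact: finite_measure_integrable_cst.
Qed.

Lemma Lfun2_along_flow (f : 'rV[R]_d -> R) s : torus_Ck 0 f ->
  (fun y => f (psi s (cube_point y))) \in Lfun (cube_measure d) 2%:E.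
Proof.
move=> [pf cf]; have [K _ KP] := periodic_bounded pf cf.
apply: (@Lfun2_bounded _ _ _ _ K) => [|y]; last exact: KP.
apply: (@measurable_row_comp _ _ R d (fun y => cube_point y) (fun x => f (psi s x))) => [i|x].
  have -> : (fun y : d.-tuple (measurableTypeR R) => cube_point y 0 i) = (fun y => tnth y i).
    by apply/funext => y; rewrite mxE.
  exact: measurable_tnth.
apply: (@continuous_comp _ _ _ (psi s) f); [exact: flow_continuous|exact: cf].
Qed.

End flow_functions.

Section field_bounds.
Context {R : realType} {d : nat}.

Lemma torus_vect_bounds (c : 'rV[R]_d -> 'rV[R]_d) : torus_Ck_vect 1 c -> exists L B : R,
  [/\ 0 < L, forall x y, `|c x - c y| <= L * `|x - y| & forall x, `|c x| <= B].
Proof.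
move=> [pc cC]; have fC i : torus_Ck 1 (fun x => c x 0 i) by split=> // x j; rewrite pc.
have /choice[L LP] i : exists L : R, 0 <= L /\ forall x y, `|c x 0 i - c y 0 i| <= L * `|x - y|.
  by have [L L0 LP] := torus_C1_lipschitz (fC i); exists L.
have /choice[B BP] i : exists B : R, 0 <= B /\ forall x, `|c x 0 i| <= B.
  by have [B B0 BP] := periodic_bounded (fC i).1 (Ck_continuous (fC i).2); exists B.
have L0 i : 0 <= L i by case: (LP i).
have B0 i : 0 <= B i by case: (BP i).
have sum0 (f : 'I_d -> R) : (forall i, 0 <= f i) -> forall i, f i <= \sum_j f j.
  by move=> f0 i; rewrite (bigD1 i)//= lerDl sumr_ge0.
exists (1 + \sum_i L i), (\sum_i B i); split.
- by rewrite ltr_pwDl// sumr_ge0.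
- move=> x y; apply: row_norm_le => [|i].
    by rewrite mulr_ge0// addr_ge0// sumr_ge0.
  rewrite row_subE (le_trans ((LP i).2 x y))// ler_wpM2r//.
  by rewrite (le_trans (sum0 L L0 i))// lerDr.
- move=> x; apply: row_norm_le => [|i]; first by rewrite sumr_ge0.
  exact: le_trans ((BP i).2 x) (sum0 B B0 i).
Qed.

End field_bounds.

(** * The approximating subspaces *)

Section scales.
Context {R : realType}.
Variable p : nat.
Hypothesis p0 : (0 < p)%N.

Definition step_size (eps : R) := eps `^ p%:R^-1.
Definition cutoff (eps : R) := eps `^ (- (2 * p%:R)^-1).
(** One more than the integer part, so that the nodes reach beyond the cutoff on both sides. *)
Definition halfwidth (eps : R) := (Num.truncn (cutoff eps / step_size eps)).+1.

Let pR : (p%:R : R) != 0. Proof. by rewrite pnatr_eq0 -lt0n. Qed.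

Lemma powR_le1 (a r : R) : 0 <= a -> a <= 1 -> 0 <= r -> a `^ r <= 1.
Proof.
move=> a0 a1 r0; have := ge0_ler_powR r0 (_ : a \in Num.nneg) (_ : 1 \in Num.nneg) a1.
by rewrite powR1; apply; rewrite nnegrE.
Qed.

Lemma step_size_gt0 eps : 0 < eps -> 0 < step_size eps.
Proof. exact: powR_gt0. Qed.

Lemma cutoff_gt0 eps : 0 < eps -> 0 < cutoff eps.
Proof. exact: powR_gt0. Qed.

Lemma step_sizeX eps : 0 < eps -> step_size eps ^+ p = eps.
Proof. by move=> e0; rewrite -powR_mulrn ?powR_ge0// -powRrM mulVf// powRr1// ltW. Qed.

(** Where [|r|] exceeds the cutoff, [eps^2 r^(4 p)] is at least 1: a moment of order [4 p] makes the
    squared error there of order [eps^2]. *)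
Lemma cutoffX eps : 0 < eps -> eps ^+ 2 * cutoff eps ^+ (2 * (2 * p)) = 1.
Proof.
move=> e0; rewrite -powR_mulrn ?powR_ge0// -powRrM -(powR_mulrn 2 (ltW e0)) -powRD.
  have -> : 2 + - (2 * p%:R)^-1 * (2 * (2 * p))%:R = 0 :> R by rewrite !natrM; field.
  by rewrite powRr0.
by rewrite (gt_eqF e0) implybT.
Qed.

Lemma nearest_step eps r : 0 < eps -> `|r| <= cutoff eps -> exists2 k, (k < (2 * halfwidth eps).+1)%N &
  `|r - step_size eps * (k%:R - (halfwidth eps)%:R)| <= step_size eps.
Proof.
move=> e0 rM; have h0 := step_size_gt0 e0; set h := step_size eps in h0 *; set N := halfwidth eps.
have NM : cutoff eps <= N%:R * h by rewrite -ler_pdivrMr// ltW// truncnS_gt.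
have rN : `|r| <= N%:R * h := le_trans rM NM.
move: rN; rewrite ler_norml => /andP[r1 r2].
have q0 : 0 <= (r + N%:R * h) / h by rewrite divr_ge0 ?(ltW h0)//; lra.
have /andP[k1 k2] := truncn_itv q0; set k := Num.truncn _ in k1 k2; exists k.
  rewrite ltnS -(ler_nat R) (le_trans k1)// ler_pdivrMr// natrM; lra.
rewrite ler_pdivlMr// in k1; rewrite ltr_pdivrMr// -natr1 in k2.
by rewrite ler_norml; apply/andP; split; lra.
Qed.

Lemma halfwidth_littleo (dim : R -> nat) :
  (forall eps, 0 < eps -> (dim eps <= p * (2 * halfwidth eps).+1)%N) ->
  (fun eps : R => (dim eps)%:R : R^o) =o_ (0^'+) (fun eps => eps `^ (- (2 / p%:R)) : R^o).
Proof.
move=> hdim; apply/eqoP => de de0.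
have p5 : 0 < 5 * p%:R :> R by rewrite mulr_gt0// ltr0n.
(* For [eps <= 1] the quotient [q] of cutoff and step is at least 1, so
   [2 halfwidth + 1 <= 2 q + 3 <= 5 q]. As [q = eps^(1/(2p)) eps^(-2/p)], it suffices that
   [5 p eps^(1/(2p)) <= de]. *)
pose e0 := Num.min 1 ((de / (5 * p%:R)) `^ (2 * p%:R)).
have e00 : 0 < e0 by rewrite lt_min ltr01 powR_gt0// divr_gt0.
near=> eps; have eps0 : 0 < eps by near: eps; exact: nbhs_right_gt.
have : eps <= e0 by near: eps; apply: nbhs_right_le.
rewrite le_min => /andP[eps1 epsd].
rewrite [leLHS]ger0_norm// [X in _ * X]ger0_norm ?powR_ge0//.
have q1 : 1 <= cutoff eps / step_size eps.
  rewrite ler_pdivlMr ?step_size_gt0// mul1r (@le_trans _ _ 1)//.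
    by apply: powR_le1; rewrite ?ltW// invr_gt0 ltr0n.
  by rewrite /cutoff powRN invf_ge1 ?powR_gt0// powR_le1 ?invr_ge0 ?mulr_ge0// ltW.
apply: (@le_trans _ _ (5 * p%:R * (cutoff eps / step_size eps))).
  apply: (@le_trans _ _ (p * (2 * halfwidth eps).+1)%:R); first by rewrite ler_nat hdim.
  rewrite natrM -[5 * _]mulrC -mulrA ler_wpM2l// -natr1 natrM /halfwidth -natr1.
  have := truncn_le (cutoff eps / step_size eps); rewrite (le_trans ler01 q1) => h; lra.
have qE : cutoff eps / step_size eps = eps `^ (2 * p%:R)^-1 * eps `^ (- (2 / p%:R)).
  rewrite /cutoff /step_size -powRN -!powRD; last 2 first.
  - by rewrite (gt_eqF eps0) implybT.
  - by rewrite (gt_eqF eps0) implybT.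
  by congr (_ `^ _); field.
rewrite qE mulrA ler_wpM2r ?powR_ge0// mulrC -ler_pdivlMr//.
have -> : de / (5 * p%:R) = ((de / (5 * p%:R)) `^ (2 * p%:R)) `^ (2 * p%:R)^-1.
  by rewrite -powRrM mulfV ?mulf_neq0// powRr1// divr_ge0// ltW.
rewrite ge0_ler_powR ?nnegrE ?invr_ge0 ?mulr_ge0 ?powR_ge0//; exact: ltW.
Unshelve. all: by end_near. Qed.

End scales.

Section taylor_space.
Context {R : realType} {d : nat}.
Variables (p : nat) (c : 'rV[R]_d -> 'rV[R]_d) (u0 : 'rV[R]_d -> R).
Hypothesis p0 : (0 < p)%N.
Hypothesis hc : torus_Ck_vect p.+1 c.
Hypothesis hu0 : torus_Ck p u0.
Variable psi : R -> 'rV[R]_d -> 'rV[R]_d.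
Hypothesis psiP : forall y, integral_curve c y (psi^~ y).
Notation mu := (@cube_measure R d).

Let hcp : torus_Ck_vect p c := torus_Ck_vect_le (leqnSn p) hc.

Let hc1 : torus_Ck_vect 1 c := torus_Ck_vect_le (ltn0Sn p) hc.

(* Entry [k * p + j] is the [j]-th time derivative of [u0] along the flow at the
   [k]-th node [h * (k - N)]. *)
Definition taylor_family (h : R) N q (y : d.-tuple (measurableTypeR R)) : R :=
  iter (q %% p) (transport c) u0 (psi (h * ((q %/ p)%:R - N%:R)) (cube_point y)).

Lemma taylor_family_Lfun2 h N q : taylor_family h N q \in Lfun mu 2%:E.
Proof.
have [L [B [L0 cL cB]]] := torus_vect_bounds hc1.
apply: (Lfun2_along_flow L0 cL cB psiP).
have qp : (q %% p <= p)%N by rewrite ltnW// ltn_mod.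
exact: torus_Ck_le (leq0n _) (torus_Ck_iter_transport hcp hu0 qp).
Qed.

Lemma solution_Lfun2 s : (fun y => u0 (psi s (cube_point y))) \in Lfun mu 2%:E.
Proof.
have [L [B [L0 cL cB]]] := torus_vect_bounds hc1.
by apply: (Lfun2_along_flow L0 cL cB psiP); exact: torus_Ck_le hu0.
Qed.

(** By minimality of the projection, any competitor in the space bounds the error. Below the cutoff
    it is the Taylor polynomial at the nearest node, with error at most [K h^p = K eps]; beyond the
    cutoff it is 0. A single bound for all [r], polynomial in [r], leaves only a moment of [W t] to
    be estimated. *)
Lemma taylor_space_error : exists K : R, forall eps e m, 0 < eps -> orthonormal_family mu e m ->
  (forall q, (q < p * (2 * halfwidth p eps).+1)%N ->
     L2_span mu e m (taylor_family (step_size p eps) (halfwidth p eps) q)) ->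
  forall r, (\int[mu]_y ((L2_proj mu (L2_span mu e m) (fun y => u0 (psi r (cube_point y))) y -
     u0 (psi r (cube_point y))) ^+ 2)%:E <= ((K * eps ^+ 2) * (1 + r ^+ (2 * (2 * p))))%:E)%E.
Proof.
have [K K0 KP] := flow_taylor hcp hu0.
have [B B0 BP] := periodic_bounded hu0.1 (Ck_continuous hu0.2).
exists (K ^+ 2 + B ^+ 2) => eps e m e0 eo spanP r; have f2 := solution_Lfun2 r.
have Vsub := L2_span_subspace eo; have even : 0 <= r ^+ (2 * (2 * p)) by rewrite exprM exprn_ge0// sqr_ge0.
have reduce (v : d.-tuple (measurableTypeR R) -> R) (b : R) : L2_span mu e m v ->
    (forall y, `|v y - u0 (psi r (cube_point y))| <= b) ->
    (\int[mu]_y ((L2_proj mu (L2_span mu e m) (fun y => u0 (psi r (cube_point y))) y -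
     u0 (psi r (cube_point y))) ^+ 2)%:E <= (b ^+ 2)%:E)%E.
  move=> Vv vb; apply: le_trans (L2_proj_min eo f2 Vv) _.
  apply: (@le_trans _ _ (\int[mu]_y (b ^+ 2)%:E)%E).
    apply: ge0_le_integralW => y; rewrite lee_fin ?sqr_ge0//.
    rewrite -(real_normK (num_real (_ - _))) lerXn2r ?nnegrE//.
    exact: le_trans (vb y).
  rewrite integral_cst//= -[leRHS]mule1 lee_wpmul2l ?lee_fin ?sqr_ge0//.
  exact: (probability_le1 mu measurableT).
have [rM|Mr] := leP `|r| (cutoff p eps).
  have [k kN rk] := nearest_step e0 rM.
  pose h := step_size p eps; pose N := halfwidth p eps; pose s0 := h * (k%:R - N%:R).
  pose v (y : d.-tuple (measurableTypeR R)) := \sum_(j < p) iter j (transport c) u0 (psi s0 (cube_point y)) * (r - s0) ^+ j / j`!%:R.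
  have vE : v = (fun y => \sum_(j < p) ((r - s0) ^+ j / j`!%:R) * taylor_family h N (k * p + j) y).
    apply/funext => y; apply: eq_bigr => j _; rewrite /taylor_family.
    rewrite modnMDl modn_small// divnMDl// divn_small// addn0 -/s0.
    by rewrite -mulrA mulrC.
  have Vv : L2_span mu e m v.
    have Vj j : (j < p)%N -> L2_span mu e m (taylor_family h N (k * p + j)).
      move=> jp; apply: spanP; rewrite [(p * _)%N]mulnC (leq_trans (_ : _ < k.+1 * p)%N)//.
        by rewrite mulSnr ltn_add2l.
      by rewrite leq_mul2r kN orbT.
    rewrite vE; exact: (L2_subspace_sum (fun j => (r - s0) ^+ j / j`!%:R) Vsub Vj).
  apply: le_trans (reduce v (K * eps) Vv _) _.
    move=> y; rewrite distrC; apply: le_trans (KP _ _ (psiP (cube_point y)) r s0) _.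
    rewrite ler_wpM2l// -[leRHS](step_sizeX p0 e0) lerXn2r ?nnegrE//.
    exact: ltW (step_size_gt0 _ e0).
  rewrite lee_fin exprMn -[leLHS]mulr1; apply: ler_pM => //.
  - by rewrite mulr_ge0 ?sqr_ge0.
  - by rewrite ler_wpM2r ?sqr_ge0// lerDl sqr_ge0.
  - by rewrite lerDl.
have [_ V0 _ _] := Vsub; apply: le_trans (reduce (cst 0) B V0 _) _.
  by move=> y; rewrite /= sub0r normrN.
have M0 := cutoff_gt0 p e0.
have rr : cutoff p eps ^+ (2 * (2 * p)) <= r ^+ (2 * (2 * p)).
  have -> : r ^+ (2 * (2 * p)) = `|r| ^+ (2 * (2 * p)) by rewrite -normrX ger0_norm.
  by rewrite lerXn2r ?nnegrE// ?(ltW M0)// ltW.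
have e2 : 0 <= eps ^+ 2 := sqr_ge0 eps.
have er : 1 <= eps ^+ 2 * r ^+ (2 * (2 * p)) by rewrite -(cutoffX p0 e0) ler_wpM2l.
rewrite lee_fin; apply: (@le_trans _ _ ((K ^+ 2 + B ^+ 2) * 1)).
  by rewrite mulr1 lerDr sqr_ge0.
rewrite -mulrA ler_wpM2l ?addr_ge0 ?sqr_ge0// (le_trans er)// ler_wpM2l// lerDr.
exact: ler01.
Qed.

Lemma taylor_space_exists eps : exists z : nat * (nat -> d.-tuple (measurableTypeR R) -> R),
  [/\ (z.1 <= p * (2 * halfwidth p eps).+1)%N, orthonormal_family mu z.2 z.1 &
   forall q, (q < p * (2 * halfwidth p eps).+1)%N ->
     L2_span mu z.2 z.1 (taylor_family (step_size p eps) (halfwidth p eps) q)].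
Proof.
have [m [e [me eo es]]] := gram_schmidt (n := p * (2 * halfwidth p eps).+1)
  (fun q (_ : (q < p * (2 * halfwidth p eps).+1)%N) => taylor_family_Lfun2 (step_size p eps) (halfwidth p eps) q).
by exists (m, e).
Qed.

End taylor_space.

Theorem proposition3p4 (R : realType) (disp : measure_display)
    (Omega : measurableType disp) (P : probability Omega R)
    (F : R -> set (set Omega)) (W : R -> Omega -> R)
    (d p : nat) (T : R)
    (c : 'rV[R]_d -> 'rV[R]_d) (u0 : 'rV[R]_d -> R)
    (u : R -> 'rV[R]_d -> Omega -> R)
    (d_gt0 : (0 < d)%N) (p_gt0 : (1 <= p)%N) (T_gt0 : 0 < T)
    (hF : complete_filtration P F) (hW : brownian_motion P F W)
    (hc : torus_Ck_vect p.+1 c) (hu0 : torus_Ck p u0)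
    (hu : transport_solution P F W c T u0 u) :
  exists (V : R -> set (d.-tuple (measurableTypeR R) -> R))
         (dimV : R -> nat) (eps0 C : R),
    [/\ 0 < eps0,
        (forall eps, 0 < eps < eps0 ->
           [/\ L2_subspace (cube_measure d) (V eps),
               L2_dim (cube_measure d) (V eps) (dimV eps) &
               (L2_norm3 P (cube_measure d) T
                  (fun t w =>
                     L2_proj (cube_measure d) (V eps)
                       (fun y => u t (cube_point y) w)
                     \- (fun y => u t (cube_point y) w))%R
                <= (C * eps)%:E)%E]) &
        (fun eps : R => (dimV eps)%:R : R^o)
          =o_ (0^'+) (fun eps => eps `^ (- (2 / p%:R)) : R^o)].
Proof.
(* As [p >= 1], the field is C^2, so that the correction term [transport c (fun y => c y 0 l)] is
   C^1, hence Lipschitz. *)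
have hc2 : torus_Ck_vect 2 c by exact: torus_Ck_vect_le hc.
have [L [B [L0 cL cB]]] := torus_vect_bounds (torus_Ck_vect_le (leqnSn 1) hc2).
have [psi psiP] := flow_exists L0 cL cB.
have uE := solution_along_flow hF hW hc2 T_gt0 L0 cL cB psiP hu.
have [K KP] := taylor_space_error p_gt0 hc hu0 psiP.
have [z zP] := choice (taylor_space_exists p_gt0 hc hu0 psiP).
pose V eps := L2_span (cube_measure d) (z eps).2 (z eps).1.
(* A bound on the moment of order [4 p] of [W t], uniform for [t] in [[0, T]]. *)
pose b : R := (4 * (2 * p)%:R) ^+ (2 * p) * (3 / 2) * T ^+ (2 * p).
have b0 : 0 <= b.
  by rewrite !mulr_ge0// ?exprn_ge0// ?(ltW T_gt0)// ?invr_ge0// mulr_ge0.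
pose K1 := Num.max K 0; have K10 : 0 <= K1 by rewrite le_max lexx orbT.
(* [K1 (1 + b)] bounds the mean square error at a fixed time divided by [eps^2], and [2 T] comes
   from [mean_time_integral]. *)
pose C := Num.sqrt (2 * T * (K1 * (1 + b))).
have C20 : 0 <= 2 * T * (K1 * (1 + b)) by rewrite !mulr_ge0 ?addr_ge0// ltW.
exists V, (fun eps => (z eps).1), 1, C; split=> //; last first.
  by apply: halfwidth_littleo => // eps _; case: (zP eps).
move=> eps /andP[e0 _]; have [_ eo es] := zP eps; split.
- exact: L2_span_subspace.
- exact: L2_span_dim.
apply: L2_norm3_le; first by rewrite mulr_ge0 ?sqrtr_ge0// ltW.
pose phi (r : R) := K1 * eps ^+ 2 * (1 + r ^+ (2 * (2 * p))).
have even (r : R) : 0 <= r ^+ (2 * (2 * p)) by rewrite exprM exprn_ge0// sqr_ge0.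
have -> : (C * eps) ^+ 2 = 2 * T * (K1 * eps ^+ 2 * (1 + b)).
  by rewrite exprMn sqr_sqrtr//; ring.
apply: (@mean_time_integral _ _ _ P F W hW T T_gt0 phi _ (fun t w => \int[cube_measure d]_y
  ((L2_proj (cube_measure d) (V eps) (fun y => u t (cube_point y) w) y - u t (cube_point y) w) ^+ 2)%:E)%E).
- move=> r; apply: cvgM; first exact: cvg_cst.
  by apply: cvgD; [exact: cvg_cst|exact: exprn_continuous].
- by move=> r; rewrite /phi mulr_ge0 ?addr_ge0// mulr_ge0 ?sqr_ge0.
- move=> t /andP[t0 tT]; apply: mean_leZ; first by rewrite mulr_ge0 ?sqr_ge0.
  have p2 : (0 < 2 * p)%N by rewrite muln_gt0.
  have mom : mean_le P (fun w => W t w ^+ (2 * (2 * p))) b.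
    have mWt := bm_moment hF hW t0 p2; have [mm _ _] := mWt.
    apply: mean_leW mWt => // [w|]; first by rewrite even lexx.
    rewrite ler_wpM2l//; last by rewrite lerXn2r ?nnegrE// (le_trans t0).
  apply: mean_leD mom; split=> //; rewrite integral_cst// mul1e.
  exact: (probability_le1 P measurableT).
- by move=> t w; apply: integral_ge0 => y _; rewrite lee_fin sqr_ge0.
- apply: filterS uE => w uw t tT.
  have -> : (fun y => u t (cube_point y) w) = (fun y : d.-tuple (measurableTypeR R) => u0 (psi (W t w) (cube_point y))).
    by apply/funext => y; exact: uw.
  under eq_integral do rewrite uw//.
  apply: le_trans (KP eps _ _ e0 eo es (W t w)) _; rewrite lee_fin /phi.
  by rewrite ler_wpM2r ?addr_ge0// ler_wpM2r ?sqr_ge0// le_max lexx.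
Qed.
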